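(* Fix an integer $\gamma\ge 1$ and $\beta>0$, and consider the sequence of inventory systems indexed by the demand rate $r\to\infty$, with exponentially distributed lead times of mean $1/\beta$, operating under the GBS policy with parameters $\gamma$, $f=f(r)$, $x_*=x_*(r)$, where $f(r)>0$, $f(r)/r\to 0$ and $f(r)/\sqrt r\to\infty$, and where $x_*(r)\in\mathbb R$ depends on $r$ arbitrarily. Then the process $(Y^r(t),Z^r(t))$, $t\ge 0$, is an irreducible continuous-time countable Markov chain, and for any sufficiently large $r$ it is positive recurrent, and therefore has a unique stationary distribution. Moreover, as $r\to\infty$, $$\frac{Y^r(\infty)-x_*(r)}{\sqrt r}\ \Rightarrow\ \mathcal N\bigl(0,(\beta\gamma)^{-1}\bigr),$$ and the expectations of the positive and negative parts converge to the corresponding expectations for $\mathcal N(0,(\beta\gamma)^{-1})$: $$\mathbb E\left[\frac{Y^r(\infty)-x_*(r)}{\sqrt r}\right]^+\to (2\pi)^{-1/2}(\beta\gamma)^{-1/2},\qquad \mathbb E\left[\frac{Y^r(\infty)-x_*(r)}{\sqrt r}\right]^-\to (2\pi)^{-1/2}(\beta\gamma)^{-1/2}.$$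
   Context: Notation: $a\vee b=\max\{a,b\}$, $a\wedge b=\min\{a,b\}$, $a^+=a\vee 0$, $a^-=(-a)^+$; $\lceil a\rceil$ is the smallest integer $\ge a$; $\Rightarrow$ is convergence in distribution; $\mathcal N(m,\sigma^2)$ is a normal random variable with mean $m$ and variance $\sigma^2$. The parameter $r$ runs along an increasing sequence of positive reals tending to infinity. Model. Demand units (customers) arrive as a Poisson process of rate $r$. Each ordered supply unit (item) arrives after a lead time; lead times are i.i.d. (and independent of demand), here exponential with mean $1/\beta$. $Y^r(t)\in\mathbb Z$ is the net inventory level (inventory on hand minus backlog) and $Z^r(t)\in\mathbb Z_+$ is the number of in-transit items (ordered, not yet arrived). GBS policy with parameters $\gamma>0$, $f>0$, $x_*\in\mathbb R$. Let $X_*^r=r/\beta$, and for a net inventory level $y$ let $X^r=X_*^r-\gamma(y-x_* )$ (target) and $T^r(y)=[X^r\wedge(X_*^r+f)]\vee 0$ (truncated target). The policy acts only at customer and item arrival times. At such a time: (1) a customer arrival changes $Y:=Y-1$; an item arrival changes $Y:=Y+1$, $Z:=Z-1$; (2) $T$ is recomputed from the new $Y$; (3) $A=\lceil T-Z\rceil\vee 0$ new items are ordered, $Z:=Z+A$. Thus with exponential lead times $(Y^r(t),Z^r(t))$ is a continuous-time Markov chain with transitions $$(y,z)\to\bigl(y-1,\ z\vee\lceil T^r(y-1)\rceil\bigr)\ \text{at rate } r,\qquad (y,z)\to\bigl(y+1,\ (z-1)\vee\lceil T^r(y+1)\rceil\bigr)\ \text{at rate }\beta z .$$ The state space is the set of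 states reachable from the states $(y,\lceil X_*^r+f\rceil)$ with $y$ sufficiently negative (states outside this set are transient). In the system with parameter $r$, $f=f(r)$ and $x_*=x_*(r)$. $(Y^r(\infty),Z^r(\infty))$ denotes the random state of the process in its stationary regime. *)

(* Defs.v *)
From HB Require Import structures.
From mathcomp Require Import all_boot all_order all_algebra.
From mathcomp Require Import all_classical all_reals all_analysis.

Set Implicit Arguments.
Unset Strict Implicit.
Unset Printing Implicit Defensive.

Import Order.TTheory GRing.Theory Num.Theory.
Import numFieldNormedType.Exports.

Local Open Scope classical_set_scope.
Local Open Scope ring_scope.

(* A state is (net inventory level, number of in-transit items). The type is
   countable and carries the discrete sigma-algebra. *)
Definition state : Type := (int * nat)%type.

HB.instance Definition _ := Countable.on state.
HB.instance Definition _ := isPointed.Build state (0 : int, 0%N).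
HB.instance Definition _ := @isMeasurable.Build default_measure_display
  state discrete_measurable discrete_measurable0
  discrete_measurableC discrete_measurableU.

Section markov_chain.
Context {R : realType}.
Implicit Types (S : set state) (Q : state -> state -> R)
  (P : R -> state -> state -> R).

(* P t i j (t >= 0; i, j in S) are the transition probabilities of an honest
   continuous-time Markov chain on S with matrix of transition rates Q, whose
   diagonal entries are minus the total exit rates. *)
Record is_ctmc S Q P : Prop := IsCTMC {
  ctmc_ge0 : forall t i j, 0 <= t -> S i -> S j -> 0 <= P t i j ;
  ctmc_mass : forall t i, 0 <= t -> S i -> \esum_(j in S) (P t i j)%:E = 1%E ;
  ctmc_0 : forall i j, S i -> S j -> P 0 i j = (j == i)%:R ;
  ctmc_semigroup : forall s t i j, 0 <= s -> 0 <= t -> S i -> S j ->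
    \esum_(k in S) (P s i k * P t k j)%:E = (P (s + t) i j)%:E ;
  ctmc_rates : forall i j, S i -> S j ->
    (P h i j - (j == i)%:R) / h @[h --> 0^'+] --> Q i j }.

Definition irreducible S P :=
  forall i j, S i -> S j -> exists2 t, 0 <= t & 0 < P t i j.

Definition stationary S P (mu : probability state R) :=
  mu S = 1%E /\
  forall t j, 0 <= t -> S j -> (\int[mu]_(i in S) (P t i j)%:E)%E = mu [set j].

(* For l = [:: (t1, j1); ...; (tn, jn)], the product
   P (t1 - t) i j1 * P (t2 - t1) j1 j2 * ... * P (tn - t(n-1)) j(n-1) jn. *)
Fixpoint path_prob P (t : R) (i : state) (l : seq (R * state)) : R :=
  if l is (u, j) :: l' then P (u - t) i j * path_prob P u j l' else 1.

(* X is a realization of the chain started at i: a process with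
   right-continuous paths with left limits (in the discrete topology) and the
   finite-dimensional distributions given by P. Only times t >= 0 matter. *)
Record is_realization S P (i : state) d (W : measurableType d)
    (Pr : probability W R) (X : R -> W -> state) : Prop := IsRealization {
  real_space : forall t w, 0 <= t -> S (X t w) ;
  real_meas : forall t, 0 <= t -> measurable_fun setT (X t) ;
  real_start : forall w, X 0 w = i ;
  real_right : forall w t, 0 <= t -> \forall s \near t^'+, X s w = X t w ;
  real_left : forall w t, 0 < t -> exists j, \forall s \near t^'-, X s w = j ;
  real_fdd : forall l : seq (R * state),
    path <=%R 0 [seq p.1 | p <- l] -> (forall p, p \in l -> S p.2) ->
    Pr [set w | all (fun p => X p.1 w == p.2) l] = (path_prob P 0 i l)%:E }.

(* First time at which the path is at i after having been elsewhere;
   +oo if this never happens. *)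
Definition return_time (X : R -> state) (i : state) : \bar R :=
  ereal_inf [set t%:E | t in
    [set t | X t = i /\ exists s, [/\ 0 <= s, s < t & X s <> i]]].

(* The mean return times are finite. The expectation only depends on P and i,
   not on the realization; return_time is measurable by regularity of paths. *)
Definition positive_recurrent S P :=
  forall i, S i ->
  forall d (W : measurableType d) (Pr : probability W R) (X : R -> W -> state),
    is_realization S P i Pr X ->
    (\int[Pr]_w return_time (X ^~ w) i < +oo)%E.

End markov_chain.

(* Convergence in distribution of the random variables X n, each on its own
   probability space (T, mu n), to the law nu: convergence of the distribution
   functions at the continuity points of the limit. *)
Definition cvg_in_distribution {R : realType} d (T : measurableType d)
    (mu : nat -> probability T R) (X : nat -> T -> R)
    (nu : probability (measurableTypeR R) R) :=
  forall x : R, {for x, continuous (fun y : R => nu `]-oo, y]%classic)} ->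
    mu n [set w | X n w <= x] @[n --> \oo] --> nu `]-oo, x]%classic.

(* An inventory system with unit demands arriving at rate demand_rate and
   i.i.d. exponential lead times of mean 1 / lead_rate. At each customer or item
   arrival, items are ordered so as to raise the number z of in-transit items to
   the ceiling of the target truncated_target y, if z is below it, where y is
   the updated net inventory level. *)
Record gbs (R : realType) := GBS {
  demand_rate : R ;
  lead_rate : R ;
  gbs_gamma : R ;
  gbs_f : R ;
  gbs_xstar : R }.

Section gbs_model.
Context {R : realType} (g : gbs R).

Definition base_target : R := demand_rate g / lead_rate g.

Definition truncated_target (y : int) : R :=
  Num.max (Num.min (base_target - gbs_gamma g * (y%:~R - gbs_xstar g))
                   (base_target + gbs_f g)) 0.

(* The targets are nonnegative, hence so are their ceilings. *)
Definition target_ceil (y : int) : nat := `|Num.ceil (truncated_target y)|%N.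

Definition after_demand (s : state) : state :=
  (s.1 - 1, maxn s.2 (target_ceil (s.1 - 1))).

(* Only occurs at positive rate when s.2 > 0. *)
Definition after_arrival (s : state) : state :=
  (s.1 + 1, maxn s.2.-1 (target_ceil (s.1 + 1))).

Definition rate (s s' : state) : R :=
  (s' == after_demand s)%:R * demand_rate g +
  (s' == after_arrival s)%:R * (lead_rate g * s.2%:R).

(* rate s s = 0, since every transition changes the net inventory level. *)
Definition generator (s s' : state) : R :=
  if s' == s then - (demand_rate g + lead_rate g * s.2%:R) else rate s s'.

Definition reachable (s s' : state) :=
  exists2 p : seq state, path (fun u v => 0 < rate u v) s p & last s p = s'.

(* The states reachable from (y, ceil (base_target + f)) for all y
   sufficiently negative. *)
Definition state_space : set state :=
  [set s | exists y0 : int, forall y : int, y <= y0 ->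
     reachable (y, `|Num.ceil (base_target + gbs_f g)|%N) s].

Definition scaled_level (s : state) : R :=
  (s.1%:~R - gbs_xstar g) / Num.sqrt (demand_rate g).

End gbs_model.

(* Main.v *)
(** The number z of in-transit items is bounded by the ceiling of the maximal
    target, so the rates are bounded and the semigroup is built by
    uniformization. For y very negative the chain is a birth and death chain with
    upward drift, which yields an invariant law; irreducibility gives its
    uniqueness, and Kac's argument for the skeleton chains bounds the mean
    return times.

    For the limit, put w = z - r/beta + gamma (y - x_* ). Test functions of the
    distance of z to the target show that E|w| = O(1 + r/f), which is
    o(sqrt r). Since beta z - r = beta w - beta gamma (y - x_* ), testing
    stationarity on functions of x = (y - x_* )/sqrt r is Stein's method for the
    normal law of variance 1/(beta gamma): solving Stein's equation for the
    function (x - a)^+ gives the convergence of E(x - a)^+ for every a. The case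
    a = 0 is the claim on positive parts, E x -> 0 (as E z = r/beta) gives the
    negative parts, and the convexity of a |-> E(x - a)^+ turns the convergence
    of these functions into that of their derivatives, the tail probabilities. *)

Require Import Defs.
From HB Require Import structures.
From mathcomp Require Import all_boot all_order all_algebra.
From mathcomp Require Import all_classical all_reals all_analysis.
From mathcomp Require Import measurable_realfun ring lra zify.

Set Implicit Arguments.
Unset Strict Implicit.
Unset Printing Implicit Defensive.

Import Order.TTheory GRing.Theory Num.Theory.
Import numFieldNormedType.Exports.

Local Open Scope classical_set_scope.
Local Open Scope ring_scope.

(** * Sums and integrals over a countable state space *)

(** A semigroup [P] is known only through its derivatives at 0, so everything passes through the
    balance equations [balanced], which involve the rates alone: an invariant law is built from
    them, the moments are estimated from them, and they are equivalent to stationarity for every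
    semigroup with these rates. No moment of a stationary law is known in advance, so each test
    function is cut off and the cut is removed by dominated or monotone convergence.

    The size of w has two sources. Where the target is capped, z equals the cap, so the drift beta z
    - r of y is at least beta f; this keeps the untruncated target from exceeding the cap by more
    than O(r/f) on average. Where z exceeds the target, a demand shrinks the gap by gamma (down to 0
    at most) and an arrival widens it by at most gamma - 1, while arrivals are hardly faster than
    demands because f = o(r): the squared gap has a negative drift of order r times the gap, and the
    mean gap is O(1). The difference between gamma and gamma - 1 is the item that leaves transit. *)

Section esum_extra.
Context {R : realType} {T : choiceType}.
Implicit Types (I J : set T) (a b : T -> \bar R).
Local Open Scope ereal_scope.

Lemma subset_esum I J a : I `<=` J -> \esum_(i in I) a i <= \esum_(i in J) a i.
Proof.
move=> IJ; apply: ereal_sup_le => _ [A [finA AI] <-].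
by exists A => //; split=> //; exact: subset_trans AI IJ.
Qed.

Lemma esum_ge_seq I a (s : seq T) : (forall i, I i -> 0 <= a i) ->
  uniq s -> {in s, forall i, I i} -> \sum_(i <- s) a i <= \esum_(i in I) a i.
Proof.
move=> a0 us sI; apply: esum_ge; exists [set` s].
  by split=> [|i /=]; [exact: finite_seq | exact: sI].
by rewrite fsbig_seq.
Qed.

Lemma esum_ge1 I a x : (forall i, I i -> 0 <= a i) -> I x ->
  a x <= \esum_(i in I) a i.
Proof.
move=> a0 Ix; have := @esum_ge_seq I a [:: x] a0; rewrite big_seq1; apply=> //.
by move=> i; rewrite inE => /eqP ->.
Qed.

Lemma esum_seq I a (s : seq T) : (forall i, I i -> 0 <= a i) ->
  uniq s -> {in s, forall i, I i} -> (forall i, I i -> i \notin s -> a i = 0) ->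
  \esum_(i in I) a i = \sum_(i <- s) a i.
Proof.
move=> a0 us sI as0; apply/eqP; rewrite eq_le esum_ge_seq// andbT.
rewrite (esumID [set` s])//.
rewrite [X in _ + X]esum1 ?adde0; last by move=> i [Ii /negP]; exact: as0.
rewrite setIidr; last by move=> i /= /sI.
rewrite esum_fset//; last by move=> i /set_mem /= /sI; exact: a0.
by rewrite -fsbig_seq//.
Qed.

Lemma esum_only I a x : (forall i, I i -> 0 <= a i) -> I x ->
  (forall i, I i -> i != x -> a i = 0) -> \esum_(i in I) a i = a x.
Proof.
move=> a0 Ix h; rewrite (@esum_seq I a [:: x])// ?big_seq1//.
  by move=> i; rewrite inE => /eqP ->.
by move=> i Ii; rewrite inE; exact: h.
Qed.

Let esumZl_le I a (c : R) : (forall i, I i -> 0 <= a i) -> (0 <= c)%R ->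
  \esum_(i in I) (c%:E * a i) <= c%:E * \esum_(i in I) a i.
Proof.
move=> a0 c0; apply: ge_ereal_sup => _ [A [finA AI] <-].
rewrite -(@eq_fsbigr _ _ _ _ (fun i => c%:E * (if i \in A then a i else 0))); last first.
  by move=> i ->.
rewrite -ge0_mule_fsumr; last first.
  by move=> i; case: ifPn => // /set_mem /AI /a0.
rewrite (@eq_fsbigr _ _ _ _ _ a); last by move=> i ->.
by apply: lee_wpmul2l; [rewrite lee_fin | apply: esum_ge; exists A].
Qed.

Lemma esumZl I a (c : R) : (forall i, I i -> 0 <= a i) -> (0 <= c)%R ->
  \esum_(i in I) (c%:E * a i) = c%:E * \esum_(i in I) a i.
Proof.
move=> a0; rewrite le_eqVlt => /predU1P[<-|c0].
  by rewrite mul0e esum1// => i _; rewrite mul0e.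
apply/eqP; rewrite eq_le (esumZl_le a0 (ltW c0))/=.
have ci : (0 <= c^-1)%R by rewrite invr_ge0 ltW.
have := @esumZl_le I (fun i => c%:E * a i) c^-1 _ ci.
under eq_esum do rewrite muleA -EFinM mulVf ?gt_eqF// mul1e.
move=> /(_ (fun i Ii => mule_ge0 (ltW (c0 : (0 < c%:E))) (a0 i Ii))) h.
have := lee_wpmul2l (ltW (c0 : (0 < c%:E))) h.
by rewrite muleA -EFinM mulfV ?gt_eqF// mul1e.
Qed.

Lemma esum_ge0_finP I (a : T -> R) : (forall i, I i -> 0 <= a i)%R ->
  \esum_(i in I) (a i)%:E < +oo -> \esum_(i in I) (a i)%:E \is a fin_num.
Proof. by move=> a0 h; rewrite ge0_fin_numE// esum_ge0// => i /a0; rewrite lee_fin. Qed.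

(** The gaps [b i - a i] are nonnegative and their sum is at most 0. This is how subinvariance is
    upgraded to invariance, both for existence and for uniqueness of the stationary law. *)
Lemma esum_eq_mass I (a b : T -> R) : (forall i, I i -> 0 <= a i <= b i)%R ->
  \esum_(i in I) (a i)%:E < +oo ->
  \esum_(i in I) (b i)%:E <= \esum_(i in I) (a i)%:E ->
  forall i, I i -> a i = b i.
Proof.
move=> ab fa ba i Ii.
have a0 j : I j -> (0 <= a j)%R by move/ab => /andP[].
have fina := esum_ge0_finP a0 fa.
have e : \esum_(i in I) (b i)%:E =
    \esum_(i in I) (a i)%:E + \esum_(i in I) (b i - a i)%:E.
  rewrite -esumD; first by apply: eq_esum => j _; rewrite -EFinD addrC subrK.
  - by move=> j /a0; rewrite lee_fin.
  - by move=> j /ab /andP[_]; rewrite lee_fin subr_ge0.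
have ba0 j : I j -> 0 <= (b j - a j)%:E.
  by move=> /ab /andP[_]; rewrite lee_fin subr_ge0.
have : \esum_(i in I) (b i - a i)%:E <= 0.
  by move: ba; rewrite e -[leRHS]adde0 leeD2lE.
move=> /(le_trans (esum_ge1 ba0 Ii)); rewrite lee_fin subr_le0 => bai.
by apply/eqP; rewrite eq_le bai andbT; case/andP: (ab _ Ii).
Qed.

End esum_extra.

Section esum_exchange.
Context {R : realType} {T1 T2 : choiceType}.
Local Open Scope ereal_scope.

Lemma esum_exchange (I : set T1) (J : set T2) (a : T1 -> T2 -> \bar R) :
  (forall i j, I i -> J j -> 0 <= a i j) ->
  \esum_(i in I) \esum_(j in J) a i j = \esum_(j in J) \esum_(i in I) a i j.
Proof.
move=> a0; rewrite !esum_esum//; last by move=> j i Jj Ii; exact: a0.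
rewrite (@reindex_esum _ _ _ (J `*`` (fun=> I)) (I `*`` (fun=> J))
  (fun p => (p.2, p.1)) (fun p => a p.1 p.2))//.
split=> [[j i] [/= ]//|[j i] [j' i'] _ _ [-> ->]//|[i j] [/= Ii Jj]].
by exists (j, i).
Qed.

End esum_exchange.

Section integral_esum.
Local Open Scope ereal_scope.

(** Slicing [D] by the codes [pickle i] gives a sequence of sets with at most one point each, to
    which additivity over the natural numbers applies. *)
Lemma integral_esum {R : realType} (mu : {measure set state -> \bar R})
    (D : set state) (f : state -> \bar R) : (forall i, D i -> 0 <= f i)%E ->
  (\int[mu]_(i in D) f i = \esum_(i in D) (f i * mu [set i])).
Proof.
move=> f0.
pose F n := D `&` [set i | pickle i = n].
have DF : D = \bigcup_n F n.
  by apply/seteqP; split=> [i Di|i [n _ []]//]; exists (pickle i).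
have tF : trivIset setT F.
  by apply/trivIsetP => m n _ _ mn; apply/seteqP; split=> // i [[_ /= e1] [_ /= e2]]; rewrite -e1 -e2 eqxx in mn.
have -> : \int[mu]_(i in D) f i = \int[mu]_(i in \bigcup_n F n) f i by rewrite -DF.
rewrite ge0_integral_bigcup//; last first.
  by move=> i [n _ [Di _]]; exact: f0.
transitivity (\esum_(n in [set: nat]) \int[mu]_(x in F n) f x).
  rewrite nneseries_esumT// => n; apply: integral_ge0 => i [Di _]; exact: f0.
have -> : \esum_(i in D) (f i * mu [set i]) = \esum_(i in \bigcup_n F n) (f i * mu [set i]) by rewrite -DF.
rewrite esum_bigcup; first last.
- move=> i [n _ [Di _]]; rewrite mule_ge0// f0//.
- by apply: sub_trivIset tF.
apply: eq_esum => n _.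
have [->|/set0P[x Fx]] := eqVneq (F n) set0.
  by rewrite integral_set0 esum_set0.
have -> : F n = [set x].
  apply/seteqP; split=> [y [Dy /= py]|y -> //].
  by case: Fx => _ /= px; apply: (pcan_inj pickleK); rewrite px.
rewrite esum_set1; last by rewrite mule_ge0// f0//; case: Fx.
rewrite -(integral_cst mu)//.
by apply: eq_integral => y /set_mem ->.
Qed.

End integral_esum.

Section integral_state.
Context {R : realType} (mu : probability state R).
Implicit Types (D : set state) (f : state -> R).

Lemma measurable_state d (U : measurableType d) D (f : state -> U) : measurable_fun D f.
Proof. by []. Qed.

Lemma bounded_integrable D f (C : R) : (forall i, D i -> `|f i| <= C) ->
  mu.-integrable D (EFin \o f).
Proof.
move=> fC; apply: measurable_bounded_integrable => //.
  by rewrite (le_lt_trans (probability_le1 mu _))// ltry.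
exists C; split; first exact: num_real.
by move=> x Cx i /= Di; rewrite (le_trans (fC i Di))// ltW.
Qed.

Lemma integrableB_EFin D (f h : state -> R) : mu.-integrable D (EFin \o f) ->
  mu.-integrable D (EFin \o h) -> mu.-integrable D (EFin \o (fun i => f i - h i)).
Proof. by move=> if_ ih; exact: (integrableB _ if_ ih). Qed.

Lemma integrableD_EFin D (f h : state -> R) : mu.-integrable D (EFin \o f) ->
  mu.-integrable D (EFin \o h) -> mu.-integrable D (EFin \o (fun i => f i + h i)).
Proof. by move=> if_ ih; exact: (integrableD _ if_ ih). Qed.

Lemma integrableZ_EFin D (k : R) (f : state -> R) : mu.-integrable D (EFin \o f) ->
  mu.-integrable D (EFin \o (fun i => k * f i)).
Proof. by move=> if_; exact: (integrableZl _ k if_). Qed.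

Lemma Rintegral_dominated D (f_ : nat -> state -> R) f (C : R) :
  (forall n i, D i -> `|f_ n i| <= C) ->
  (forall i, D i -> f_ n i @[n --> \oo] --> f i) ->
  \int[mu]_(i in D) f_ n i @[n --> \oo] --> \int[mu]_(i in D) f i.
Proof.
move=> fC ff; apply: fine_cvg.
have mD : measurable D by [].
have [|||||_ _ h] := @dominated_convergence _ _ _ mu D mD (fun n i => (f_ n i)%:E)
    (EFin \o f) (cst C%:E).
- by [].
- by [].
- by apply: aeW => i Di; apply: cvg_EFin; [exact: nearW|exact: ff].
- exact: (@bounded_integrable D (cst C) `|C|).
- by apply: aeW => i n Di; rewrite lee_fin fC.
rewrite fineK//; apply: integrable_fin_num => //.
have fb i : D i -> `|f i| <= C.
  move=> Di; apply: (cvgr_to_le (cvg_norm (ff i Di))).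
  by apply: nearW => n; exact: fC.
exact: bounded_integrable fb.
Qed.

Lemma Rintegral_point D j (a : R) : 0 <= a -> D j ->
  \int[mu]_(i in D) ((i == j)%:R * a) = fine (mu [set j]) * a.
Proof.
move=> a0 Dj; rewrite /Rintegral integral_esum; last first.
  by move=> i _; rewrite lee_fin mulr_ge0.
rewrite (@esum_only _ _ _ _ j)//.
- rewrite eqxx mul1r fineM//; first by rewrite mulrC.
  exact: fin_num_measure.
- by move=> i _; rewrite mule_ge0// lee_fin mulr_ge0.
- by move=> i _ /negbTE ->; rewrite mul0r mul0e.
Qed.

Lemma Rintegral_eq D j : D j -> \int[mu]_(i in D) (i == j)%:R = fine (mu [set j]).
Proof.
move=> Dj; rewrite -[RHS]mulr1 -(Rintegral_point ler01 Dj).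
by apply: eq_Rintegral => i _; rewrite mulr1.
Qed.

Lemma esum_prob D : (\esum_(i in D) (fine (mu [set i]))%:E = mu D)%E.
Proof.
rewrite -[RHS]mul1e -(integral_cst mu)// integral_esum; last by move=> *; exact: lee01.
by apply: eq_esum => i _; rewrite mul1e fineK// fin_num_measure.
Qed.

Lemma prob_support D (A : set state) : mu D = 1%E -> mu A = mu (A `&` D).
Proof.
move=> D1; have nD : mu (~` D) = 0%E by rewrite probability_setC// D1 subee.
have mD (B : set state) : measurable B by [].
rewrite (measureDI mu (mD A) (mD D)) -[RHS]add0e; congr (_ + _)%E.
apply/eqP; rewrite eq_le measure_ge0 andbT -nD.
by apply: le_measure; rewrite ?inE//; move=> x [].
Qed.

Lemma Rintegral_cst1 D (a : R) : mu D = 1%E -> \int[mu]_(i in D) a = a.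
Proof. by move=> D1; rewrite /Rintegral (integral_cst mu) //= [X in (_ * X)%E]D1 mule1. Qed.

End integral_state.

Lemma measure_bigcup_state {R : realType} d (W : measurableType d)
    (nu : {measure set W -> \bar R}) (D : set state) (G : state -> set W) :
  (forall j, D j -> measurable (G j)) -> trivIset D G ->
  nu (\bigcup_(j in D) G j) = (\esum_(j in D) nu (G j))%E.
Proof.
move=> mG tG; pose F n := D `&` [set i | pickle i = n].
have DF : D = \bigcup_n F n.
  by apply/seteqP; split=> [i Di|i [n _ []]//]; exists (pickle i).
have tF : trivIset setT F.
  by apply/trivIsetP => m n _ _ mn; apply/seteqP; split=> // i [[_ /= e1] [_ /= e2]]; rewrite -e1 -e2 eqxx in mn.
have FE n : F n = set0 \/ exists2 x, D x & F n = [set x].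
  have [->|/set0P[x Fx]] := eqVneq (F n) set0; [by left|right; exists x].
    by case: Fx.
  apply/seteqP; split=> [y [Dy /= py]|y -> //].
  by case: Fx => _ /= px; apply: (pcan_inj pickleK); rewrite px.
have tFG : trivIset setT (fun n => \bigcup_(j in F n) G j).
  apply/trivIsetP => m n _ _ mn.
  case: (FE m) => [->|[x Dx Fx]]; first by rewrite bigcup_set0 set0I.
  case: (FE n) => [->|[y Dy Fy]]; first by rewrite bigcup_set0 setI0.
  rewrite Fx Fy !bigcup_set1; move/trivIsetP : tG; apply=> //.
  apply: contra_neq mn => xy.
  have : F m x by rewrite Fx.
  have : F n x by rewrite Fy xy.
  by move=> [_ /= <-] [_ /= <-].
have mF n : measurable (\bigcup_(j in F n) G j).
  case: (FE n) => [->|[x Dx ->]]; first by rewrite bigcup_set0.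
  by rewrite bigcup_set1; exact: mG.
rewrite [in LHS]DF bigcup_bigcup measure_semi_bigcup//; last exact: bigcupT_measurable.
rewrite [in RHS]DF esum_bigcup; first last.
- by move=> j _; exact: measure_ge0.
- by apply: sub_trivIset tF.
rewrite nneseries_esumT; last by move=> n; exact: measure_ge0.
apply: eq_esum => n _; case: (FE n) => [->|[x Dx ->]].
  by rewrite bigcup_set0 measure0 esum_set0.
by rewrite bigcup_set1 esum_set1//; exact: measure_ge0.
Qed.

(* The integral of a nonnegative function, measurable or not, is a supremum over
   the simple functions below it. *)
Lemma ge0_le_integralT {R : realType} d (W : measurableType d)
    (nu : {measure set W -> \bar R}) (f1 f2 : W -> \bar R) :
  (forall w, 0 <= f1 w)%E -> (forall w, f1 w <= f2 w)%E ->
  (\int[nu]_w f1 w <= \int[nu]_w f2 w)%E.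
Proof.
move=> f10 f12; have f20 w : (0 <= f2 w)%E by exact: le_trans (f12 w).
rewrite !ge0_integralTE//; apply: ereal_sup_le => _ [h hf <-].
by exists h => // t; exact: le_trans (hf t) (f12 t).
Qed.

Section esum_nat.
Context {R : realType}.
Local Open Scope ereal_scope.

(** The rearrangement behind Cauchy products; it makes Poisson weights convolve in the semigroup
    property of the uniformized chain. *)
Lemma esum_antidiagonal (F : nat -> nat -> \bar R) : (forall n m, 0 <= F n m) ->
  \esum_(n in [set: nat]) \esum_(m in [set: nat]) F n m =
  \esum_(n in [set: nat]) \sum_(k < n.+1) F k (n - k)%N.
Proof.
move=> F0; rewrite esum_esum//.
transitivity (\esum_(n in [set: nat]) \esum_(k in `I_n.+1) F k (n - k)%N); last first.
  apply: eq_esum => n _; rewrite esum_fset; [|exact: finite_II|by move=> k _; exact: F0].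
  by rewrite -fsbig_ord.
rewrite esum_esum//.
rewrite (@reindex_esum _ _ _ ([set: nat] `*`` (fun n => `I_n.+1)) _
  (fun p => (p.2, p.1 - p.2)%N))//.
split.
- by move=> [n k] _.
- move=> [n k] [n' k']; rewrite !inE => -[/= _ kn] [/= _ kn'] [e1 e2]; congr pair => //.
  by move: kn kn' => /=; lia.
- move=> [n m] _; exists (n + m, n)%N; first by split=> //=; lia.
  by congr pair => /=; lia.
Qed.

Lemma esum_poisson (x : R) : (0 <= x)%R ->
  \esum_(n in [set: nat]) (expR (- x) * (x ^+ n / n`!%:R))%:E = 1.
Proof.
move=> x0; have t0 n : (0 <= x ^+ n / n`!%:R)%R by rewrite divr_ge0// exprn_ge0.
under eq_esum do rewrite EFinM.
rewrite esumZl ?expR_ge0//; last by move=> n _; rewrite lee_fin.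
rewrite -nneseries_esumT; last by move=> n; rewrite lee_fin.
have -> : \sum_(n <oo) (x ^+ n / n`!%:R)%:E = (expR x)%:E.
  apply/cvg_lim => //; rewrite /expR.
  rewrite (_ : (fun n => _) = EFin \o series (exp_coeff x)); last first.
    by apply/funext => n /=; rewrite sumEFin.
  by apply: cvg_EFin; [exact: nearW|exact: is_cvg_series_exp_coeff].
by rewrite -EFinM -expRD addNr expR0.
Qed.

End esum_nat.

Section finite_stationary.
Context {R : realType} (V : finType) (p : V -> V -> R) (v0 : V).
Context (p_ge0 : forall i j, 0 <= p i j) (p_sum : forall i, \sum_j p i j = 1).

(* The absolute value of a left null vector of p - 1 is subinvariant, hence
   invariant since p preserves the total mass. *)
Lemma finite_stationary : exists m : V -> R,
  [/\ forall i, 0 <= m i, \sum_i m i = 1 & forall j, \sum_i m i * p i j = m j].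
Proof.
pose A : 'M[R]_#|V| := \matrix_(a, b) (p (enum_val a) (enum_val b) - (a == b)%:R).
have n0 : (0 < #|V|)%N by apply/card_gt0P; exists v0.
have detA : \det A = 0.
  (* The rows of [p] sum to 1, so the constant vector is in the kernel on the other side. *)
  rewrite -det_tr; apply/eqP/det0P; exists (const_mx 1).
    apply/eqP => /matrixP /(_ 0 (Ordinal n0)) /eqP.
    by rewrite !mxE oner_eq0.
  apply/matrixP => a b; rewrite !mxE.
  under eq_bigr do rewrite !mxE mul1r.
  rewrite sumrB (reindex enum_rank) /=; last exact/onW_bij/enum_rank_bij.
  under eq_bigr do rewrite enum_rankK.
  rewrite p_sum (bigD1 b)//= eqxx big1 ?addr0 ?subrr// => c cb.
  by rewrite eq_sym (negbTE cb).
have /det0P[v v_neq0 vA] : \det A == 0 by rewrite detA.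
have inv j : \sum_i v 0 (enum_rank i) * p i j = v 0 (enum_rank j).
  have /matrixP /(_ 0 (enum_rank j)) := vA; rewrite !mxE.
  under eq_bigr do rewrite !mxE mulrBr.
  rewrite sumrB (reindex enum_rank) /=; last exact/onW_bij/enum_rank_bij.
  under eq_bigr do rewrite !enum_rankK.
  move=> /eqP; rewrite subr_eq0 => /eqP ->.
  rewrite (bigD1 (enum_rank j))//= eqxx mulr1 big1 ?addr0// => c cb.
  by rewrite (negbTE cb) mulr0.
pose x i := `|v 0 (enum_rank i)|.
have sub j : 0 <= \sum_i x i * p i j - x j.
  rewrite subr_ge0 /x -{1}inv (le_trans (ler_norm_sum _ _ _))//.
  by apply: ler_sum => i _; rewrite normrM (ger0_norm (p_ge0 _ _)).
have tot : \sum_j (\sum_i x i * p i j - x j) = 0.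
  rewrite sumrB exchange_big /=; under eq_bigr do rewrite -mulr_sumr p_sum mulr1.
  by rewrite subrr.
have eqx j : \sum_i x i * p i j = x j.
  by apply/eqP; rewrite -subr_eq0; apply/eqP; apply: (psumr_eq0P _ tot).
have X0 : 0 < \sum_i x i.
  rewrite lt_neqAle sumr_ge0 ?andbT//; last by move=> i _; exact: normr_ge0.
  apply/eqP => /esym x0; move/eqP : v_neq0; apply; apply/matrixP => a b.
  have : x (enum_val b) = 0 by apply: (psumr_eq0P _ x0) => // i _; exact: normr_ge0.
  by rewrite /x enum_valK (ord1 a) mxE => /eqP; rewrite normr_eq0 => /eqP.
exists (fun i => x i / \sum_i x i); split.
- by move=> i; rewrite divr_ge0 ?normr_ge0// ltW.
- by rewrite -mulr_suml mulfV// gt_eqF.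
- by move=> j; rewrite -[in RHS]eqx mulr_suml; apply: eq_bigr => i _; rewrite mulrAC.
Qed.

End finite_stationary.

(** The absolute value makes this a measure for every [w], so that the instance carries no sign
    condition. *)
Definition weight_measure {R : realType} (w : state -> R) (A : set state) : \bar R :=
  (\esum_(i in A) `|w i|%:E)%E.

Section weight_measure.
Context {R : realType} (w : state -> R).

Let weight_measure0 : weight_measure w set0 = 0%E.
Proof. by rewrite /weight_measure esum_set0. Qed.

Let weight_measure_ge0 A : (0 <= weight_measure w A)%E.
Proof. by apply: esum_ge0 => i _; rewrite lee_fin. Qed.

Let weight_measure_sigma_additive : semi_sigma_additive (weight_measure w).
Proof.
move=> F mF tF mU; rewrite /weight_measure nneseries_sum_bigcup//.
by apply: is_cvg_nneseries => n _ _; apply: esum_ge0 => i _; rewrite lee_fin.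
Qed.

HB.instance Definition _ := isMeasure.Build _ _ _ (weight_measure w)
  weight_measure0 weight_measure_ge0 weight_measure_sigma_additive.

End weight_measure.

(** * Stein's equation for the normal law *)

Section mills.
Context {R : realType} (sg : R) (sg_gt0 : 0 < sg).

Let kap : R := (sg ^+ 2)^-1.
Let q : R -> R := normal_pdf 0 sg.

Definition normal_tail (x : R) : R := fine (normal_prob 0 sg `]x, +oo[%classic).

Let sg_neq0 : sg != 0. Proof. by rewrite gt_eqF. Qed.
Let kap_gt0 : 0 < kap. Proof. by rewrite invr_gt0 exprn_gt0. Qed.

Lemma normal_pdf_expE x : q x = normal_peak sg * expR (- (kap * x ^+ 2 / 2)).
Proof.
rewrite /q normal_pdfE// /normal_fun subr0; congr (_ * expR _).
rewrite -mulr_natr invfM /kap; ring.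
Qed.

Let q_gt0 x : 0 < q x.
Proof. by rewrite normal_pdf_expE mulr_gt0 ?expR_gt0// normal_peak_gt0. Qed.

Lemma is_derive_normal_pdf (x : R) : is_derive x 1 q (- (kap * x * q x)).
Proof.
have -> : q = (fun x => normal_peak sg * expR (- (kap * x ^+ 2 / 2))).
  by apply/funext => y; exact: normal_pdf_expE.
apply: is_derive_eq; rewrite /GRing.scale /=.
by field.
Qed.

Let measurable_itv (i : interval R) : measurable ([set` i] : set (measurableTypeR R)).
Proof. exact: measurable_itv. Qed.

Let integrable_q (i : interval R) : lebesgue_measure.-integrable [set` i] (EFin \o q).
Proof.
apply: (integrableS measurableT); [exact: measurable_itv|by []|].
exact: integrable_normal_pdf.
Qed.

Lemma normal_probE x : (normal_prob 0 sg `]-oo, x] = (1 - normal_tail x)%:E)%E.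
Proof.
have -> : `]-oo, x]%classic = ~` `]x, +oo[%classic by rewrite setCitvr.
rewrite probability_setC; last exact: measurable_itv.
by rewrite EFinB /normal_tail fineK// fin_num_measure.
Qed.

Lemma normal_tailE x : normal_tail x = 1 - \int[lebesgue_measure]_(t in `]-oo, x]) q t.
Proof.
by rewrite /Rintegral -[X in fine X]/(normal_prob 0 sg _) normal_probE /= subKr.
Qed.

Lemma is_derive_normal_tail (x : R) : is_derive x 1 normal_tail (- q x).
Proof.
have -> : normal_tail = (fun x => 1 - \int[lebesgue_measure]_(t in `]-oo, x]) q t).
  by apply/funext => y; exact: normal_tailE.
have xx1 : x < x + 1 by rewrite ltrDl.
have [dF F'] := @continuous_FTC1 R q -oo%O x (x + 1) xx1 (integrable_q _) (ltNyr x)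
  (continuous_normal_pdf sg_neq0 (x := x)).
have dI : is_derive x 1 (fun x => \int[lebesgue_measure]_(t in `]-oo, x]) q t) (q x).
  by split; [exact: dF|rewrite -derive1E; exact: F'].
by have := is_deriveB (is_derive_cst (1 : R) x 1) dI; rewrite sub0r.
Qed.

Lemma normal_tail_itv x : 0 <= normal_tail x <= 1.
Proof.
rewrite fine_ge0//= -lee_fin fineK ?fin_num_measure// probability_le1//.
Qed.

Let idTR : measurableTypeR R -> R := idfun.

#[local] HB.instance Definition _ :=
  @isMeasurableFun.Build _ _ _ _ idTR (@measurable_id _ _ setT).

Lemma normal_tail_cvg0 : normal_tail x @[x --> +oo] --> (0 : R).
Proof.
apply: fine_cvg.
have := @cvg_ccdfy0 _ _ R (normal_prob 0 sg) (idTR : {RV (normal_prob 0 sg) >-> R}).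
by apply: cvg_trans; apply: near_eq_cvg; exact: nearW.
Qed.

Let qN x : q (- x) = q x.
Proof. by rewrite !normal_pdf_expE sqrrN. Qed.

Lemma normal_tailN x : normal_tail (- x) = 1 - normal_tail x.
Proof.
apply: EFin_inj; rewrite -normal_probE /normal_tail fineK ?fin_num_measure//.
rewrite /normal_prob.
have -> : (\int[lebesgue_measure]_(t in `]-oo, x]) (q t)%:E =
    \int[lebesgue_measure]_(t in `]-oo, (- - x)%R]) (q t)%:E)%E by rewrite opprK.
rewrite ge0_integration_by_substitutionNy.
- rewrite -integral_itv_obnd_cbnd; last first.
    apply/measurable_EFinP; apply: measurable_funTS.
    rewrite (_ : q \o -%R = q); first exact: measurable_normal_pdf.
    by apply/funext => y; rewrite /= qN.
  by apply: eq_integral => y _; rewrite /= qN.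
- by apply: continuous_subspaceT => y; exact: continuous_normal_pdf.
- by move=> y _; exact: normal_pdf_ge0.
Qed.

(** Solves m' - kap x m = -1: the Stein operator sends it to a constant, and it stays bounded at
    +oo. It is the building block of the solutions of Stein's equation. *)
Definition mills x := normal_tail x / q x.

Let m' x := kap * x * mills x - 1.

Lemma is_derive_mills (x : R) : is_derive x 1 mills (m' x).
Proof.
have dT := is_derive_normal_tail x; have dq := is_derive_normal_pdf x.
have dV := is_deriveV (lt0r_neq0 (q_gt0 x)) dq.
have -> : mills = normal_tail * (fun y => (q y)^-1) by [].
apply: is_derive_eq; rewrite /GRing.scale /= /m' /mills; field.
by rewrite gt_eqF.
Qed.

(** Compares two functions that agree at +oo through their derivatives; both bounds on the Mills
    ratio come from it. *)
Lemma ge0_of_decreasing (h h' : R -> R) (b : R) :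
  (forall x, b < x -> is_derive x 1 h (h' x)) -> (forall x, b < x -> h' x <= 0) ->
  h x @[x --> +oo] --> (0 : R) -> forall x, b < x -> 0 <= h x.
Proof.
move=> dh h'0 ch x bx; apply: (cvgr_to_le ch); near=> y.
have xy : x < y by near: y; apply: nbhs_pinfty_gt; exact: num_real.
have dhxy z : x <= z -> is_derive z 1 h (h' z) by move=> xz; apply: dh; exact: lt_le_trans xz.
have [||c] := @MVT R h h' x y xy.
- by move=> z; rewrite in_itv /= => /andP[/ltW xz _]; exact: dhxy.
- apply: derivable_within_continuous => z; rewrite in_itv /= => /andP[xz _].
  by have := dhxy z xz; case.
rewrite in_itv /= => /andP[xc _] /eqP; rewrite subr_eq => /eqP ->.
rewrite gerDr mulr_le0_ge0 ?subr_ge0 ?(ltW xy)//.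
by apply: h'0; exact: lt_trans xc.
Unshelve. all: by end_near.
Qed.

Lemma normal_pdf_cvg0 : q x @[x --> +oo] --> (0 : R).
Proof.
pose k := kap / 2.
have k0 : 0 < k by rewrite divr_gt0.
have ce : normal_peak sg * expR (- (k * x)) @[x --> +oo] --> (0 : R).
  rewrite -[X in _ --> X](mulr0 (normal_peak sg)); apply: cvgM; first exact: cvg_cst.
  apply: (cvg_comp (fun x => k * x) (fun x => expR (- x))); last exact: cvgr_expR.
  by apply: gt0_cvgMry => //; exact: cvg_id.
apply: (squeeze_cvgr _ (cvg_cst 0) ce); near=> x.
rewrite normal_pdf_ge0 /= -/(q x) normal_pdf_expE ler_wpM2l ?normal_peak_ge0// ler_expR lerN2.
have x1 : 1 <= x by near: x; apply: nbhs_pinfty_ge; exact: num_real.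
rewrite /k mulrAC ler_pM2r// ?invr_gt0// ler_pM2l// expr2 ler_peMl// (le_trans _ x1)//.
Unshelve. all: by end_near.
Qed.

Let T := normal_tail.
Let den x := 1 + kap * x ^+ 2.

Let den_gt0 x : 0 < den x.
Proof. by rewrite ltr_wpDr// mulr_ge0 ?sqr_ge0// ltW. Qed.

Let abs_le_den x : `|x| <= sg * den x.
Proof.
have -> : sg * den x = sg + x ^+ 2 / sg by rewrite /den /kap; field.
rewrite -[x ^+ 2]real_normK ?num_real//; have := normr_ge0 x; move: `|x| => y y0.
rewrite -subr_ge0.
have -> : sg + y ^+ 2 / sg - y = (sg ^+ 2 + y ^+ 2 - y * sg) / sg by field.
by rewrite divr_ge0 ?(ltW sg_gt0)//; nra.
Qed.

Let T_ge0 x : 0 <= T x. Proof. by case/andP: (normal_tail_itv x). Qed.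

Let mills_ge0 x : 0 <= mills x.
Proof. by rewrite divr_ge0// ltW. Qed.

(** The gap h between the normal tail and q y / den y has derivative -2 q / den^2 and vanishes at
    +oo. The bound is exactly the convexity of [mills], since m'' = kap (mills x * den x - x). *)
Lemma mills_lower x : x / den x <= mills x.
Proof.
rewrite ler_pdivlMr//.
pose h y := T y - q y * (y / den y).
pose h' y := - (2 * q y / den y ^+ 2).
suff : 0 <= h x by rewrite subr_ge0 mulrC.
apply: (@ge0_of_decreasing h h' (x - 1)); last by rewrite ltrBlDr ltrDl.
- move=> y _; have dT := is_derive_normal_tail y; have dq := is_derive_normal_pdf y.
  have dden : is_derive y 1 den (2 * kap * y).
    by rewrite /den; apply: is_derive_eq; rewrite /GRing.scale /=; ring.
  have dV := is_deriveV (lt0r_neq0 (den_gt0 y)) dden.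
  have -> : h = (T - q * (id * (fun z => (den z)^-1))) by [].
  apply: is_derive_eq; rewrite /GRing.scale /= /h'.
  rewrite -[(id * _) y]/(y * (den y)^-1).
  by have N0 := lt0r_neq0 (den_gt0 y); rewrite /den in N0 *; field.
- by move=> y _; rewrite /h' oppr_le0 divr_ge0 ?sqr_ge0// mulr_ge0// ltW.
rewrite -[X in _ --> X](subrr 0); apply: cvgB; first exact: normal_tail_cvg0.
have cq : q y * sg @[y --> +oo] --> (0 : R).
  by rewrite -[X in _ --> X](mul0r sg); apply: cvgM; [exact: normal_pdf_cvg0|exact: cvg_cst].
apply: (squeeze_cvgr _ (cvg_cst 0) cq); near=> y.
have y0 : 0 <= y by near: y; apply: nbhs_pinfty_ge; exact: num_real.
rewrite mulr_ge0 ?divr_ge0 ?(ltW (q_gt0 y)) ?(ltW (den_gt0 y))//=.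
rewrite ler_pM2l// ler_pdivrMr//; have := abs_le_den y; rewrite ger0_norm//.
Unshelve. all: by end_near.
Qed.

(** Monotonicity of [mills]. Only x > 0 needs an argument: there q y / (kap y) minus the tail has
    derivative -q / (kap y^2) and vanishes at +oo. *)
Lemma mills_upper x : m' x <= 0.
Proof.
rewrite /m' subr_le0; have [x0|x0] := leP x 0.
  by rewrite (@le_trans _ _ 0)// -mulrA mulr_ge0_le0 ?(ltW kap_gt0)// mulr_le0_ge0.
rewrite /mills mulrA ler_pdivrMr// mul1r.
have kx : 0 < kap * x by rewrite mulr_gt0.
rewrite mulrC -ler_pdivlMr// -subr_ge0.
pose h y := q y / (kap * y) - T y.
pose h' y := - (q y / (kap * y ^+ 2)).
apply: (@ge0_of_decreasing h h' 0) => //.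
- move=> y y0; have dT := is_derive_normal_tail y; have dq := is_derive_normal_pdf y.
  have dk : is_derive y 1 (fun z => kap * z) kap.
    by apply: is_derive_eq; rewrite /GRing.scale /=; ring.
  have ky : kap * y != 0 by rewrite mulf_neq0// gt_eqF.
  have dV := is_deriveV ky dk.
  have -> : h = q * (fun z => (kap * z)^-1) - T by [].
  apply: is_derive_eq; rewrite /GRing.scale /= /h'; field.
  by rewrite !gt_eqF.
- move=> y y0; rewrite /h' oppr_le0; apply: divr_ge0; first exact: ltW.
  by apply: mulr_ge0; [exact: ltW|exact: sqr_ge0].
rewrite -[X in _ --> X](subrr 0); apply: cvgB; last exact: normal_tail_cvg0.
have cq : q y * kap^-1 @[y --> +oo] --> (0 : R).
  by rewrite -[X in _ --> X](mul0r kap^-1); apply: cvgM; [exact: normal_pdf_cvg0|exact: cvg_cst].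
apply: (squeeze_cvgr _ (cvg_cst 0) cq); near=> y.
have y1 : 1 <= y by near: y; apply: nbhs_pinfty_ge; exact: num_real.
have y0 : 0 < y by exact: lt_le_trans y1.
rewrite divr_ge0 ?mulr_ge0 ?(ltW (q_gt0 y)) ?(ltW kap_gt0) ?(ltW y0)//=.
rewrite ler_pM2l// lef_pV2 ?posrE ?mulr_gt0//.
by rewrite ler_peMr// ltW.
Unshelve. all: by end_near.
Qed.

Let m'' x := kap * mills x + kap * x * m' x.

Lemma is_derive_mills' (x : R) : is_derive x 1 m' (m'' x).
Proof.
have dm := is_derive_mills x.
have dk : is_derive x 1 (fun z => kap * z) kap.
  by apply: is_derive_eq; rewrite /GRing.scale /=; ring.
have -> : m' = (fun z => kap * z) * mills - cst 1 by [].
by apply: is_derive_eq; rewrite /GRing.scale /= /m''; ring.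
Qed.

Let m''_ge0 x : 0 <= m'' x.
Proof.
have -> : m'' x = kap * (mills x * den x - x) by rewrite /m'' /m' /den; ring.
by rewrite mulr_ge0 ?(ltW kap_gt0)// subr_ge0 -ler_pdivrMr// mills_lower.
Qed.

Let mvt (h h' : R -> R) x y : (forall z : R, is_derive z 1 h (h' z)) -> x <= y ->
  exists2 z, x <= z <= y & h y - h x = h' z * (y - x).
Proof.
move=> dh; rewrite le_eqVlt => /predU1P[<-|xy].
  by exists x; rewrite ?lexx// !subrr mulr0.
have [|z] := @MVT R h h' x y xy (fun z _ => dh z).
  by apply: derivable_within_continuous => z _; case: (dh z).
rewrite in_itv /= => /andP[/ltW xz /ltW zy] e; by exists z; rewrite ?xz.
Qed.

(* [mills] is positive, decreasing and convex, so it is bounded with its first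
   two derivatives on every half-line [a, +oo[. *)
Lemma mills_bounds a : exists2 C, 0 <= C & (forall x, a <= x -> 0 <= mills x <= C) /\
  forall x y, a <= x -> x <= y ->
    `|m' y - m' x| <= C * (y - x) /\
    (forall z, x <= z <= y -> `|mills y - mills x - (y - x) * m' z| <= C * (y - x) ^+ 2).
Proof.
(* The first term bounds [mills]; the others bound m'' = kap mills + kap x m'. Its second summand is
   nonpositive for x >= 0, and for a <= x < 0 both |x| and - m' x are at most their values at a. *)
pose C := mills a + (kap * mills a + kap * `|a| * - m' a).
have ma0 : 0 <= - m' a by rewrite oppr_ge0 mills_upper.
have k0 := ltW kap_gt0.
have D0 : 0 <= kap * mills a + kap * `|a| * - m' a.
  by apply: addr_ge0; apply: mulr_ge0 => //; exact: mulr_ge0.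
have C0 : 0 <= C by rewrite addr_ge0.
have mle x : a <= x -> mills x <= mills a.
  move=> ax; have [z _ e] := mvt is_derive_mills ax.
  by rewrite -subr_le0 e mulr_le0_ge0 ?mills_upper// subr_ge0.
have m'le x : a <= x -> m' a <= m' x.
  move=> ax; have [z _ e] := mvt is_derive_mills' ax.
  by rewrite -subr_ge0 e mulr_ge0 ?subr_ge0.
have m''le x : a <= x -> m'' x <= C.
  move=> ax; rewrite /m'' /C -[leLHS]add0r lerD// lerD//.
    by rewrite ler_wpM2l// mle.
  have [x0|x0] := leP 0 x.
    rewrite (@le_trans _ _ 0)//; last by apply: mulr_ge0 => //; exact: mulr_ge0.
    by rewrite mulr_ge0_le0 ?mills_upper// mulr_ge0.
  rewrite -!mulrA ler_wpM2l// -mulrNN; apply: ler_pM.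
  - by rewrite oppr_ge0 ltW.
  - by rewrite oppr_ge0 mills_upper.
  - by rewrite ler0_norm ?(le_trans ax (ltW x0))// lerN2.
  - by rewrite lerN2 m'le.
have lip x y : a <= x -> x <= y -> `|m' y - m' x| <= C * (y - x).
  move=> ax xy; have [z /andP[xz _] ->] := mvt is_derive_mills' xy.
  rewrite ger0_norm ?mulr_ge0 ?subr_ge0// ler_wpM2r ?subr_ge0//.
  by apply: m''le; exact: le_trans xz.
exists C => //; split.
  move=> x ax; rewrite mills_ge0 /= (le_trans (mle _ ax))// /C lerDl//.
move=> x y ax xy; split; first exact: lip.
move=> z /andP[xz zy]; have [t /andP[xt ty] ->] := mvt is_derive_mills xy.
have -> : m' t * (y - x) - (y - x) * m' z = (m' t - m' z) * (y - x) by ring.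
rewrite normrM (ger0_norm (_ : 0 <= y - x)) ?subr_ge0// expr2 mulrA ler_wpM2r ?subr_ge0//.
have [tz|/ltW zt] := leP t z.
  rewrite distrC (le_trans (lip t z (le_trans ax xt) tz))// ler_wpM2l//; lra.
rewrite (le_trans (lip z t (le_trans ax xz) zt))// ler_wpM2l//; lra.
Qed.

(* E (N - a)^+ for a centered normal variable N of standard deviation sg. *)
Definition normal_excess (a : R) : R := q a / kap - a * T a.

Lemma is_derive_normal_excess (a : R) : is_derive a 1 normal_excess (- T a).
Proof.
have dT := is_derive_normal_tail a; have dq := is_derive_normal_pdf a.
have -> : normal_excess = q * cst kap^-1 - id * T by [].
apply: is_derive_eq; rewrite /GRing.scale /=.
rewrite /T; field.
by rewrite gt_eqF.
Qed.

(* The solution of Stein's equation phi' - kap x phi = (x - a)^+ - normal_excess a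
   is explicit in terms of the Mills ratio on each side of a. *)
Lemma stein_solution a : exists (phi : R -> R) (C : R), [/\ 0 <= C,
  forall x, `|phi x| <= C & forall x e, 0 <= e ->
  `|phi x - phi (x - e) - e * (Num.max (x - a) 0 - normal_excess a + kap * x * phi x)|
    <= C * e ^+ 2].
Proof.
pose A := normal_excess a; pose B := a + A.
(* The right-hand side is - A to the left of a and x - B to the right: [- A * mills (- x)] produces
   - A, [- kap^-1] produces x and [B * mills x] produces - B. *)
pose phi x := if x <= a then - A * mills (- x) else - kap^-1 + B * mills x.
have [Cr Cr0 [Mr Tr]] := mills_bounds a.
have [Cl Cl0 [Ml Tl]] := mills_bounds (- a).
have k0 : kap != 0 by rewrite gt_eqF.
have q0 : q a != 0 by rewrite gt_eqF.
(* The two branches meet at a precisely because A is [normal_excess a]. *)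
have glue : - A * mills (- a) = - kap^-1 + B * mills a.
  rewrite /mills normal_tailN qN /B /A /normal_excess -/T; field.
  by rewrite k0 q0.
have phir x : a <= x -> phi x = - kap^-1 + B * mills x.
  rewrite /phi; case: (leP x a) => // xa ax.
  by have -> : x = a by apply/eqP; rewrite eq_le xa ax.
have phil x : x <= a -> phi x = - A * mills (- x) by rewrite /phi => ->.
(* G is phi' by Stein's equation. The claim is phrased as a backward Taylor bound with step e
   because the chain moves y by unit steps, that is by e = 1 / sqrt r after scaling. *)
pose G x := Num.max (x - a) 0 - A + kap * x * phi x.
have Gr x : a <= x -> G x = B * m' x.
  move=> ax; rewrite /G phir// (max_idPl _) ?subr_ge0// /m' /B; field.
  exact: k0.
have Gl x : x <= a -> G x = A * m' (- x).
  move=> xa; rewrite /G phil// (max_idPr _) ?subr_le0// /m'; ring.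
have AC0 : 0 <= `|A| * Cl by exact: mulr_ge0.
have BC0 : 0 <= `|B| * Cr by exact: mulr_ge0.
have ki0 : 0 <= kap^-1 by rewrite invr_ge0 ltW.
pose C := `|A| * Cl + kap^-1 + (`|B| * Cr) *+ 2.
have right x y : a <= x -> x <= y ->
    `|phi y - phi x - (y - x) * G y| <= `|B| * Cr * (y - x) ^+ 2.
  move=> ax xy; rewrite !phir ?Gr ?(le_trans ax)//.
  have [_ /(_ y)] := Tr x y ax xy; rewrite xy lexx => /(_ isT) h.
  have -> : - kap^-1 + B * mills y - (- kap^-1 + B * mills x) - (y - x) * (B * m' y) =
    B * (mills y - mills x - (y - x) * m' y) by ring.
  by rewrite normrM -mulrA ler_wpM2l.
have left x y : y <= a -> x <= y ->
    `|phi y - phi x - (y - x) * G y| <= `|A| * Cl * (y - x) ^+ 2.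
  move=> ya xy; rewrite !phil ?Gl ?(le_trans xy)//.
  have ya' : - a <= - y by rewrite lerN2.
  have yx' : - y <= - x by rewrite lerN2.
  have [_ /(_ (- y))] := Tl (- y) (- x) ya' yx'; rewrite yx' lexx => /(_ isT) h.
  have -> : - A * mills (- y) - - A * mills (- x) - (y - x) * (A * m' (- y)) =
    A * (mills (- x) - mills (- y) - (- x - - y) * m' (- y)) by ring.
  by rewrite normrM -mulrA ler_wpM2l// (_ : y - x = - x - - y)//; ring.
exists phi, C; split.
- by rewrite /C !addr_ge0// mulrn_wge0.
- move=> x; have [xa|/ltW ax] := leP x a.
    rewrite phil// normrM normrN (@le_trans _ _ (`|A| * Cl))//.
      rewrite ler_wpM2l// ger0_norm; last exact: mills_ge0.
      have xa' : - a <= - x by rewrite lerN2.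
      by case/andP: (Ml (- x) xa').
    by rewrite /C -addrA lerDl addr_ge0// mulrn_wge0.
  rewrite phir// (le_trans (ler_normD _ _))// normrN (ger0_norm ki0) normrM.
  have : `|B| * `|mills x| <= `|B| * Cr.
    by rewrite ler_wpM2l// ger0_norm ?mills_ge0//; case/andP: (Mr x ax).
  by rewrite /C; move: AC0 BC0; lra.
move=> x e e0; rewrite -/A -/(G x).
have xex : x - e <= x by rewrite gerBl.
have -> : e * G x = (x - (x - e)) * G x by ring.
have eE : e = x - (x - e) by ring.
have [axe|/ltW xea] := leP a (x - e).
  apply: (le_trans (right _ _ axe xex)); rewrite -eE ler_wpM2r ?sqr_ge0// /C; lra.
have [xa|/ltW ax] := leP x a.
  apply: (le_trans (left _ _ xa xex)); rewrite -eE ler_wpM2r ?sqr_ge0// /C; lra.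
(* phi' is continuous but may have a kink at a, so an interval straddling a is cut there; the change
   of G between a and x is absorbed by the Lipschitz bound on m'. *)
have h1 := right a x (lexx a) ax.
have h2 := left (x - e) a (lexx a) xea.
have h3 : `|G a - G x| <= `|B| * Cr * (x - a).
  rewrite !Gr// -mulrBr normrM -mulrA ler_wpM2l// distrC.
  by case: (Tr a x (lexx a) ax).
have -> : phi x - phi (x - e) - (x - (x - e)) * G x =
  (phi x - phi a - (x - a) * G x) + (phi a - phi (x - e) - (a - (x - e)) * G a) +
  (a - (x - e)) * (G a - G x) by ring.
have xa0 : 0 <= x - a by rewrite subr_ge0.
have ax0 : 0 <= a - (x - e) by rewrite subr_ge0.
have sq1 : (x - a) ^+ 2 <= e ^+ 2 by rewrite ler_sqr ?nnegrE//; lra.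
have sq2 : (a - (x - e)) ^+ 2 <= e ^+ 2 by rewrite ler_sqr ?nnegrE//; lra.
have sq3 : (a - (x - e)) * (x - a) <= e ^+ 2 by rewrite expr2 ler_pM//; lra.
apply: (le_trans (ler_normD _ _)); rewrite /C.
apply: (@le_trans _ _ (`|B| * Cr * e ^+ 2 + `|A| * Cl * e ^+ 2 + `|B| * Cr * e ^+ 2)).
  apply: lerD.
    apply: (le_trans (ler_normD _ _)); apply: lerD.
      by apply: (le_trans h1); rewrite ler_wpM2l.
    by apply: (le_trans h2); rewrite ler_wpM2l.
  rewrite normrM (ger0_norm ax0) (@le_trans _ _ ((a - (x - e)) * (`|B| * Cr * (x - a))))//.
    by rewrite ler_wpM2l.
  by rewrite mulrCA ler_wpM2l.
have : 0 <= kap^-1 * e ^+ 2 by rewrite mulr_ge0 ?sqr_ge0.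
lra.
Qed.

End mills.

(** * From expected excesses to tail probabilities *)

Section tail_from_excess.
Context {R : realType}.

(* Tail probabilities pr k are squeezed by the difference quotients of the
   convex functions e k a = E (X_k - a)^+. *)
Lemma tail_from_excess (pr e : nat -> R -> R) (A : R -> R) (x T : R) :
  (\forall k \near \oo, forall a b, a < b ->
    (b - a) * pr k b <= e k a - e k b <= (b - a) * pr k a) ->
  (forall a, e k a @[k --> \oo] --> A a) -> is_derive x 1 A (- T) ->
  pr k x @[k --> \oo] --> T.
Proof.
move=> sq ce [dA vA]; apply/cvgrPdist_le => eps eps0.
have /cvgrPdist_le/(_ (eps / 2)) : h^-1 *: ((A \o shift x) (h *: 1) - A x) @[h --> 0^'] --> - T.
  by rewrite -vA; exact: dA.
rewrite divr_gt0// => /(_ isT) [d /= d0 hd].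
pose h := d / 2; have h0 : 0 < h by rewrite divr_gt0.
have hh : h < d by rewrite ltr_pdivrMr// ltr_pMr// ltr1n.
have up : `|- T - h^-1 * (A (h + x) - A x)| <= eps / 2.
  have := hd h; rewrite /= sub0r normrN gtr0_norm// => /(_ hh (lt0r_neq0 h0)).
  by rewrite /GRing.scale /= mulr1.
have dn : `|- T - (- h)^-1 * (A (- h + x) - A x)| <= eps / 2.
  have := hd (- h); rewrite /= sub0r opprK gtr0_norm// oppr_eq0 => /(_ hh (lt0r_neq0 h0)).
  by rewrite /GRing.scale /= mulr1.
(* h is fixed before k; errors of at most h * eps / 4 at the three points x - h, x, x + h are still
   small after division by h. *)
have e4 : 0 < h * (eps / 4) by rewrite mulr_gt0// divr_gt0.
near=> k.
have sqk : forall a b, a < b -> (b - a) * pr k b <= e k a - e k b <= (b - a) * pr k a.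
  by near: k.
have c0 : `|A x - e k x| <= h * (eps / 4) by near: k; apply: cvgr_dist_le.
have c1 : `|A (h + x) - e k (h + x)| <= h * (eps / 4) by near: k; apply: cvgr_dist_le.
have c2 : `|A (- h + x) - e k (- h + x)| <= h * (eps / 4) by near: k; apply: cvgr_dist_le.
have /andP[_ l1] := sqk x (h + x) ltac:(by rewrite ltrDr).
have /andP[l2 _] := sqk (- h + x) x ltac:(by rewrite gtrDr oppr_lt0).
have hi : h != 0 by rewrite gt_eqF.
have up' : h * T <= A x - A (h + x) + h * (eps / 2).
  move: up; rewrite ler_norml => /andP[up _].
  have := ler_wpM2l (ltW h0) up; rewrite mulrBr mulrA mulfV// mul1r; lra.
have dn' : A (- h + x) - A x <= h * T + h * (eps / 2).
  move: dn; rewrite ler_norml => /andP[_ dn].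
  have := ler_wpM2l (ltW h0) dn; rewrite invrN mulNr opprK mulrDr mulrN mulrA mulfV// mul1r; lra.
move: c0 c1 c2; rewrite !ler_norml => /andP[c01 c02] /andP[c11 c12] /andP[c21 c22].
have e8 : h * eps = h * (eps / 4) + h * (eps / 4) + h * (eps / 2) by field.
have lo : h * (T - pr k x) <= h * eps by lra.
have hi' : h * (pr k x - T) <= h * eps by lra.
by move: lo hi'; rewrite !ler_pM2l// => lo hi'; apply/andP; split; lra.
Unshelve. all: by end_near.
Qed.

End tail_from_excess.

Lemma normal_excess0 (R : realType) (c : R) : 0 < c ->
  normal_excess (Num.sqrt c^-1) 0 = (Num.sqrt (2 * pi))^-1 * (Num.sqrt c)^-1.
Proof.
move=> c0; have ci : 0 <= c^-1 by rewrite invr_ge0 ltW.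
have sg0 : 0 < Num.sqrt c^-1 by rewrite sqrtr_gt0 invr_gt0.
rewrite /normal_excess mul0r subr0 normal_pdf_expE// expr0n /= mulr0 mul0r oppr0 expR0 mulr1.
rewrite invrK /normal_peak.
have -> : Num.sqrt c^-1 ^+ 2 * pi *+ 2 = Num.sqrt c^-1 ^+ 2 * (2 * pi) :> R by ring.
rewrite sqrtrM ?sqr_ge0// sqrtr_sqr (gtr0_norm sg0) (sqrtrV (ltW c0)); field.
by rewrite !gt_eqF ?sqrtr_gt0 ?mulr_gt0 ?pi_gt0.
Qed.

Lemma cvgr_dist_squeeze (R : realType) (u h : nat -> R) (l : R) :
  (\forall k \near \oo, `|u k - l| <= h k) -> h k @[k --> \oo] --> (0 : R) ->
  u k @[k --> \oo] --> l.
Proof.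
move=> uh h0; apply: (@squeeze_cvgr _ _ _ _ (fun k => l - h k) (fun k => l + h k)).
- by near=> k; rewrite -ler_distl; near: k.
- by rewrite -[X in _ --> X]subr0; apply: cvgB => //; exact: cvg_cst.
- by rewrite -[X in _ --> X]addr0; apply: cvgD => //; exact: cvg_cst.
Unshelve. all: by end_near.
Qed.

(** States outside a set of full mass are null atoms. This links expectations over all states to the
    integrals over the state space on which the estimates are made. *)
Lemma expectation_support (R : realType) (mu : probability state R) (A : set state)
    (f : state -> R) : mu A = 1%E -> (forall s, 0 <= f s) -> mu.-integrable A (EFin \o f) ->
  ('E_mu[f] = (\int[mu]_(s in A) f s)%:E)%E.
Proof.
move=> A1 f0 fi; rewrite unlock /Rintegral fineK; last exact: integrable_fin_num.
rewrite !integral_esum => [|s _|s _]; rewrite ?lee_fin//.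
have nu0 s : ~ A s -> mu [set s] = 0%E.
  move=> nA; rewrite (prob_support _ A1) (_ : _ `&` _ = set0) ?measure0//.
  by apply/seteqP; split=> // t [/= -> /nA].
rewrite (esumID A) ?setTI; last by move=> s _; rewrite mule_ge0 ?lee_fin.
rewrite [X in (_ + X)%E]esum1 ?adde0// => s nA; have e := nu0 s nA.
by rewrite [X in (_ * X)%E]e mule0.
Qed.

(** * The state space and the rates *)

Section gbs_structure.
Context {R : realType} (gam : nat) (beta r fr xs : R).
Context (gam_ge1 : (1 <= gam)%N) (beta_gt0 : 0 < beta) (r_gt0 : 0 < r) (fr_gt0 : 0 < fr).

Local Notation g := (GBS r beta gam%:R fr xs).
Local Notation down := (after_demand g).
Local Notation up := (after_arrival g).
Local Notation c := (target_ceil g).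
Local Notation S := (state_space g).

(** As gamma is an integer, the ceiling of the untruncated target is affine in y with slope exactly
    - gamma. The order dynamics thereby become integer arithmetic. *)
Definition sloped_target (y : int) : int :=
  Num.ceil (r / beta + gam%:R * xs) - gam%:Z * y.

(* An upper bound for the number of in-transit items, attained when y is small. *)
Definition max_transit : nat := `|Num.ceil (r / beta + fr)|%N.

Local Notation D := sloped_target.
Local Notation Zm := max_transit.

Lemma max_transit_itv : r / beta + fr <= Zm%:R < r / beta + fr + 1.
Proof.
have h : 0 < r / beta + fr by rewrite addr_gt0// divr_gt0.
have -> : Zm%:R = (Num.ceil (r / beta + fr))%:~R :> R.
  rewrite /max_transit pmulrn gez0_abs//.
  by rewrite ceil_ge0 (lt_trans _ h)// ltrN10.
by rewrite ceil_ge/= -ltrBlDr; have := ceilB1_lt (r / beta + fr); rewrite intrB.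
Qed.

Lemma max_transit_gt0 : (0 < Zm)%N.
Proof.
have /andP[h _] := max_transit_itv.
by rewrite -(ltr_nat R) (lt_le_trans _ h)// addr_gt0// divr_gt0.
Qed.

Lemma sloped_target_itv y :
  r / beta - gam%:R * (y%:~R - xs) <= (D y)%:~R < r / beta - gam%:R * (y%:~R - xs) + 1.
Proof.
rewrite /sloped_target intrB intrM -pmulrn.
have := ceil_ge (r / beta + gam%:R * xs); have := ceilB1_lt (r / beta + gam%:R * xs).
rewrite intrB mulrBr; lra.
Qed.

Lemma target_ceilE y : (c y)%:Z = Num.max (Num.min (D y) Zm%:Z) 0.
Proof.
rewrite /target_ceil.
have -> : Num.ceil (truncated_target g y) = Num.max (Num.min (D y) Zm%:Z) 0.
  have ceil_min (a b : R) : Num.ceil (Num.min a b) = Num.min (Num.ceil a) (Num.ceil b).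
    by case: (leP a b) => [/le_ceil|/ltW /le_ceil] h; [rewrite (min_idPl h)|rewrite (min_idPr h)].
  have ceil_max (a b : R) : Num.ceil (Num.max a b) = Num.max (Num.ceil a) (Num.ceil b).
    by case: (leP a b) => [/le_ceil|/ltW /le_ceil] h; [rewrite (max_idPr h)|rewrite (max_idPl h)].
  rewrite /truncated_target ceil_max ceil_min ceil0; congr (Num.max (Num.min _ _) _).
  - apply: ceil_def; have /andP[h1 h2] := sloped_target_itv y.
    by rewrite h1 andbT intrB ltrBlDr.
  - rewrite /max_transit gez0_abs// ceil_ge0 (@lt_trans _ _ 0)//.
    by rewrite addr_gt0// divr_gt0.
by rewrite gez0_abs// le_max lexx orbT.
Qed.

(** Capped, sloped and zero regimes, in a form on which [lia] can split cases. *)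
Lemma target_ceilP y : (Zm%:Z <= D y /\ c y = Zm) \/
  (0 <= D y /\ D y < Zm%:Z /\ (c y)%:Z = D y) \/ (D y < 0 /\ c y = 0%N).
Proof.
have := target_ceilE y; have := max_transit_gt0.
by rewrite /Order.max /Order.min; case: ifPn; case: ifPn; lia.
Qed.

Lemma sloped_targetD1 y : D (y + 1) = D y - gam%:Z.
Proof. by rewrite /sloped_target mulrDr mulr1 opprD addrA. Qed.

Lemma sloped_targetB1 y : D (y - 1) = D y + gam%:Z.
Proof. by rewrite /sloped_target mulrBr mulr1 opprB; lia. Qed.

(** The position y + z rises only through an order, which leaves z at a positive target; then y is
    bounded by [target_ceil_gt0] and z by [max_transit]. With the other bounds of [state_inv] this
    leaves finitely many states above any level of y. *)
Definition position_bound : int := `|Num.ceil (r / beta + gam%:R * xs)| + Zm%:Z.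

Definition state_inv (s : state) :=
  [/\ (c s.1 <= s.2)%N, (s.2 <= Zm)%N & s.1 + s.2%:Z <= position_bound].

Lemma target_ceil_gt0 y : (0 < c y)%N -> y <= `|Num.ceil (r / beta + gam%:R * xs)|.
Proof.
move=> cy; have : 0 < D y by have := target_ceilP y; have := max_transit_gt0; lia.
by rewrite /sloped_target; nia.
Qed.

Lemma state_inv_down s : state_inv s -> state_inv (down s).
Proof.
case: s => y z [/= h1 h2 h3]; rewrite /after_demand /=.
have := @target_ceil_gt0 (y - 1).
have : (c (y - 1) <= Zm)%N by have := (target_ceilP (y - 1)); lia.
by move: h3; rewrite /position_bound => h3 *; split; rewrite /= /position_bound; lia.
Qed.

Lemma state_inv_up s : state_inv s -> (0 < s.2)%N -> state_inv (up s).
Proof.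
case: s => y z [/= h1 h2 h3] z0; rewrite /after_arrival /=.
have := @target_ceil_gt0 (y + 1).
have : (c (y + 1) <= Zm)%N by have := (target_ceilP (y + 1)); lia.
have : (c (y + 1) <= c y)%N.
  have := sloped_targetD1 y; have := target_ceilP (y + 1); have := target_ceilP y.
  by move: (D (y + 1)) (D y) (c (y + 1)) (c y) (max_transit) => a b c' d'; lia.
by move: h3; rewrite /position_bound => h3 *; split; rewrite /= /position_bound; lia.
Qed.

Lemma up_neq_down s : up s != down s.
Proof. by apply/eqP => -[]; lia. Qed.

Lemma down_neq s : down s != s.
Proof. by case: s => y z; apply/eqP => -[]; lia. Qed.

Lemma up_neq s : up s != s.
Proof. by case: s => y z; apply/eqP => -[]; lia. Qed.

Lemma rate_down s : rate g s (down s) = r.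
Proof.
by rewrite /rate eqxx eq_sym (negbTE (up_neq_down s)) mul1r mul0r addr0.
Qed.

Lemma rate_up s : rate g s (up s) = beta * s.2%:R.
Proof. by rewrite /rate eqxx (negbTE (up_neq_down s)) mul1r mul0r add0r. Qed.

Lemma rate_ge0 s s' : 0 <= rate g s s'.
Proof. by rewrite addr_ge0// mulr_ge0// ?ler0n ?mulr_ge0 ?ler0n// ltW. Qed.

Lemma rate_gt0P s s' : 0 < rate g s s' -> s' = down s \/ s' = up s /\ (0 < s.2)%N.
Proof.
rewrite /rate; case: eqVneq => [->|_]; first by left.
case: eqVneq => [->|_]; last by rewrite !mul0r addr0 ltxx.
by rewrite mul0r mul1r add0r pmulr_rgt0// ltr0n; right.
Qed.

Lemma reachable_refl s : reachable g s s.
Proof. by exists [::]. Qed.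

Lemma reachable_trans s2 s1 s3 : reachable g s1 s2 -> reachable g s2 s3 -> reachable g s1 s3.
Proof.
move=> [p p1 <-] [q q1 <-]; exists (p ++ q); last by rewrite last_cat.
by rewrite cat_path p1.
Qed.

Lemma reachable_down s : reachable g s (down s).
Proof. by exists [:: down s] => //=; rewrite rate_down r_gt0. Qed.

Lemma reachable_up s : (0 < s.2)%N -> reachable g s (up s).
Proof.
by move=> s0; exists [:: up s] => //=; rewrite rate_up mulr_gt0// ltr0n.
Qed.

Lemma reachable_ind (P : state -> Prop) s s' : P s ->
  (forall u, P u -> P (down u)) -> (forall u, P u -> (0 < u.2)%N -> P (up u)) ->
  reachable g s s' -> P s'.
Proof.
move=> Ps Pd Pu [p]; elim: p s Ps => [s Ps _ <-//|u p IH s Ps /= /andP[su pu] us].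
by apply: (IH u) => //; case: (rate_gt0P su) => [->|[-> ?]]; [exact: Pd|exact: Pu].
Qed.

Lemma state_space_down s : S s -> S (down s).
Proof.
move=> [y0 h]; exists y0 => y /h hy; exact: reachable_trans hy (reachable_down s).
Qed.

Lemma state_space_up s : S s -> (0 < s.2)%N -> S (up s).
Proof.
move=> [y0 h] s0; exists y0 => y /h hy; exact: reachable_trans hy (reachable_up s0).
Qed.

Lemma flat_exists : exists y0 : int, forall y : int, y <= y0 -> Zm%:Z <= D y.
Proof.
exists (- (`|Num.ceil (r / beta + gam%:R * xs)| + Zm%:Z)) => y.
by rewrite /sloped_target; nia.
Qed.

Lemma flat_inv y z : Zm%:Z <= D y -> state_inv (y, z) -> z = Zm.
Proof. by move=> Dy [/=]; have := max_transit_gt0; have := (target_ceilP y); lia. Qed.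

Lemma state_space_inv s : S s -> state_inv s.
Proof.
move=> [y0 h]; have [y1 h1] := flat_exists.
pose y := Num.min y0 (Num.min y1 0) : int.
have yy0 : y <= y0 by rewrite /y; lia.
have Dy : Zm%:Z <= D y by apply: h1; rewrite /y; lia.
apply: (reachable_ind _ state_inv_down state_inv_up (h y yy0)).
rewrite -[`|_|%N]/Zm /position_bound; split; rewrite /=.
- by have := (target_ceilP y); lia.
- by [].
- have : y <= 0 by rewrite /y; lia.
  by rewrite /position_bound; lia.
Qed.

Lemma down_iter_reach s y : state_inv s -> y <= s.1 -> Zm%:Z <= D y ->
  reachable g s (y, Zm).
Proof.
move=> + + Dy; have [n] := ubnP `|s.1 - y|%N; elim: n s => // n IH s sn si ys.
have [e|e] := eqVneq s.1 y.
  move: si {sn ys}; case: s e => s1 s2 /= -> si.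
  by rewrite (flat_inv Dy si); exact: reachable_refl.
apply: (reachable_trans (reachable_down s)).
by apply: IH; [rewrite /=; lia|exact: state_inv_down|rewrite /=; lia].
Qed.

Lemma up_iter_reach (y' y : int) : y' <= y -> Zm%:Z <= D y -> reachable g (y', Zm) (y, Zm).
Proof.
move=> y'y Dy; have [n] := ubnP `|y - y'|%N; elim: n y' y'y => // n IH y' y'y yn.
have [->|e] := eqVneq y' y; first exact: reachable_refl.
apply: (reachable_trans (@reachable_up (y', Zm) max_transit_gt0)).
have -> : up (y', Zm) = (y' + 1, Zm).
  have h : c (y' + 1) = Zm.
    have : Zm%:Z <= D (y' + 1) by move: Dy; rewrite /sloped_target; nia.
    by case: (target_ceilP (y' + 1)); lia.
  by rewrite /after_arrival /= h; congr pair; have := max_transit_gt0; lia.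
by apply: IH; lia.
Qed.

Lemma state_space_flat y : Zm%:Z <= D y -> S (y, Zm).
Proof. by move=> Dy; exists y => y' y'y; apply: up_iter_reach. Qed.

(** The states (y, [max_transit]) with y very negative are a hub: demands alone lead to them from
    anywhere, since the invariant forces z to be at the cap there, and by definition of the state
    space they lead to every state. *)
Lemma state_space_reach i j : S i -> S j -> reachable g i j.
Proof.
move=> Si [y0 h]; have [y1 h1] := flat_exists.
pose y := Num.min (Num.min y0 y1) i.1.
apply: (@reachable_trans (y, Zm)).
- apply: down_iter_reach; first exact: state_space_inv.
  + by rewrite /y; lia.
  + by apply: h1; rewrite /y; lia.
- by apply: h; rewrite /y; lia.
Qed.

Local Notation q s := (r + beta * (s : state).2%:R).
Local Notation Lam := (r + beta * Zm%:R).

Lemma exit_rate_itv s : S s -> 0 < q s <= Lam.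
Proof.
move=> /state_space_inv[_ sZ _]; rewrite ltr_wpDr ?mulr_ge0// ?(ltW beta_gt0)//=.
by rewrite lerD2l ler_pM2l// ler_nat.
Qed.

Lemma up_rate_itv s : S s -> 0 <= beta * s.2%:R <= Lam.
Proof.
move=> /exit_rate_itv /andP[_]; rewrite mulr_ge0// ?(ltW beta_gt0)//=.
by have := r_gt0; lra.
Qed.

(** * Bounds on the transition probabilities and irreducibility *)

Section chain.
Context (P : R -> state -> state -> R) (HP : is_ctmc S (generator g) P).

Lemma ctmc_le1 t i j : 0 <= t -> S i -> S j -> P t i j <= 1.
Proof.
move=> t0 Si Sj; rewrite -lee_fin -(ctmc_mass HP t0 Si).
by apply: (esum_ge1 (a := fun j => (P t i j)%:E)) => // k Sk; rewrite lee_fin (ctmc_ge0 HP).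
Qed.

Lemma ctmc_semi_ge s t i j k : 0 <= s -> 0 <= t -> S i -> S j -> S k ->
  P s i k * P t k j <= P (s + t) i j.
Proof.
move=> s0 t0 Si Sj Sk; rewrite -lee_fin -(ctmc_semigroup HP s0 t0 Si Sj).
apply: (esum_ge1 (a := fun k => (P s i k * P t k j)%:E)) => // l Sl.
by rewrite lee_fin mulr_ge0// (ctmc_ge0 HP).
Qed.

Lemma ctmc_mul_diag h n i : 0 <= h -> S i -> 1 - P (h *+ n) i i <= (1 - P h i i) *+ n.
Proof.
move=> h0 Si; elim: n => [|n IH].
  by rewrite !mulr0n (ctmc_0 HP)// eqxx subrr.
rewrite !mulrS; apply: le_trans (lerD (lexx _) IH).
have hn0 : 0 <= h *+ n by exact: mulrn_wge0.
have := ctmc_semi_ge h0 hn0 Si Si Si.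
have := ctmc_le1 h0 Si Si; have := ctmc_le1 hn0 Si Si; nra.
Qed.

Lemma ctmc_rate_seq (u : nat -> R) i j : S i -> S j -> (forall n, 0 < u n) ->
  u n @[n --> \oo] --> (0 : R) ->
  (P (u n) i j - (j == i)%:R) / u n @[n --> \oo] --> generator g i j.
Proof. by move=> Si Sj u0 cu; apply: (cvg_at_rightP _ _ _).1 (ctmc_rates HP Si Sj) _ _. Qed.

Lemma cvg_step (t : R) : t * n.+1%:R^-1 @[n --> \oo] --> (0 : R).
Proof.
rewrite -[X in _ --> X](mulr0 t); apply: cvgM; first exact: cvg_cst.
exact: cvg_harmonic.
Qed.

(** By [ctmc_mul_diag], 1 - P t i i is at most n times its value at t / n, and n tending to infinity
    brings in the derivative at 0. The resulting bound is uniform in t, which supplies the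
    domination in all limits t -> 0. *)
Lemma ctmc_diag_ge t i : 0 <= t -> S i -> 1 - q i * t <= P t i i.
Proof.
rewrite le_eqVlt => /predU1P[<-|t0] Si.
  by rewrite mulr0 subr0 (ctmc_0 HP)// eqxx.
pose u n := t * n.+1%:R^-1.
have u0 n : 0 < u n by rewrite mulr_gt0// invr_gt0.
have h n : t * ((P (u n) i i - (i == i)%:R) / u n) <= P t i i - 1.
  have := ctmc_mul_diag n.+1 (ltW (u0 n)) Si.
  have -> : u n *+ n.+1 = t by rewrite -mulr_natr /u mulfVK// pnatr_eq0.
  rewrite eqxx.
  have -> : t * ((P (u n) i i - 1) / u n) = - ((1 - P (u n) i i) *+ n.+1).
    rewrite -mulr_natr /u invf_div mulrCA [t * (_ / _)]mulrCA divff ?gt_eqF// mulr1.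
    by rewrite -mulNr opprB.
  lra.
have : t * generator g i i <= P t i i - 1.
  by apply: (cvgr_to_le (cvgM (cvg_cst t) (ctmc_rate_seq Si Si u0 (cvg_step t)))); exact: nearW.
by rewrite /generator eqxx /=; lra.
Qed.

Lemma ctmc_offdiag_le t i j : 0 <= t -> S i -> S j -> j != i -> P t i j <= q i * t.
Proof.
move=> t0 Si Sj ji; have := ctmc_diag_ge t0 Si.
have := @esum_ge_seq _ _ S (fun j => (P t i j)%:E) [:: i; j].
rewrite (ctmc_mass HP t0 Si) big_cons big_seq1 -EFinD lee_fin.
have H1 k : S k -> (0%E <= (P t i k)%:E)%E by move=> Sk; rewrite lee_fin (ctmc_ge0 HP).
have H2 : uniq [:: i; j] by rewrite /= inE eq_sym ji.
move=> /(_ H1 H2); have H3 : {in [:: i; j], forall k, S k}.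
  by move=> k; rewrite !inE => /orP[] /eqP ->.
by move=> /(_ H3); lra.
Qed.

Lemma generator_down i : generator g i (down i) = r.
Proof. by rewrite /generator (negbTE (down_neq i)) rate_down. Qed.

Lemma generator_up i : generator g i (up i) = beta * i.2%:R.
Proof. by rewrite /generator (negbTE (up_neq i)) rate_up. Qed.

Lemma ctmc_edge_gt0 i j : S i -> S j -> j != i -> 0 < generator g i j ->
  exists2 t, 0 <= t & 0 < P t i j.
Proof.
move=> Si Sj ji Q0.
pose u n := 1 * n.+1%:R^-1 : R.
have u0 n : 0 < u n by rewrite mulr_gt0// invr_gt0.
have /cvgr_gt/(_ _ Q0)[N _ /(_ N (leqnn N))/=] := ctmc_rate_seq Si Sj u0 (cvg_step 1).
rewrite (negbTE ji) subr0 pmulr_lgt0 ?invr_gt0// => ?; exists (u N) => //.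
exact: ltW.
Qed.

Lemma ctmc_irreducible : irreducible S P.
Proof.
move=> i j Si Sj.
suff [] : S j /\ exists2 t, 0 <= t & 0 < P t i j by [].
apply: (reachable_ind (P := fun u => S u /\ exists2 t, 0 <= t & 0 < P t i u)
  _ _ _ (state_space_reach Si Sj)).
- by split=> //; exists 0 => //; rewrite (ctmc_0 HP)// eqxx.
- move=> u [Su [t t0 Pt]]; have Sd := state_space_down Su; split=> //.
  have [|s s0 Ps] := ctmc_edge_gt0 Su Sd (down_neq u); first by rewrite generator_down.
  exists (t + s); first exact: addr_ge0.
  by apply: lt_le_trans (ctmc_semi_ge t0 s0 Si Sd Su); exact: mulr_gt0.
- move=> u [Su [t t0 Pt]] u2; have Sd := state_space_up Su u2; split=> //.
  have [|s s0 Ps] := ctmc_edge_gt0 Su Sd (up_neq u).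
    by rewrite generator_up mulr_gt0// ltr0n.
  exists (t + s); first exact: addr_ge0.
  by apply: lt_le_trans (ctmc_semi_ge t0 s0 Si Sd Su); exact: mulr_gt0.
Qed.

End chain.

(** * Balance equations and stationarity *)

Definition balanced (mu : probability state R) := mu S = 1%E /\ forall j, S j ->
  \int[mu]_(i in S) rate g i j = q j * fine (mu [set j]).

Lemma rate_le i j : S i -> `|rate g i j| <= Lam.
Proof.
move=> Si; rewrite ger0_norm ?rate_ge0// /rate /=.
have /andP[_] := exit_rate_itv Si; have := r_gt0; have /andP[] := up_rate_itv Si.
case: eqVneq => _; case: eqVneq => _; rewrite ?mul1r ?mul0r; lra.
Qed.

(** Stationarity is differentiated at time 0 under the integral: the difference quotients are
    bounded by the largest exit rate, uniformly in the starting state. *)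
Lemma stationary_balanced P mu : is_ctmc S (generator g) P -> stationary S P mu -> balanced mu.
Proof.
move=> HP [mu1 HS]; split=> // j Sj.
pose u n := 1 * n.+1%:R^-1 : R.
have u0 n : 0 < u n by rewrite mulr_gt0// invr_gt0.
pose F n i := (P (u n) i j - (j == i)%:R) / u n.
have iP n : mu.-integrable S (EFin \o (fun i => P (u n) i j)).
  apply: (@bounded_integrable _ mu _ _ 1) => i Si.
  by rewrite ger0_norm ?(ctmc_le1 HP)// ?(ctmc_ge0 HP)// ltW.
have iI : mu.-integrable S (EFin \o (fun i => (i == j)%:R : R)).
  by apply: (@bounded_integrable _ mu _ _ 1) => i Si; rewrite normr_nat; case: eqP.
have eI := Rintegral_eq mu Sj.
have F0 n : \int[mu]_(i in S) F n i = 0.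
  have -> : \int[mu]_(i in S) F n i =
      \int[mu]_(i in S) ((u n)^-1 * (P (u n) i j - (i == j)%:R)).
    by apply: eq_Rintegral => i _; rewrite /F mulrC (eq_sym j).
  rewrite RintegralZl//; last first.
    apply: (@bounded_integrable _ mu _ _ (1 + 1)) => i Si.
    rewrite (le_trans (ler_normB _ _))// lerD//.
      by rewrite ger0_norm ?(ctmc_le1 HP)// ?(ctmc_ge0 HP)// ltW.
    by rewrite normr_nat; case: eqP.
  by rewrite RintegralB// eI {1}/Rintegral HS ?subrr ?mulr0// ltW.
have FC n i : S i -> `|F n i| <= Lam.
  move=> Si; have /andP[_ qL] := exit_rate_itv Si; apply: le_trans qL.
  have un0 := ltW (u0 n).
  rewrite /F normrM [`|_^-1|]gtr0_norm ?invr_gt0// ler_pdivrMr//.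
  case: eqVneq => [->|ji].
    rewrite ler0_norm ?subr_le0 ?(ctmc_le1 HP)//.
    by have := ctmc_diag_ge HP un0 Si; rewrite (_ : true%:R = 1)//; lra.
  by rewrite subr0 ger0_norm ?(ctmc_ge0 HP)// (ctmc_offdiag_le HP).
have FQ i : S i -> F n i @[n --> \oo] --> generator g i j.
  by move=> Si; exact: (ctmc_rate_seq HP Si Sj u0 (cvg_step 1)).
have := Rintegral_dominated (mu := mu) FC FQ.
rewrite (_ : (fun n => _) = cst 0); last by apply/funext.
move=> /(cvg_lim (@Rhausdorff R)); rewrite lim_cst// => /esym.
have iR : mu.-integrable S (EFin \o (fun i => rate g i j)).
  by apply: (@bounded_integrable _ mu _ _ Lam) => i; exact: rate_le.
have q0 : 0 <= q j by have /andP[/ltW] := exit_rate_itv Sj.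
have iq : mu.-integrable S (EFin \o (fun i => (i == j)%:R * q j)).
  apply: (@bounded_integrable _ mu _ _ (q j)) => i Si.
  by rewrite ger0_norm ?mulr_ge0//; case: eqP => _; rewrite ?mul1r ?mul0r.
have -> : \int[mu]_(i in S) generator g i j =
    \int[mu]_(i in S) (rate g i j - (i == j)%:R * q j).
  apply: eq_Rintegral => i _; rewrite /generator (eq_sym j); case: eqVneq => [->|_].
  - rewrite /rate (eq_sym j) (negbTE (down_neq j)) (eq_sym j) (negbTE (up_neq j)) /=.
    by rewrite !mul0r mul1r add0r sub0r.
  - by rewrite mul0r subr0.
by rewrite RintegralB// Rintegral_point// => /eqP; rewrite subr_eq0 => /eqP ->; rewrite mulrC.
Qed.

(** The balance equations are summed against H and the sums exchanged. As H is nonnegative, Tonelli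
    applies and the equality holds in the extended reals, +oo included. *)
Lemma balanced_test mu (H : state -> R) : balanced mu -> (forall i, S i -> 0 <= H i) ->
  (\int[mu]_(i in S) (q i * H i)%:E =
   \int[mu]_(i in S) (r * H (down i) + beta * i.2%:R * H (up i))%:E)%E.
Proof.
move=> [mu1 bal] H0.
have mE i : mu [set i] = (fine (mu [set i]))%:E by rewrite fineK// fin_num_measure.
have m0 i : 0 <= fine (mu [set i]) by exact: fine_ge0.
have HR i : S i -> 0 <= r * H (down i) + beta * i.2%:R * H (up i).
  move=> Si; apply: addr_ge0.
    by rewrite mulr_ge0 ?(ltW r_gt0)// H0//; exact: state_space_down.
  (* For z = 0 the state [up i] may lie outside the state space, where the sign of H is unknown; its
     weight is then 0. *)
  have [->|i0] := posnP i.2; first by rewrite mulr0 mul0r.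
  by rewrite !mulr_ge0 ?(ltW beta_gt0)// H0//; exact: state_space_up.
have rates i : S i -> (\esum_(j in S) (rate g i j * H j)%:E =
    (r * H (down i) + beta * i.2%:R * H (up i))%:E)%E.
  move=> Si; have Sd := state_space_down Si.
  have rH0 j : S j -> (0 <= (rate g i j * H j)%:E)%E.
    by move=> Sj; rewrite lee_fin mulr_ge0// ?rate_ge0// H0.
  have rate0 j : j != down i -> (j != up i) || (i.2 == 0%N) -> rate g i j = 0.
    rewrite /rate => /negbTE -> /orP[/negbTE ->|/eqP ->]; rewrite ?mul0r ?addr0//.
    by rewrite !mulr0 addr0.
  have [i0|i0] := posnP i.2.
    rewrite (@esum_only _ _ _ _ (down i))// ?rate_down ?i0 ?mulr0 ?mul0r ?addr0//.
    by move=> j Sj jd; rewrite rate0 ?mul0r// i0 eqxx orbT.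
  have Su := state_space_up Si i0.
  rewrite (@esum_seq _ _ _ _ [:: down i; up i])//.
  - by rewrite big_cons big_seq1 rate_down rate_up -EFinD.
  - by rewrite /= inE eq_sym up_neq_down.
  - by move=> j; rewrite !inE => /orP[] /eqP ->.
  - by move=> j Sj; rewrite !inE negb_or => /andP[jd ju]; rewrite rate0 ?mul0r// ju.
have balE j : S j -> (\esum_(i in S) (rate g i j * fine (mu [set i]))%:E =
    (q j * fine (mu [set j]))%:E)%E.
  move=> Sj; rewrite -bal// /Rintegral fineK; last first.
    apply: integrable_fin_num => //.
    by apply: (@bounded_integrable _ mu _ _ Lam) => i; exact: rate_le.
  rewrite integral_esum; last by move=> i Si; rewrite lee_fin rate_ge0.
  by apply: eq_esum => i Si; rewrite [X in (_ * X)%E]mE -EFinM.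
rewrite !integral_esum; first last.
- by move=> i Si; rewrite lee_fin mulr_ge0 ?H0//; case/andP: (exit_rate_itv Si) => /ltW.
- by move=> i Si; rewrite lee_fin HR.
transitivity (\esum_(j in S) \esum_(i in S) (H j * (rate g i j * fine (mu [set i])))%:E)%E.
  apply: eq_esum => j Sj.
  under eq_esum do rewrite EFinM.
  rewrite esumZl ?H0//; last by move=> i Si; rewrite lee_fin mulr_ge0 ?rate_ge0.
  by rewrite balE// [X in (_ * X)%E]mE -!EFinM; congr EFin; ring.
rewrite esum_exchange; last by move=> i j Si Sj; rewrite lee_fin !mulr_ge0 ?rate_ge0 ?H0.
apply: eq_esum => i Si.
transitivity (\esum_(j in S) ((fine (mu [set i]))%:E * (rate g i j * H j)%:E))%E.
  by apply: eq_esum => j Sj; rewrite -EFinM; congr EFin; ring.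
rewrite esumZl//; last by move=> j Sj; rewrite lee_fin mulr_ge0 ?rate_ge0 ?H0.
by rewrite rates// -mE muleC.
Qed.

(** Three terms of the Chapman-Kolmogorov sum are enough for a lower bound. The indicator discards
    the arrival when z = 0, as [up i] need not be in the state space then. *)
Lemma ctmc_step_ge P h t i j : is_ctmc S (generator g) P -> 0 <= h -> 0 <= t -> S i -> S j ->
  P h i i * P t i j + P h i (down i) * P t (down i) j +
    (0 < i.2)%:R * (P h i (up i) * P t (up i) j) <= P (h + t) i j.
Proof.
move=> HP h0 t0 Si Sj; have Sd := state_space_down Si.
have F0 k : S k -> (0 <= (P h i k * P t k j)%:E)%E.
  by move=> Sk; rewrite lee_fin mulr_ge0// (ctmc_ge0 HP).
rewrite -lee_fin -(ctmc_semigroup HP h0 t0 Si Sj).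
have [i0|i0] := posnP i.2.
  have /= := @esum_ge_seq _ _ S _ [:: i; down i] F0.
  rewrite big_cons big_seq1 -EFinD /= mul0r addr0; apply.
  - by rewrite /= inE eq_sym down_neq.
  - by move=> k; rewrite !inE => /orP[] /eqP ->.
have Su := state_space_up Si i0.
have /= := @esum_ge_seq _ _ S _ [:: i; down i; up i] F0.
rewrite !big_cons big_nil adde0 -!EFinD /= mul1r addrA; apply.
- by rewrite /= !inE eq_sym (negbTE (down_neq i)) eq_sym (negbTE (up_neq i)) eq_sym up_neq_down.
- by move=> k; rewrite !inE => /or3P[] /eqP ->.
Qed.

(** Let U s be the mass at j after time s when starting from mu. A step of length h loses at most h
    times an error that tends to 0 with h: to first order the gains and losses cancel by balance.
    Cutting [0, t] into equal steps and refining gives U t >= U 0 = mu {j}, and since the total mass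
    is 1 on both sides, equality holds at every j. *)
Lemma balanced_stationary P mu : is_ctmc S (generator g) P -> balanced mu -> stationary S P mu.
Proof.
move=> HP bal; have [mu1 _] := bal; split=> // t j t0 Sj.
have Pb s i j' : 0 <= s -> S i -> S j' -> 0 <= P s i j' <= 1.
  by move=> s0 Si Sj'; rewrite (ctmc_ge0 HP)// (ctmc_le1 HP).
have Pn s i j' : 0 <= s -> S i -> S j' -> `|P s i j'| <= 1.
  by move=> s0 Si Sj'; have /andP[? ?] := Pb s i j' s0 Si Sj'; rewrite ger0_norm.
have iP s j' : 0 <= s -> S j' -> mu.-integrable S (EFin \o (fun i => P s i j')).
  by move=> s0 Sj'; apply: (@bounded_integrable _ mu _ _ 1) => i Si; exact: Pn.
pose U (j' : state) (s : R) := \int[mu]_(i in S) P s i j'.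
(* The error of the two jump rates at step h. The diagonal needs no error term, as [ctmc_diag_ge]
   bounds it in the right direction for every h. *)
pose eps (h : R) i := `|r - P h i (down i) / h| +
  (0 < i.2)%:R * `|beta * i.2%:R - P h i (up i) / h|.
have eps_le (h : R) i : 0 < h -> S i -> `|eps h i| <= (r + Lam) + (Lam + Lam).
  move=> h0 Si; have /andP[q0 qL] := exit_rate_itv Si; have /andP[u0 uL] := up_rate_itv Si.
  have Sd := state_space_down Si.
  have PL k : S k -> k != i -> `|P h i k / h| <= Lam.
    move=> Sk ki; rewrite ger0_norm ?divr_ge0 ?(ltW h0) ?(ctmc_ge0 HP) ?(ltW h0)//.
    rewrite ler_pdivrMr// (le_trans (ctmc_offdiag_le HP (ltW h0) Si Sk ki))//.
    by rewrite ler_pM2r.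
  rewrite ger0_norm ?addr_ge0 ?mulr_ge0//; apply: lerD.
    rewrite (le_trans (ler_normB _ _))// lerD//; first by rewrite gtr0_norm.
    exact: PL (down_neq i).
  have [i0|i0] := posnP i.2; first by rewrite mul0r; lra.
  rewrite mul1r (le_trans (ler_normB _ _))// lerD//; first by rewrite ger0_norm.
  by apply: PL (up_neq i); exact: state_space_up.
have ieps (h : R) : 0 < h -> mu.-integrable S (EFin \o eps h).
  by move=> h0; apply: (@bounded_integrable _ mu _ _ (r + Lam + (Lam + Lam))) => i; exact: eps_le.
have step (h s : R) j' : 0 < h -> 0 <= s -> S j' ->
    U j' s - h * \int[mu]_(i in S) eps h i <= U j' (h + s).
  move=> h0 s0 Sj'.
  pose H i := P s i j'.
  have H01 i : S i -> 0 <= H i <= 1 by move=> Si; exact: Pb.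
  have Hu i : S i -> (0 < i.2)%N -> 0 <= H (up i) <= 1.
    by move=> Si i0; apply: H01; exact: state_space_up.
  pose G1 i := q i * H i; pose G2 i := r * H (down i) + beta * i.2%:R * H (up i).
  have iG1 : mu.-integrable S (EFin \o G1).
    apply: (@bounded_integrable _ mu _ _ Lam) => i Si.
    have /andP[? ?] := exit_rate_itv Si; have /andP[? ?] := H01 i Si.
    rewrite /G1 ger0_norm ?mulr_ge0 ?(ltW (_ : 0 < q i))//.
    by apply: le_trans (ler_piMr _ _) _ => //; exact: ltW.
  have iG2 : mu.-integrable S (EFin \o G2).
    apply: (@bounded_integrable _ mu _ _ (r + Lam)) => i Si.
    have Sd := state_space_down Si.
    have /andP[? uL] := up_rate_itv Si; have /andP[? ?] := H01 _ Sd.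
    rewrite (le_trans (ler_normD _ _))// lerD//.
      by rewrite ger0_norm ?mulr_ge0 ?(ltW r_gt0)// ler_piMr// ltW.
    have [->|i0] := posnP i.2; first by rewrite mulr0 mul0r normr0; have := r_gt0; lra.
    have /andP[? ?] := Hu i Si i0.
    have bH0 : 0 <= beta * i.2%:R * H (up i) by apply: mulr_ge0.
    have bH1 : beta * i.2%:R * H (up i) <= beta * i.2%:R by apply: ler_piMr.
    by rewrite (ger0_norm bH0); exact: le_trans bH1 uL.
  have G12 : \int[mu]_(i in S) G1 i = \int[mu]_(i in S) G2 i.
    congr fine; apply: (@balanced_test mu H bal) => i /H01 /andP[] //.
  have iH : mu.-integrable S (EFin \o H) by exact: iP.
  have iB : mu.-integrable S (EFin \o (fun i => G2 i - G1 i)) by exact: integrableB_EFin.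
  have iZ k (f : state -> R) : mu.-integrable S (EFin \o f) ->
    mu.-integrable S (EFin \o (fun i => k * f i)) by exact: integrableZ_EFin.
  have iD : mu.-integrable S (EFin \o (fun i => H i + h * (G2 i - G1 i))).
    exact: integrableD_EFin iH (iZ h _ iB).
  have -> : U j' s - h * \int[mu]_(i in S) eps h i =
      \int[mu]_(i in S) (H i + h * (G2 i - G1 i) - h * eps h i).
    rewrite RintegralB//; last exact: iZ (ieps _ h0).
    rewrite RintegralD//; last exact: iZ.
    rewrite !RintegralZl//; last exact: ieps.
    by rewrite RintegralB// G12 subrr mulr0 addr0.
  apply: le_Rintegral => //.
  - exact: integrableB_EFin iD (iZ h _ (ieps _ h0)).
  - by apply: iP => //; rewrite addr_ge0// ltW.
  move=> i Si; apply: le_trans (ctmc_step_ge HP (ltW h0) s0 Si Sj').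
  have Sd := state_space_down Si.
  have diag := ctmc_diag_ge HP (ltW h0) Si; have /andP[? ?] := H01 i Si.
  have /andP[? ?] := H01 _ Sd; rewrite /eps /G1 /G2 -!/(H _).
  set x := P h i (down i) / h; set y := P h i (up i) / h.
  have dE : P h i (down i) = h * x by rewrite mulrC mulfVK// gt_eqF.
  have uE : P h i (up i) = h * y by rewrite mulrC mulfVK// gt_eqF.
  rewrite dE uE.
  have aux (a e y' : R) : a <= e -> 0 <= e -> 0 <= y' -> y' <= 1 -> 0 <= e - a * y'.
    move=> ae e0 y0 y1; rewrite subr_ge0 (le_trans (ler_wpM2r y0 ae))//.
    exact: ler_piMr.
  have := ler_norm (r - x); have := ler_norm (beta * i.2%:R - y).
  have [i0|i0] := posnP i.2.
    rewrite i0 !mulr0 !mul0r !addr0 => _ e1.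
    have A : 0 <= h * (`|r - x| - (r - x) * H (down i)) by rewrite mulr_ge0 ?(ltW h0)// aux.
    have C : 0 <= (P h i i - (1 - r * h)) * H i by rewrite mulr_ge0// subr_ge0; move: diag; rewrite i0 mulr0 addr0.
    move: A C; rewrite /H; lra.
  have /andP[? ?] := Hu i Si i0.
  rewrite !mul1r => e2 e1.
  have A : 0 <= h * (`|r - x| - (r - x) * H (down i)) by rewrite mulr_ge0 ?(ltW h0)// aux.
  have B : 0 <= h * (`|beta * i.2%:R - y| - (beta * i.2%:R - y) * H (up i)).
    by rewrite mulr_ge0 ?(ltW h0)// aux.
  have C : 0 <= (P h i i - (1 - q i * h)) * H i by rewrite mulr_ge0// subr_ge0.
  move: A B C; rewrite /H; lra.
have eps0 : 0 < t -> \int[mu]_(i in S) eps (t * n.+1%:R^-1) i @[n --> \oo] --> (0 : R).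
  move=> tt0; have h0 n : 0 < t * n.+1%:R^-1 by rewrite mulr_gt0// invr_gt0.
  rewrite -[X in _ --> X](_ : \int[mu]_(i in S) 0 = 0); last by rewrite Rintegral_cst1.
  apply: (Rintegral_dominated (C := r + Lam + (Lam + Lam))) => [n i Si|i Si]; first exact: eps_le.
  have Sd := state_space_down Si.
  rewrite -[X in _ --> X]addr0; apply: cvgD.
    rewrite -[X in _ --> X](normr0 R); apply: cvg_norm.
    rewrite -[X in _ --> X](subrr r); apply: cvgB; first exact: cvg_cst.
    have := ctmc_rate_seq HP Si Sd h0 (cvg_step t).
    by rewrite generator_down (negbTE (down_neq i)); under eq_fun do rewrite subr0.
  have [i0|i0] := posnP i.2.
    by under eq_fun do rewrite mul0r; exact: cvg_cst.
  have Su := state_space_up Si i0.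
  rewrite -[X in _ --> X](mulr0 1); apply: cvgM; first exact: cvg_cst.
  rewrite -[X in _ --> X](normr0 R); apply: cvg_norm.
  rewrite -[X in _ --> X](subrr (beta * i.2%:R)); apply: cvgB; first exact: cvg_cst.
  have := ctmc_rate_seq HP Si Su h0 (cvg_step t).
  by rewrite generator_up (negbTE (up_neq i)); under eq_fun do rewrite subr0.
have U0 j' : S j' -> U j' 0 = fine (mu [set j']).
  move=> Sj'; rewrite -(Rintegral_eq mu Sj') /U; apply: eq_Rintegral => i /set_mem Si.
  by rewrite (ctmc_0 HP)// eq_sym.
have Ule j' : S j' -> fine (mu [set j']) <= U j' t.
  move=> Sj'; rewrite -U0//; move: t0; rewrite le_eqVlt => /predU1P[<-//|t0].
  have h0 n : 0 < t * n.+1%:R^-1 by rewrite mulr_gt0// invr_gt0.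
  have tele h m : 0 < h -> U j' 0 - (h *+ m) * \int[mu]_(i in S) eps h i <= U j' (h *+ m).
    move=> hh; elim: m => [|m IH]; first by rewrite mulr0n mul0r subr0.
    rewrite !mulrS; apply: le_trans (step _ _ _ hh (mulrn_wge0 _ (ltW hh)) Sj').
    by move: IH; lra.
  have h n : U j' 0 - U j' t <= t * \int[mu]_(i in S) eps (t * n.+1%:R^-1) i.
    have := tele _ n.+1 (h0 n).
    by rewrite -[(_ / _) *+ _]mulr_natr mulfVK ?pnatr_eq0//; lra.
  have : U j' 0 - U j' t <= t * 0.
    by apply: (cvgr_to_ge (cvgM (cvg_cst t) (eps0 t0))); exact: nearW.
  by rewrite mulr0 subr_le0.
have UE : (\int[mu]_(i in S) (P t i j)%:E)%E = (U j t)%:E.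
  by rewrite /U /Rintegral fineK//; apply: integrable_fin_num => //; exact: iP.
rewrite UE; have -> : mu [set j] = (fine (mu [set j]))%:E by rewrite fineK// fin_num_measure.
congr EFin; apply/esym; apply: (@esum_eq_mass _ _ S (fun k => fine (mu [set k])) (U^~ t)) => //.
- by move=> k Sk; rewrite fine_ge0//= Ule.
- by rewrite esum_prob mu1 ltry.
rewrite esum_prob mu1.
have UjE k : S k -> ((U k t)%:E = \esum_(i in S) ((P t i k)%:E * mu [set i]))%E.
  move=> Sk; rewrite -integral_esum; last by move=> i Si; rewrite lee_fin (ctmc_ge0 HP).
  by rewrite /U /Rintegral fineK//; apply: integrable_fin_num => //; exact: iP.
under eq_esum => k Sk do rewrite (UjE k Sk).
rewrite esum_exchange; last first.
  by move=> k i Sk Si; rewrite mule_ge0// lee_fin (ctmc_ge0 HP).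
rewrite -mu1 -esum_prob; apply: le_esum => i Si.
have muE : mu [set i] = (fine (mu [set i]))%:E by rewrite fineK// fin_num_measure.
under eq_esum do rewrite muleC muE.
rewrite esumZl ?fine_ge0//; last by move=> k Sk; rewrite lee_fin (ctmc_ge0 HP).
by rewrite (ctmc_mass HP t0 Si) mule1.
Qed.

Lemma stationary_esum P (mu : probability state R) t j : is_ctmc S (generator g) P ->
  stationary S P mu -> 0 <= t -> S j ->
  (\esum_(i in S) (fine (mu [set i]) * P t i j)%:E = (fine (mu [set j]))%:E)%E.
Proof.
move=> HP [_ st] t0 Sj; rewrite fineK ?fin_num_measure// -(st t j t0 Sj).
rewrite integral_esum; last by move=> i Si; rewrite lee_fin (ctmc_ge0 HP).
by apply: eq_esum => i Si; rewrite mulrC EFinM fineK// fin_num_measure.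
Qed.

Lemma invariant_gt0 P (m : state -> R) i0 j : is_ctmc S (generator g) P ->
  (forall i, S i -> 0 <= m i) ->
  (forall t j, 0 <= t -> S j -> (\esum_(i in S) (m i * P t i j)%:E = (m j)%:E)%E) ->
  S i0 -> 0 < m i0 -> S j -> 0 < m j.
Proof.
move=> HP m0 inv Si0 mi0 Sj.
have [t t0 Pt] := ctmc_irreducible HP Si0 Sj.
rewrite -lte_fin -(inv t j t0 Sj).
apply: (@lt_le_trans _ _ (m i0 * P t i0 j)%:E); first by rewrite lte_fin mulr_gt0.
apply: (esum_ge1 (a := fun i => (m i * P t i j)%:E)) => // i Si.
by rewrite lee_fin mulr_ge0 ?m0// (ctmc_ge0 HP).
Qed.

Lemma prob_exists_gt0 (mu : probability state R) : mu S = 1%E ->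
  exists2 i, S i & 0 < fine (mu [set i]).
Proof.
move=> mu1; apply: contrapT => h.
have : (\esum_(i in S) (fine (mu [set i]))%:E = 0)%E.
  apply: esum1 => i Si; congr EFin; apply/eqP; rewrite eq_le fine_ge0// andbT leNgt.
  by apply/negP => mi; apply: h; exists i.
by rewrite esum_prob mu1 => /eqP; rewrite onee_eq0.
Qed.

Lemma stationary_gt0 P mu j : is_ctmc S (generator g) P -> stationary S P mu -> S j ->
  0 < fine (mu [set j]).
Proof.
move=> HP st Sj; have [i Si mi] := prob_exists_gt0 st.1.
apply: (@invariant_gt0 P (fun i => fine (mu [set i])) i j HP) => //.
- by move=> k _; exact: fine_ge0.
- by move=> t k t0 Sk; exact: stationary_esum.
Qed.

(* The pointwise minimum m of two invariant laws a, b is subinvariant, hence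
   invariant, so a - m is an invariant weight: it is positive everywhere or zero. *)
Lemma stationary_unique P mu mu' : is_ctmc S (generator g) P ->
  stationary S P mu -> stationary S P mu' -> forall A, mu' A = mu A.
Proof.
move=> HP st st'.
pose a i := fine (mu [set i]); pose b i := fine (mu' [set i]).
have a0 i : 0 <= a i by exact: fine_ge0.
have b0 i : 0 <= b i by exact: fine_ge0.
pose m i := Num.min (a i) (b i).
have m0 i : 0 <= m i by rewrite /m le_min a0 b0.
have ma i : m i <= a i by rewrite /m ge_min lexx.
have mb i : m i <= b i by rewrite /m ge_min lexx orbT.
have suma : (\esum_(i in S) (a i)%:E = 1)%E by rewrite esum_prob st.1.
have sumb : (\esum_(i in S) (b i)%:E = 1)%E by rewrite esum_prob st'.1.
have summ : (\esum_(i in S) (m i)%:E < +oo)%E.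
  by rewrite (le_lt_trans _ (ltry 1))// -suma; apply: le_esum => i _; rewrite lee_fin.
have summf : (\esum_(i in S) (m i)%:E)%E \is a fin_num by exact: esum_ge0_finP.
have minv t j : 0 <= t -> S j -> (\esum_(i in S) (m i * P t i j)%:E = (m j)%:E)%E.
  move=> t0; pose n k := (\esum_(i in S) (m i * P t i k)%:E)%E.
  have mP0 i k : S i -> S k -> 0 <= m i * P t i k.
    by move=> Si Sk; rewrite mulr_ge0// (ctmc_ge0 HP).
  have nle k : S k -> (n k <= (m k)%:E)%E.
    move=> Sk; rewrite /m EFin_min le_min -(stationary_esum HP st t0 Sk).
    rewrite -(stationary_esum HP st' t0 Sk); apply/andP; split;
    by apply: le_esum => i Si; rewrite lee_fin ler_wpM2r ?(ctmc_ge0 HP).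
  have n0 k : S k -> (0 <= n k)%E by move=> Sk; apply: esum_ge0 => i Si; rewrite lee_fin mP0.
  have nf k : S k -> ((fine (n k))%:E = n k).
    by move=> Sk; rewrite fineK// ge0_fin_numE ?n0// (le_lt_trans (nle k Sk)) ?ltry.
  have sumn : (\esum_(k in S) n k = \esum_(i in S) (m i)%:E)%E.
    rewrite esum_exchange; last by move=> k i Sk Si; rewrite lee_fin mP0.
    apply: eq_esum => i Si; under eq_esum do rewrite EFinM.
    rewrite esumZl ?(ctmc_mass HP t0 Si) ?mule1// => k Sk.
    by rewrite lee_fin (ctmc_ge0 HP).
  move=> Sj; rewrite -/(n j) -nf//; congr EFin.
  have sumn' : (\esum_(k in S) (fine (n k))%:E = \esum_(k in S) n k)%E by exact: eq_esum.
  apply: (@esum_eq_mass _ _ S (fun k => fine (n k)) m) => //.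
  - by move=> k Sk; rewrite fine_ge0 ?n0//= -lee_fin nf// nle.
  - by rewrite sumn' sumn.
  - by rewrite sumn' sumn.
have diff_inv (c' : state -> R) : (forall i, m i <= c' i) ->
    (forall t j, 0 <= t -> S j -> (\esum_(i in S) (c' i * P t i j)%:E = (c' j)%:E)%E) ->
    forall t j, 0 <= t -> S j ->
      (\esum_(i in S) ((c' i - m i) * P t i j)%:E = (c' j - m j)%:E)%E.
  move=> mc cinv t j t0 Sj; rewrite EFinB -(cinv t j t0 Sj) -(minv t j t0 Sj).
  have -> : (\esum_(i in S) (c' i * P t i j)%:E = \esum_(i in S) ((c' i - m i) * P t i j)%:E +
      \esum_(i in S) (m i * P t i j)%:E)%E.
    rewrite -esumD; first by apply: eq_esum => i _; rewrite -EFinD -mulrDl subrK.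
    - by move=> i Si; rewrite lee_fin mulr_ge0 ?subr_ge0// (ctmc_ge0 HP).
    - by move=> i Si; rewrite lee_fin mulr_ge0 ?subr_ge0// (ctmc_ge0 HP).
  by rewrite minv// addeK.
have ab i : S i -> a i <= b i.
  move=> Si; rewrite leNgt; apply/negP => bai.
  have lt j : S j -> b j < a j.
    move=> Sj; have : 0 < a j - m j.
      apply: (@invariant_gt0 P (fun i => a i - m i) i j HP) => //.
      - by move=> k Sk; rewrite subr_ge0.
      - by apply: diff_inv => // t k t0 Sk; exact: stationary_esum.
      - by rewrite subr_gt0 /m gt_min bai orbT.
    by rewrite subr_gt0 /m gt_min ltxx.
  have : b i = a i.
    apply: (@esum_eq_mass _ _ S b a) => //.
    - by move=> j /lt /ltW ->; rewrite b0.
    - by rewrite sumb ltry.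
    - by rewrite suma sumb.
  by move: bai => /[swap] ->; rewrite ltxx.
have pt i : S i -> mu' [set i] = mu [set i].
  move=> Si; rewrite -[LHS]fineK ?fin_num_measure// -[RHS]fineK ?fin_num_measure//.
  congr EFin; apply/esym; apply: (@esum_eq_mass _ _ S a b) => //.
  - by move=> j Sj; rewrite a0 ab.
  - by rewrite suma ltry.
  - by rewrite suma sumb.
move=> A; rewrite (prob_support _ st.1) (prob_support _ st'.1) -!esum_prob.
by apply: eq_esum => i [_ Si]; rewrite pt.
Qed.

(** * Positive recurrence *)

Section recurrence.
Context (P : R -> state -> state -> R) (HP : is_ctmc S (generator g) P).
Context (mu : probability state R) (st : stationary S P mu).
Context (i : state) (Si : S i) (dt : R) (dt_gt0 : 0 < dt).

(* avoid m s: probability that the skeleton chain with step dt, started at s,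
   is not at i at any of the times 1, ..., m. *)
Fixpoint avoid (m : nat) (s : state) : \bar R :=
  if m is m'.+1 then (\esum_(j in S `\ i) ((P dt s j)%:E * avoid m' j))%E else 1%E.

Lemma avoid_itv m s : S s -> (0 <= avoid m s <= 1)%E.
Proof.
elim: m s => [|m IH] s Ss /=; first by rewrite lee01 lexx.
have P0 j : S j -> (0 <= (P dt s j)%:E)%E by move=> Sj; rewrite lee_fin (ctmc_ge0 HP)// ltW.
apply/andP; split.
  by apply: esum_ge0 => j [Sj _]; rewrite mule_ge0 ?P0//; case/andP: (IH j Sj).
rewrite -(ctmc_mass HP (ltW dt_gt0) Ss).
apply: (@le_trans _ _ (\esum_(j in S `\ i) (P dt s j)%:E)%E).
  apply: le_esum => j [Sj _]; rewrite -[leRHS]mule1 lee_wpmul2l ?P0//.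
  by case/andP: (IH j Sj).
by apply: subset_esum => j [].
Qed.

Lemma avoid_fin m s : S s -> avoid m s \is a fin_num.
Proof.
move=> /(avoid_itv m) /andP[a0 a1].
by rewrite ge0_fin_numE// (le_lt_trans a1)// ltry.
Qed.

Let wt s := fine (mu [set s]).
Let u m := (\esum_(s in S `\ i) ((wt s)%:E * avoid m s))%E.

(* Kac's argument: u m is the stationary probability of not being at i at the
   times 0, ..., m. *)
Lemma avoid_kac_step m : ((wt i)%:E * avoid m.+1 i + u m.+1 = u m)%E.
Proof.
have a0 k s : S s -> (0 <= avoid k s)%E by move=> /(avoid_itv k) /andP[].
have w0 s : (0 <= (wt s)%:E)%E by rewrite lee_fin fine_ge0.
have P0 s j : S s -> S j -> (0 <= (P dt s j)%:E)%E.
  by move=> Ss Sj; rewrite lee_fin (ctmc_ge0 HP)// ltW.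
have T0 k s : S s -> (0 <= (wt s)%:E * avoid k s)%E by move=> Ss; rewrite mule_ge0 ?a0.
have -> : ((wt i)%:E * avoid m.+1 i + u m.+1 =
    \esum_(s in S) ((wt s)%:E * avoid m.+1 s))%E.
  rewrite [RHS](esumID [set i]); last by move=> s; exact: T0.
  congr (_ + _)%E.
  have -> : S `&` [set i] = [set i] by apply/seteqP; split=> [s []//|s ->].
  by rewrite esum_set1// T0.
transitivity (\esum_(s in S) \esum_(j in S `\ i) ((wt s)%:E * ((P dt s j)%:E * avoid m j)))%E.
  apply: eq_esum => s Ss /=; rewrite esumZl ?fine_ge0// => j [Sj _].
  by rewrite mule_ge0 ?P0 ?a0.
rewrite esum_exchange; last by move=> s j Ss [Sj _]; rewrite !mule_ge0 ?P0 ?a0.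
apply: eq_esum => j [Sj _]; rewrite -(fineK (avoid_fin m Sj)).
transitivity (\esum_(s in S) ((fine (avoid m j))%:E * (wt s * P dt s j)%:E))%E.
  by apply: eq_esum => s Ss; rewrite -!EFinM; congr EFin; ring.
rewrite esumZl ?fine_ge0 ?a0//; last first.
  by move=> s Ss; rewrite EFinM mule_ge0 ?P0.
by rewrite (stationary_esum HP st (ltW dt_gt0) Sj) muleC.
Qed.

(** Telescoping [avoid_kac_step] bounds the terms m >= 1 by u 0 / wt i <= 1 / wt i; the term m = 0
    is 1 <= 1 / wt i, hence the factor 2. *)
Lemma avoid_sum_le n : \sum_(m < n) fine (avoid m i) <= 2 / wt i.
Proof.
have wi : 0 < wt i by exact: (stationary_gt0 HP st Si).
rewrite ler_pdivlMr//.
have w1 : wt i <= 1.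
  by rewrite -lee_fin fineK ?fin_num_measure// probability_le1.
have uf m : u m \is a fin_num.
  rewrite ge0_fin_numE; last first.
    apply: esum_ge0 => s [Ss _]; rewrite mule_ge0 ?lee_fin ?fine_ge0//.
    by case/andP: (avoid_itv m Ss).
  apply: (@le_lt_trans _ _ 1%E); last exact: ltry.
  rewrite -st.1 -esum_prob; apply: (@le_trans _ _ (\esum_(s in S `\ i) (wt s)%:E)%E).
    apply: le_esum => s [Ss _]; rewrite -[leRHS]mule1 lee_wpmul2l ?lee_fin ?fine_ge0//.
    by case/andP: (avoid_itv m Ss).
  by apply: subset_esum => s [].
have u0 m : 0 <= fine (u m).
  rewrite fine_ge0//; apply: esum_ge0 => s [Ss _]; rewrite mule_ge0 ?lee_fin ?fine_ge0//.
  by case/andP: (avoid_itv m Ss).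
have step m : wt i * fine (avoid m.+1 i) + fine (u m.+1) = fine (u m).
  apply: EFin_inj; rewrite EFinD EFinM (fineK (avoid_fin _ Si)) (fineK (uf _)) (fineK (uf _)).
  exact: avoid_kac_step.
have u01 : fine (u 0%N) <= 1.
  rewrite -lee_fin fineK// -st.1 -esum_prob.
  rewrite /u; under eq_esum do rewrite mule1.
  by apply: subset_esum => s [].
case: n => [|n]; first by rewrite big_ord0 mul0r.
suff h : (\sum_(m < n) fine (avoid m.+1 i)) * wt i + fine (u n) <= 1.
  rewrite big_ord_recl /= mulrDl mul1r; have := u0 n; lra.
elim: n => [|n IH]; first by rewrite big_ord0 mul0r add0r.
by rewrite big_ord_recr /= mulrDl; have := step n; lra.
Qed.

Let p := P dt i i.

(* Bounds the probability that the skeleton chain started at i has not both left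
   i and come back at the times 1, ..., n. *)
Fixpoint delay (n : nat) : R :=
  if n is n'.+1 then fine (avoid n i) + p * delay n' else 1.

(** A return requires leaving i first, and the skeleton chain stays at i for a geometric time.
    Summing the recursion gives sum delay <= sum avoid + p * sum delay, which is solved for the sum
    as p < 1. *)
Lemma delay_sum_le n : p < 1 -> \sum_(m < n) delay m <= 2 / wt i / (1 - p).
Proof.
move=> p1; have p0 : 0 <= p by rewrite (ctmc_ge0 HP)// ltW.
have wi : 0 < wt i by exact: (stationary_gt0 HP st Si).
rewrite ler_pdivlMr ?subr_gt0//.
have d0 m : 0 <= delay m.
  elim: m => //= m IH; rewrite addr_ge0 ?mulr_ge0// fine_ge0//.
  by case/andP: (avoid_itv m.+1 Si).
have C0 := avoid_sum_le n.
suff h : \sum_(m < n) delay m <= \sum_(m < n) fine (avoid m i) + p * \sum_(m < n) delay m.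
  by move: h C0; lra.
case: n {C0} => [|n]; first by rewrite !big_ord0 mulr0 addr0.
have le_S : \sum_(m < n) delay m <= \sum_(m < n.+1) delay m by rewrite big_ord_recr lerDl.
have e : \sum_(m < n.+1) delay m = \sum_(m < n.+1) fine (avoid m i) + p * \sum_(m < n) delay m.
  by rewrite !big_ord_recl /= big_split /= -mulr_sumr addrA.
by rewrite {1}e lerD2l; exact: ler_wpM2l.
Qed.

Lemma path_prob_rcons l (v : R) j t k :
  path_prob P t k (rcons l (v, j)) =
  path_prob P t k l * P (v - (last (t, k) l).1) (last (t, k) l).2 j.
Proof.
elim: l t k => [|[w s] l IH] t k /=; first by rewrite mulr1 mul1r.
by rewrite IH mulrA.
Qed.

Section realization.
Context d (W : measurableType d) (Pr : probability W R) (X : R -> W -> state)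
  (HX : is_realization S P i Pr X).

Let tn (n : nat) : R := n%:R * dt.
Let matches (l : seq (R * state)) : set W := [set w | all (fun p => X p.1 w == p.2) l].
Let avoiding n m : set W := [set w | forall a, (a < m)%N -> X (tn (n + a.+1)) w != i].
Let admissible (l : seq (R * state)) := path <=%R 0 [seq p.1 | p <- l] /\
  (forall p, p \in l -> S p.2).

Let tn_ge0 n : 0 <= tn n.
Proof. by rewrite mulr_ge0// ltW. Qed.

Let tnS n : tn n.+1 - tn n = dt.
Proof. by rewrite /tn -natr1 mulrDl mul1r addrAC subrr add0r. Qed.

Let measurable_at (t : R) j : 0 <= t -> measurable [set w | X t w == j].
Proof.
move=> t0; rewrite (_ : [set w | _] = X t @^-1` [set j]); last first.
  by apply/seteqP; split=> w /= /eqP.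
by rewrite -[X in measurable X]setTI; exact: (real_meas HX t0).
Qed.

Let measurable_matches l : admissible l -> measurable (matches l).
Proof.
move=> [pl _]; have aux (t0 : R) : 0 <= t0 -> path <=%R t0 [seq p.1 | p <- l] -> measurable (matches l).
  elim: l {pl} t0 => [|[t j] l IH] t0 t00 /=.
    by rewrite /matches (_ : [set w | _] = setT)//; apply/seteqP.
  move=> /andP[t0t pl]; have t_ge0 := le_trans t00 t0t.
  rewrite /matches (_ : [set w | _] = [set w | X t w == j] `&` matches l).
    by apply: measurableI; [exact: measurable_at|exact: IH pl].
  by apply/seteqP; split=> w /=; [move/andP|move=> []/= -> ->].
exact: aux pl.
Qed.

Let measurable_avoiding n m : measurable (avoiding n m).
Proof.
rewrite (_ : avoiding n m =
    \bigcap_a [set w | (a < m)%N -> X (tn (n + a.+1)) w != i]); last first.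
  by apply/seteqP; split=> w h a; [move=> _; exact: h|exact: (h a I)].
apply: bigcapT_measurable => a; case: (ltnP a m) => am; last first.
  by rewrite (_ : [set w | _] = setT)//; apply/seteqP; split.
rewrite (_ : [set w | _] = ~` [set w | X (tn (n + a.+1)) w == i]).
  by apply: measurableC; exact: measurable_at.
by apply/seteqP; split=> w /=; [move=> /(_ isT) /negP|move=> /negP h _].
Qed.

Let avoiding0 n : avoiding n 0 = setT.
Proof. by apply/seteqP; split. Qed.

Let avoidingS n m : avoiding n m.+1 =
  [set w | X (tn n.+1) w != i] `&` avoiding n.+1 m.
Proof.
apply/seteqP; split=> w /=.
  by move=> h; split=> [|a am]; [rewrite -addn1; exact: h|rewrite addSnnS; exact: (h a.+1)].
by move=> [h0 h] [_|a am]; [rewrite addn1|rewrite -addSnnS; exact: h].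
Qed.

Let admissible_rcons l n s j : admissible l -> last (0, i) l = (tn n, s) -> S j ->
  admissible (rcons l (tn n.+1, j)).
Proof.
move=> [pl Sl] ll Sj; split; last first.
  by move=> q; rewrite mem_rcons inE => /predU1P[->//|]; exact: Sl.
rewrite map_rcons rcons_path pl /=.
have -> : last 0 [seq q.1 | q <- l] = (last (0, i) l).1 by rewrite -(last_map fst).
by rewrite ll /= -subr_ge0 tnS ltW.
Qed.

Let matches_rcons l t j : matches (rcons l (t, j)) = [set w | X t w == j] `&` matches l.
Proof. by apply/seteqP; split=> w; rewrite /matches /= all_rcons => /andP. Qed.

Let path_prob_next l n s j : last (0, i) l = (tn n, s) ->
  path_prob P 0 i (rcons l (tn n.+1, j)) = path_prob P 0 i l * P dt s j.
Proof. by move=> ll; rewrite path_prob_rcons ll /= tnS. Qed.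

Let path_prob_ge0 l : admissible l -> 0 <= path_prob P 0 i l.
Proof. by move=> [pl Sl]; rewrite -lee_fin -(real_fdd HX pl Sl). Qed.

Let last_in l n s : admissible l -> last (0, i) l = (tn n, s) -> S s.
Proof.
move=> [_ Sl] ll; have := mem_last (0, i) l; rewrite ll inE => /predU1P[[_ ->]//|].
by move=> /Sl.
Qed.

(** The observed history [l] is general so that the induction can append the position at the next
    epoch; the finite-dimensional distributions then play the part of the Markov property. *)
Lemma prob_avoiding m l n s : admissible l -> last (0, i) l = (tn n, s) ->
  Pr (matches l `&` avoiding n m) = ((path_prob P 0 i l)%:E * avoid m s)%E.
Proof.
elim: m l n s => [|m IH] l n s al ll.
  by rewrite avoiding0 setIT /= mule1; apply: (real_fdd HX); case: al.
have -> : matches l `&` avoiding n m.+1 =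
    \bigcup_(j in S `\ i) (matches (rcons l (tn n.+1, j)) `&` avoiding n.+1 m).
  apply/seteqP; split=> w.
    rewrite avoidingS => -[ml [/= Xi aw]]; exists (X (tn n.+1) w).
      by split; [exact: real_space HX _ _ _|exact/eqP].
    by rewrite matches_rcons; split=> //; split=> /=.
  move=> [j [Sj ji]]; rewrite matches_rcons avoidingS => -[[/= /eqP Xj ml] aw].
  by split=> //; split=> //=; rewrite Xj; exact/eqP.
have aj j : S j -> admissible (rcons l (tn n.+1, j)) by exact: (admissible_rcons al ll).
rewrite measure_bigcup_state; first last.
- move=> j k _ _ [w []]; rewrite !matches_rcons => -[[/= /eqP <- _] _] [[/= /eqP <- _] _].
  by [].
- move=> j [Sj _]; apply: measurableI => //; exact: measurable_matches (aj j Sj).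
rewrite /= -esumZl; first last.
- exact: path_prob_ge0.
- move=> j [Sj _]; rewrite mule_ge0//.
    by rewrite lee_fin (ctmc_ge0 HP) ?ltW//; exact: last_in ll.
  by case/andP: (avoid_itv m Sj).
apply: eq_esum => j [Sj _].
rewrite (IH _ n.+1 j (aj j Sj)) ?last_rcons//.
by rewrite (path_prob_next _ ll) EFinM muleA.
Qed.

(** Along the skeleton, no departure from i followed by a return has been seen yet. Off [quiet 0 m]
    the return time is at most [tn m]. *)
Let quiet n m : set W := [set w | forall a b, (a < b <= m)%N ->
  X (tn (n + a)) w != i -> X (tn (n + b)) w != i].

Let measurable_quiet n m : measurable (quiet n m).
Proof.
rewrite (_ : quiet n m = \bigcap_a \bigcap_b [set w | (a < b <= m)%N ->
    X (tn (n + a)) w != i -> X (tn (n + b)) w != i]); last first.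
  apply/seteqP; split=> w h; first by move=> a _ b _; exact: h.
  by move=> a b; exact: (h a I b I).
apply: bigcapT_measurable => a; apply: bigcapT_measurable => b.
case: (boolP (a < b <= m)%N) => ab; last first.
  by rewrite (_ : [set w | _] = setT)//; apply/seteqP; split.
rewrite (_ : [set w | _] = [set w | X (tn (n + a)) w == i] `|` ~` [set w | X (tn (n + b)) w == i]).
  apply: measurableU; first exact: measurable_at.
  by apply: measurableC; exact: measurable_at.
apply/seteqP; split=> w /=.
  by move=> /(_ isT); case: eqP => [|_ /(_ isT)]; [left|right; exact/negP].
by move=> [/eqP ->|/negP h _ _//]; rewrite eqxx.
Qed.

(** Split at the next epoch: either the path is at i again and the event restarts with one epoch
    less, or it has left and must avoid i at all the remaining epochs. *)
Lemma prob_quiet m l n : admissible l -> last (0, i) l = (tn n, i) ->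
  (Pr (matches l `&` quiet n m) <= (path_prob P 0 i l * delay m)%:E)%E.
Proof.
elim: m l n => [|m IH] l n al ll /=.
  rewrite mulr1 -(real_fdd HX (proj1 al) (proj2 al)).
  apply: le_measure; rewrite ?inE; last by move=> w [].
    by apply: measurableI => //; exact: measurable_matches.
  exact: measurable_matches.
have al' := admissible_rcons al ll Si.
have ml := measurable_matches al; have ml' := measurable_matches al'.
apply: (@le_trans _ _ (Pr ((matches l `&` avoiding n m.+1) `|`
    (matches (rcons l (tn n.+1, i)) `&` quiet n.+1 m)))).
  apply: le_measure; rewrite ?inE.
  - exact: measurableI.
  - by apply: measurableU; exact: measurableI.
  move=> w [mw qw]; case: (eqVneq (X (tn n.+1) w) i) => Xi.
    right; split; first by rewrite matches_rcons; split=> //=; exact/eqP.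
    by move=> a b ab; have := qw a.+1 b.+1; rewrite -!addSnnS; exact.
  left; split=> // a am; case: a am => [|a] am; first by rewrite addn1.
  by apply: (qw 1%N a.+2) => //; rewrite addn1.
apply: (le_trans (measureU2 _ _ _)); try exact: measurableI.
rewrite mulrDr EFinD; apply: leeD.
  rewrite -[fine _]/(fine (avoid m.+1 i)) EFinM (fineK (avoid_fin m.+1 Si)).
  by rewrite -(prob_avoiding _ al ll).
apply: (le_trans (IH _ _ al' _)); first by rewrite last_rcons.
by rewrite (path_prob_next _ ll) mulrA.
Qed.

(** Pointwise, the return time is at most [dt] times the number of n for which [quiet 0 n] holds:
    this number is at least the first epoch at which a return shows, and is +oo if none ever shows.
    Its expectation is a sum of probabilities bounded by [delay]. *)
Lemma return_time_lt_pinfty : p < 1 -> (\int[Pr]_w return_time (X ^~ w) i < +oo)%E.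
Proof.
move=> p1.
have rt0 w : (0 <= return_time (X ^~ w) i)%E.
  apply: le_ereal_inf_tmp => /= _ [t [_ [s [s0 st' _]]] <-].
  by rewrite lee_fin (le_trans s0)// ltW.
pose B n (w : W) := ((\1_(quiet 0 n) w : R)%:E).
have rt_le w : (return_time (X ^~ w) i <= dt%:E * \sum_(n <oo) B n w)%E.
  have sum_ge N : (forall n, (n < N)%N -> quiet 0 n w) -> (N%:R%:E <= \sum_(n <oo) B n w)%E.
    move=> qN; apply: le_trans (nneseries_lim_ge N _); last first.
      by move=> n _; rewrite lee_fin.
    rewrite big_mkord (eq_bigr (fun=> 1%E)); last first.
      by move=> n _; rewrite /B indicE mem_set//; exact: qN.
    by rewrite sumEFin lee_fin sumr_const card_ord.
  pose bad N := [exists a : 'I_N, X (tn a) w != i] && (X (tn N) w == i).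
  have quietP n : (forall b, (b <= n)%N -> ~~ bad b) -> quiet 0 n w.
    move=> nb a b /andP[ab bn]; rewrite !add0n => Xa; apply/negP => Xb.
    by have /negP := nb b bn; apply; rewrite /bad Xb andbT; apply/existsP; exists (Ordinal ab).
  have [[N bN]|nb] := pselect (exists N, bad N); last first.
    have -> : (\sum_(n <oo) B n w = +oo)%E.
      apply/eqyP => A A0; have [N AN] : exists N : nat, A <= N%:R.
        by exists (Num.truncn A).+1; rewrite ltW// truncnS_gt.
      apply: (@le_trans _ _ N%:R%:E); first by rewrite lee_fin.
      apply: sum_ge => n _; apply: quietP => b _; apply/negP => bb.
      by apply: nb; exists b.
    by rewrite gt0_muley ?lte_fin// leey.
  case: (ex_minnP (ex_intro _ N bN)) => M /andP[/existsP[a Xa] /eqP XM] minM.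
  apply: (@le_trans _ _ (tn M)%:E); last first.
    rewrite /tn mulrC EFinM; apply: lee_wpmul2l; first by rewrite lee_fin ltW.
    apply: sum_ge => n nM; apply: quietP => b bn; apply/negP => /minM.
    by rewrite leqNgt (leq_ltn_trans bn nM).
  apply: ereal_inf_lbound; exists (tn M) => //; split=> //.
  exists (tn a); split=> //; last exact/eqP.
  by rewrite /tn ltr_pM2r// ltr_nat.
apply: (le_lt_trans (ge0_le_integralT Pr rt0 rt_le)).
rewrite ge0_integralZl//; last 3 first.
- apply: (@ge0_emeasurable_sum _ _ _ setT B predT).
    by move=> n w _ _; rewrite lee_fin.
  by move=> n _; apply/measurable_EFinP; exact: measurable_indic.
- by move=> w _; apply: nneseries_ge0 => n _ _; rewrite lee_fin.
- by rewrite lee_fin ltW.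
rewrite integral_nneseries//; last 2 first.
- by move=> n; apply/measurable_EFinP; exact: measurable_indic.
- by move=> n w _; rewrite lee_fin.
have IB n : (\int[Pr]_w B n w = Pr (quiet 0 n))%E.
  by rewrite integral_indic// setIT.
have QB n : (Pr (quiet 0 n) <= (delay n)%:E)%E.
  have := @prob_quiet n [::] 0; rewrite /= mul1r => h.
  rewrite (_ : quiet 0 n = matches [::] `&` quiet 0 n); first apply: h.
  - by split.
  - by rewrite /tn mul0r.
  - by rewrite (_ : matches [::] = setT) ?setTI//; apply/seteqP.
apply: (@le_lt_trans _ _ (dt%:E * (2 / wt i / (1 - p))%:E)%E); last by rewrite -EFinM ltry.
apply: lee_wpmul2l; first by rewrite lee_fin ltW.
apply: lime_le; first by apply: is_cvg_nneseries => n _ _; rewrite IB; exact: measure_ge0.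
apply: nearW => n; rewrite big_mkord.
apply: (@le_trans _ _ (\sum_(m < n) (delay m)%:E)%E).
  by apply: lee_sum => m _; rewrite IB; exact: QB.
by rewrite sumEFin lee_fin; exact: delay_sum_le.
Qed.

End realization.

End recurrence.

Lemma ctmc_positive_recurrent P mu : is_ctmc S (generator g) P -> stationary S P mu ->
  positive_recurrent S P.
Proof.
move=> HP st i Si d W Pr X HX.
pose u n := 1 * n.+1%:R^-1 : R.
have u0 n : 0 < u n by rewrite mulr_gt0// invr_gt0.
(* The derivative of P t i i at 0 is negative, so some small step [dt] has P dt i i < 1, as the
   geometric bound on the stay requires. *)
have Q0 : generator g i i < 0.
  by rewrite /generator eqxx oppr_lt0; case/andP: (exit_rate_itv Si).
have /cvgr_lt/(_ _ Q0)[N _ /(_ N (leqnn N))/=] := ctmc_rate_seq HP Si Si u0 (cvg_step 1).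
rewrite eqxx pmulr_llt0 ?invr_gt0// subr_lt0 => p1.
exact: (return_time_lt_pinfty HP st Si (u0 N) HX p1).
Qed.

(** * Uniformization *)

Section uniformization.

Let pd : R := r / Lam.
Let pu (i : state) : R := beta * (minn i.2 Zm)%:R / Lam.
Let ps i := 1 - pd - pu i.

Let Lam_gt0 : 0 < Lam.
Proof. by rewrite ltr_wpDr// mulr_ge0// ltW. Qed.

Let pd_ge0 : 0 <= pd. Proof. by rewrite divr_ge0 ?ltW. Qed.
Let pu_ge0 i : 0 <= pu i. Proof. by rewrite divr_ge0 ?(ltW Lam_gt0)// mulr_ge0// ltW. Qed.
Let pu0 i : i.2 = 0%N -> pu i = 0.
Proof. by move=> i0; rewrite /pu i0 min0n mulr0 mul0r. Qed.

Let ps_ge0 i : 0 <= ps i.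
Proof.
rewrite /ps /pd /pu -addrA -opprD subr_ge0 -mulrDl ler_pdivrMr// mul1r.
by rewrite lerD2l ler_pM2l// ler_nat geq_minr.
Qed.

(* The process sampled at the epochs of a Poisson process of rate Lam; minn only
   matters off the state space, where it keeps the weights nonnegative. *)
Fixpoint jump (n : nat) (i j : state) : R :=
  if n is n'.+1 then pd * jump n' (down i) j + pu i * jump n' (up i) j + ps i * jump n' i j
  else (j == i)%:R.

Lemma jump_itv n i j : 0 <= jump n i j <= 1.
Proof.
elim: n i => [|n IH] i /=; first by case: eqP; rewrite ?lexx ler01.
have /andP[? ?] := IH (down i); have /andP[? ?] := IH (up i); have /andP[? ?] := IH i.
apply/andP; split; first by apply: addr_ge0; [apply: addr_ge0|]; exact: mulr_ge0.
apply: (@le_trans _ _ (pd * 1 + pu i * 1 + ps i * 1)); last by rewrite /ps; lra.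
by apply: lerD; [apply: lerD|]; apply: ler_wpM2l.
Qed.

Let jump_ge0 n i j : 0 <= jump n i j. Proof. by case/andP: (jump_itv n i j). Qed.

Let jump_esumS n i (w : state -> R) : (forall k, S k -> 0 <= w k) ->
  (\esum_(k in S) (jump n.+1 i k * w k)%:E =
   pd%:E * (\esum_(k in S) (jump n (down i) k * w k)%:E) +
   (pu i)%:E * (\esum_(k in S) (jump n (up i) k * w k)%:E) +
   (ps i)%:E * (\esum_(k in S) (jump n i k * w k)%:E))%E.
Proof.
move=> w0; have h (c' : R) m s k : 0 <= c' -> S k -> (0 <= c'%:E * (jump m s k * w k)%:E)%E.
  by move=> c0 Sk; rewrite lee_fin !mulr_ge0// w0.
have h' m s k : S k -> (0 <= (jump m s k * w k)%:E)%E.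
  by move=> Sk; rewrite lee_fin mulr_ge0// w0.
have E (c' : R) s : 0 <= c' -> (c'%:E * (\esum_(k in S) (jump n s k * w k)%:E) =
    \esum_(k in S) (c'%:E * (jump n s k * w k)%:E))%E.
  by move=> c0; rewrite esumZl// => k; exact: h'.
rewrite !E// -esumD; first rewrite -esumD.
- by apply: eq_esum => k Sk /=; rewrite -!EFinM -!EFinD; congr EFin; ring.
- by move=> k Sk; rewrite adde_ge0//; exact: h.
- by move=> k Sk; exact: h.
- by move=> k Sk; exact: h.
- by move=> k Sk; exact: h.
Qed.

Lemma jump_mass n i : S i -> (\esum_(k in S) (jump n i k)%:E = 1)%E.
Proof.
move=> Si; transitivity (\esum_(k in S) (jump n i k * 1)%:E)%E.
  by under [RHS]eq_esum do rewrite mulr1.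
elim: n i Si => [|n IH] i Si.
  rewrite (@esum_only _ _ _ _ i)//= ?eqxx ?mulr1//.
  - by move=> k _ /negbTE ->; rewrite mul0r.
rewrite jump_esumS// (IH _ (state_space_down Si)) (IH _ Si); have [i0|i0] := posnP i.2.
  by rewrite pu0// mul0e adde0 !mule1 -EFinD /ps pu0//; congr EFin; ring.
rewrite IH; last exact: state_space_up.
by rewrite !mule1 -!EFinD /ps; congr EFin; ring.
Qed.

Lemma jump_chapman n m i j : S i -> S j ->
  (\esum_(k in S) (jump n i k * jump m k j)%:E = (jump (n + m) i j)%:E)%E.
Proof.
move=> + Sj; elim: n i => [|n IH] i Si.
  rewrite (@esum_only _ _ _ _ i)//= ?eqxx ?mul1r//.
  - by move=> k _; rewrite lee_fin mulr_ge0.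
  - by move=> k _ /negbTE ->; rewrite mul0r.
rewrite jump_esumS// (IH _ (state_space_down Si)) (IH _ Si); have [i0|i0] := posnP i.2.
  by rewrite pu0// mul0e adde0 -!EFinM -EFinD addSn /= pu0// mul0r addr0.
rewrite IH; last exact: state_space_up.
by rewrite -!EFinM -!EFinD.
Qed.

Let pois (n : nat) (t : R) : R := expR (- (Lam * t)) * ((Lam * t) ^+ n / n`!%:R).

Let pois_ge0 n t : 0 <= t -> 0 <= pois n t.
Proof.
by move=> t0; rewrite mulr_ge0 ?expR_ge0// divr_ge0// exprn_ge0// mulr_ge0// ltW.
Qed.

Let pp_ge0 n m s t : 0 <= s -> 0 <= t -> 0 <= pois n s * pois m t.
Proof. by move=> s0 t0; apply: mulr_ge0; exact: pois_ge0. Qed.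

Let pj_ge0 n m s t a i j b k l : 0 <= s -> 0 <= t ->
  0 <= pois n s * pois m t * (jump a i j * jump b k l).
Proof. by move=> s0 t0; apply: mulr_ge0; [exact: pp_ge0|exact: mulr_ge0]. Qed.

Let pois_mass t : 0 <= t -> (\esum_(n in [set: nat]) (pois n t)%:E = 1)%E.
Proof. by move=> t0; apply: esum_poisson; rewrite mulr_ge0// ltW. Qed.

Let poisD n s t : pois n (s + t) = \sum_(k < n.+1) pois k s * pois (n - k) t.
Proof.
rewrite /pois mulrDr opprD expRD; move: (Lam * s) (Lam * t) => x y.
rewrite [x + y]addrC exprDn mulr_suml mulr_sumr.
apply: eq_bigr => k _; have kn : (k <= n)%N by rewrite -ltnS.
have bf := bin_fact kn.
have nf : (n`!%:R : R) = 'C(n, k)%:R * (k`!%:R * (n - k)`!%:R) by rewrite -!natrM bf.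
have f0 m : (m`!%:R : R) != 0 by rewrite pnatr_eq0 -lt0n fact_gt0.
have c0 : ('C(n, k)%:R : R) != 0 by rewrite pnatr_eq0 -lt0n bin_gt0.
rewrite -mulr_natr nf invfM invfM.
move: (expR _) (expR _) => a b.
move: (k`!%:R^-1) ((n - k)`!%:R^-1) => d e.
transitivity (a * b * (x ^+ k * y ^+ (n - k)) * (d * e) * ('C(n, k)%:R * 'C(n, k)%:R^-1)).
  by ring.
by rewrite mulfV// mulr1; ring.
Qed.

Definition uniform_semigroup (t : R) (i j : state) : R :=
  fine (\esum_(n in [set: nat]) (pois n t * jump n i j)%:E)%E.

Let usE t i j : 0 <= t ->
  ((uniform_semigroup t i j)%:E = \esum_(n in [set: nat]) (pois n t * jump n i j)%:E)%E.
Proof.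
move=> t0; rewrite fineK// ge0_fin_numE; last first.
  by apply: esum_ge0 => n _; rewrite lee_fin mulr_ge0// pois_ge0.
apply: (@le_lt_trans _ _ 1%E); last exact: ltry.
rewrite -(pois_mass t0); apply: le_esum => n _; rewrite lee_fin.
by rewrite ler_piMr ?pois_ge0//; case/andP: (jump_itv n i j).
Qed.

Let us_ge0 t i j : 0 <= t -> 0 <= uniform_semigroup t i j.
Proof.
move=> t0; rewrite -lee_fin usE//.
by apply: esum_ge0 => n _; rewrite lee_fin mulr_ge0// pois_ge0.
Qed.

(** The terms n = 0, 1 of the Poisson series give the lower bound; the same terms for 1 - [jump]
    give the upper one, because the Poisson weights sum to 1. *)
Let us_expansion (t : R) (i j : state) : 0 <= t ->
  `|uniform_semigroup t i j - (j == i)%:R - Lam * t * (jump 1 i j - (j == i)%:R)|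
    <= 2 * (Lam * t) ^+ 2.
Proof.
move=> t0; set d : R := (j == i)%:R; set x := Lam * t.
have x0 : 0 <= x by apply: mulr_ge0 => //; exact: (ltW Lam_gt0).
pose e := expR (- x).
have p0E : pois 0 t = e by rewrite /pois expr0 divr1 mulr1.
have p1E : pois 1 t = e * x by rewrite /pois expr1 divr1.
have lo : e * d + e * x * jump 1 i j <= uniform_semigroup t i j.
  rewrite -lee_fin usE//.
  have := @esum_ge_seq _ _ setT (fun n => (pois n t * jump n i j)%:E) [:: 0; 1]%N.
  rewrite big_cons big_seq1 -EFinD p0E p1E; apply => // n _.
  by rewrite lee_fin mulr_ge0// pois_ge0.
have hi : uniform_semigroup t i j <= 1 - e * (1 - d) - e * x * (1 - jump 1 i j).
  have b0 n : 0 <= 1 - jump n i j by rewrite subr_ge0; case/andP: (jump_itv n i j).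
  have e1 : (\esum_(n in [set: nat]) (pois n t * (1 - jump n i j))%:E +
      (uniform_semigroup t i j)%:E = 1)%E.
    rewrite usE// -(pois_mass t0) -esumD.
    - by apply: eq_esum => n _; rewrite -EFinD -mulrDr subrK mulr1.
    - by move=> n _; rewrite lee_fin mulr_ge0// pois_ge0.
    - by move=> n _; rewrite lee_fin mulr_ge0// pois_ge0.
  have := @esum_ge_seq _ _ setT (fun n => (pois n t * (1 - jump n i j))%:E) [:: 0; 1]%N.
  rewrite big_cons big_seq1 -EFinD p0E p1E.
  have p0' n : [set: nat] n -> (0 <= (pois n t * (1 - jump n i j))%:E)%E.
    by move=> _; rewrite lee_fin mulr_ge0// pois_ge0.
  move=> /(_ p0' isT (fun _ _ => I)) h.
  have : ((e * (1 - d) + e * x * (1 - jump 1 i j))%:E + (uniform_semigroup t i j)%:E <= 1)%E.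
    by rewrite -e1; exact: leeD.
  by rewrite -EFinD lee_fin; lra.
have e_ge : 1 - x <= e by exact: expR_ge1Dx.
have e_le : e * (1 + x) <= 1.
  by rewrite /e expRN mulrC ler_pdivrMr ?expR_gt0// mul1r expR_ge1Dx.
have e0 : 0 <= e by exact: expR_ge0.
have d01 : 0 <= d <= 1 by rewrite /d; case: eqP; rewrite ?lexx ?ler01.
have := jump_itv 1 i j; move: lo hi; set U := uniform_semigroup _ _ _; set J := jump 1 i j.
move=> lo hi /andP[J0 J1]; case/andP: d01 => d0 d1.
have A1 : e - 1 + x <= x ^+ 2 by nra.
have A2 : 0 <= e - 1 + x by lra.
have A3 : 1 - e * (1 + x) <= x ^+ 2 by nra.
have A4 : (e - 1 + x) * d <= x ^+ 2 by nra.
have A5 : 0 <= (e - 1 + x) * d by exact: mulr_ge0.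
have e_le1 : e <= 1 by nra.
have A6 : 0 <= x * J * (1 - e).
  by apply: mulr_ge0; [exact: mulr_ge0|rewrite subr_ge0].
have A7 : x * J * (1 - e) <= x ^+ 2.
  rewrite expr2; apply: ler_pM; [exact: mulr_ge0|by rewrite subr_ge0|exact: ler_piMr|lra].
rewrite ler_norml; apply/andP; split; nra.
Qed.

Lemma uniform_semigroup_ctmc : is_ctmc S (generator g) uniform_semigroup.
Proof.
split.
- move=> t i j t0 _ _; rewrite -lee_fin usE//.
  by apply: esum_ge0 => n _; rewrite lee_fin mulr_ge0// pois_ge0.
- move=> t i t0 Si; under eq_esum do rewrite usE//.
  rewrite esum_exchange; last by move=> k n _ _; rewrite lee_fin mulr_ge0// pois_ge0.
  rewrite -(pois_mass t0); apply: eq_esum => n _; under eq_esum do rewrite EFinM.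
  rewrite esumZl ?pois_ge0//; last by move=> k _; rewrite lee_fin.
  by rewrite jump_mass// mule1.
- move=> i j Si Sj; apply: EFin_inj; rewrite usE//.
  rewrite (@esum_only _ _ _ _ 0%N)//.
  + by rewrite /pois mulr0 oppr0 expR0 expr0 divr1 !mul1r.
  + by move=> n _; rewrite lee_fin mulr_ge0// pois_ge0.
  + by move=> n _ n0; rewrite /pois mulr0 expr0n (negbTE n0) mul0r mulr0 mul0r.
- move=> s t i j s0 t0 Si Sj; rewrite usE ?addr_ge0//.
  transitivity (\esum_(k in S) \esum_(n in [set: nat]) \esum_(m in [set: nat])
      ((pois n s * pois m t) * (jump n i k * jump m k j))%:E)%E.
    apply: eq_esum => k Sk; rewrite EFinM (usE i k s0) muleC -esumZl; last 2 first.
    - by move=> n _; rewrite lee_fin mulr_ge0// pois_ge0.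
    - exact: us_ge0.
    apply: eq_esum => n _; rewrite muleC (usE k j t0) -esumZl; last 2 first.
    - by move=> m _; rewrite lee_fin mulr_ge0// pois_ge0.
    - by apply: mulr_ge0 => //; exact: pois_ge0.
    by apply: eq_esum => m _; rewrite -EFinM; congr EFin; ring.
  rewrite esum_exchange; last first.
    move=> k n _ _; apply: esum_ge0 => m _.
    by rewrite lee_fin pj_ge0.
  transitivity (\esum_(n in [set: nat]) \esum_(m in [set: nat])
      ((pois n s * pois m t) * jump (n + m) i j)%:E)%E.
    apply: eq_esum => n _; rewrite esum_exchange; last first.
      by move=> k m _ _; rewrite lee_fin pj_ge0.
    apply: eq_esum => m _; under eq_esum do rewrite EFinM.
    rewrite esumZl ?pp_ge0//; last by move=> k _; rewrite lee_fin mulr_ge0.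
    by rewrite jump_chapman// -EFinM.
  (* Grouping by the total number of epochs n + m, Poisson laws convolve. *)
  rewrite esum_antidiagonal; last first.
    by move=> n m; rewrite lee_fin; apply: mulr_ge0 => //; exact: pp_ge0.
  apply: eq_esum => n _; rewrite sumEFin poisD mulr_suml; congr EFin.
  by apply: eq_bigr => k _; rewrite subnKC// -ltnS.
- move=> i j Si Sj.
  have QE : generator g i j = Lam * (jump 1 i j - (j == i)%:R).
    have pdE : Lam * pd = r by rewrite mulrC mulfVK// gt_eqF.
    have puE : Lam * pu i = beta * i.2%:R.
      rewrite mulrC mulfVK ?gt_eqF//; case: (state_space_inv Si) => _ iZ _.
      by rewrite (minn_idPl iZ).
    rewrite mulrBr /= !mulrDr [Lam * (pd * _)]mulrA pdE [Lam * (pu i * _)]mulrA puE.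
    rewrite /generator /rate /ps; case: eqVneq => [->|ji].
      rewrite eq_sym (negbTE (down_neq i)) eq_sym (negbTE (up_neq i)) /=.
      by move: pdE puE; lra.
    by rewrite !mulr0 addr0 subr0 [r * _]mulrC [_ * i.2%:R * _]mulrC.
  apply/cvgrPdist_le => e e0; near=> h.
  have h0 : 0 < h by near: h; exact: nbhs_right_gt.
  have := us_expansion i j (ltW h0); rewrite /= => H.
  have -> : generator g i j - (uniform_semigroup h i j - (j == i)%:R) / h =
      - ((uniform_semigroup h i j - (j == i)%:R - Lam * h * (jump 1 i j - (j == i)%:R)) / h).
    by rewrite QE; field; rewrite gt_eqF.
  rewrite normrN normrM [`|h^-1|]gtr0_norm ?invr_gt0// ler_pdivrMr//.
  apply: (le_trans H).
  have he : h <= e / (2 * Lam ^+ 2).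
    by near: h; apply: nbhs_right_le; rewrite divr_gt0// mulr_gt0// exprn_gt0.
  rewrite exprMn mulrA expr2 mulrA ler_pM2r// mulrC -ler_pdivlMr//.
  by rewrite !mulr_gt0.
Unshelve. all: by end_near.
Qed.

End uniformization.

(** * Existence of a stationary distribution *)

Lemma weight_balanced (w : state -> R) : (forall i, 0 <= w i) -> (forall i, ~ S i -> w i = 0) ->
  (exists2 i, S i & 0 < w i) -> (\esum_(i in S) (w i)%:E < +oo)%E ->
  (forall j, S j -> (\esum_(i in S) (w i * rate g i j)%:E = (q j * w j)%:E)%E) ->
  exists mu, balanced mu.
Proof.
move=> w0 wS [i0 Si0 wi0] wfin bal.
pose nu : {measure set state -> \bar R} := weight_measure w.
have nuE A : nu A = (\esum_(i in A) (w i)%:E)%E.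
  by apply: eq_esum => i _; rewrite ger0_norm.
have nuS : nu setT = nu S.
  rewrite !nuE (esumID S); last by move=> i _; rewrite lee_fin.
  rewrite setTI [X in (_ + X)%E]esum1 ?adde0// => i [_ nSi].
  by rewrite wS.
have nupos : (0 < nu S)%E.
  rewrite nuE; apply: (@lt_le_trans _ _ (w i0)%:E); first by rewrite lte_fin.
  by apply: (esum_ge1 (a := fun i => (w i)%:E)) => // i _; rewrite lee_fin.
have nufin : nu S \is a fin_num by rewrite ge0_fin_numE nuE ?esum_ge0// => i _; rewrite lee_fin.
pose W := fine (nu S).
have W0 : 0 < W by rewrite fine_gt0// nupos -ge0_fin_numE// ltW.
(* [dirac i0] is the default value for a measure of zero or infinite mass, both excluded here. *)
pose mu : probability state R := mnormalize nu (dirac i0).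
have muE A : mu A = (nu A * W^-1%:E)%E.
  have -> : mu A = mnormalize nu (dirac i0) A by [].
  rewrite /mnormalize /= nuS ifF//; apply/negbTE; rewrite negb_or gt_eqF//=.
  by apply/negbT/lt_eqF; rewrite -ge0_fin_numE// ltW.
have mu1 j : mu [set j] = (w j / W)%:E.
  by rewrite muE nuE esum_set1 ?lee_fin// EFinM.
exists mu; split.
  by rewrite muE -[nu S]fineK// -EFinM mulfV// gt_eqF.
move=> j Sj; rewrite mu1 /= /Rintegral integral_esum; last first.
  by move=> i _; rewrite lee_fin rate_ge0.
under eq_esum => i _ do rewrite [X in (_ * X)%E]mu1 -EFinM mulrA [_ * w i]mulrC [_ / W]mulrC EFinM.
rewrite esumZl ?invr_ge0 ?(ltW W0)//; last by move=> i _; rewrite lee_fin mulr_ge0// rate_ge0.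
by rewrite bal// -EFinM /=; ring.
Qed.

Lemma geometric_sum_le (x : R) n : 0 <= x < 1 -> \sum_(k < n) x ^+ k <= (1 - x)^-1.
Proof.
move=> /andP[x0 x1]; rewrite -[leRHS]mul1r ler_pdivlMr ?subr_gt0//.
have := subrX1 x n; have : 0 <= x ^+ n by exact: exprn_ge0.
lra.
Qed.

Let rho := r / (beta * Zm%:R).

(** The upward drift at the cap: arrivals have rate beta * [max_transit] >= r + beta f > r. The
    ratio itself is forced by detailed balance between (y - 1, [max_transit]) and (y,
    [max_transit]). *)
Lemma flat_ratio : 0 < rho < 1.
Proof.
have Z0 : 0 < beta * Zm%:R by rewrite mulr_gt0// ltr0n max_transit_gt0.
rewrite divr_gt0//= ltr_pdivrMr// mul1r.
have /andP[h _] := max_transit_itv.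
rewrite -ltr_pdivrMl// mulrC (lt_le_trans _ h)// ltrDl//.
Qed.

Lemma up_flat y : Zm%:Z <= D (y + 1) -> up (y, Zm) = (y + 1, Zm).
Proof.
move=> Dy; have h : c (y + 1) = Zm by have := target_ceilP (y + 1); lia.
by rewrite /after_arrival /= h; congr pair; lia.
Qed.

Lemma down_flat y : down (y, Zm) = (y - 1, Zm).
Proof.
have h : (c (y - 1) <= Zm)%N by have := target_ceilP (y - 1); lia.
by rewrite /after_demand /=; congr pair; lia.
Qed.

Lemma rate_eq0 s s' : s' != down s -> s' != up s -> rate g s s' = 0.
Proof. by rewrite /rate => /negbTE -> /negbTE ->; rewrite !mul0r addr0. Qed.

(* Below y0 only the states (y, Zm) exist and the chain is a birth and death
   chain with geometric invariant weights; these are glued at y0 to the invariant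
   law of the finite chain on y >= y0 whose jumps below y0 are suppressed. *)
Lemma balanced_exists : exists mu, balanced mu.
Proof.
have [y0 flat] := flat_exists.
have flatS y : y <= y0 -> S (y, Zm) by move=> /flat; exact: state_space_flat.
have flatE s : S s -> s.1 <= y0 -> s = (s.1, Zm).
  case: s => y z Ss /= /flat Dy; congr pair.
  exact: flat_inv Dy (state_space_inv Ss).
pose n := `|position_bound - y0|%N.+1.
pose box := ('I_n * 'I_Zm.+1)%type.
pose stb (b : box) : state := (y0 + (b.1 : nat)%:Z, b.2 : nat).
pose V : finType := {b : box | `[< S (stb b) >]}.
pose sv (v : V) := stb (val v).
have svS v : S (sv v) by apply/asboolP; exact: (valP v).
have sv_ge v : y0 <= (sv v).1 by rewrite /sv /stb /=; lia.
have sv_inj : injective sv.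
  move=> [[a b] ab] [[a' b'] ab'] [] /= e1 e2; apply/val_inj => /=.
  by congr pair; apply: ord_inj; lia.
have sv_surj s : S s -> y0 <= s.1 -> exists v, sv v = s.
  move=> Ss ys; have [_ sZ sB] := state_space_inv Ss.
  have h1 : (`|s.1 - y0| < n)%N by rewrite /n; lia.
  have h2 : (s.2 < Zm.+1)%N by [].
  have e : stb (Ordinal h1, Ordinal h2) = s.
    by rewrite /stb /= [RHS]surjective_pairing; congr pair; lia.
  have h : `[< S (stb (Ordinal h1, Ordinal h2)) >] by apply/asboolP; rewrite e.
  by exists (exist _ (Ordinal h1, Ordinal h2) h).
have sum_at s (F : V -> R) v : sv v = s -> \sum_v' (sv v' == s)%:R * F v' = F v.
  move=> e; rewrite (bigD1 v)//= e eqxx mul1r big1 ?addr0// => v' v'v.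
  by rewrite -e (inj_eq sv_inj) (negbTE v'v) mul0r.
clearbody sv.
have [v0 v0E] : exists v, sv v = (y0, Zm) by apply: sv_surj; [exact: flatS|].
pose dn (s : state) : state := if s.1 == y0 :> int then s else down s.
have dn_ex v : exists v', sv v' = dn (sv v).
  apply: sv_surj; rewrite /dn; case: eqVneq => e; rewrite ?e//.
    exact: state_space_down.
  by have := sv_ge v; rewrite /=; move/eqP: e; lia.
have up_ex v : (0 < (sv v).2)%N -> exists v', sv v' = up (sv v).
  move=> v2; apply: sv_surj; first exact: state_space_up.
  by have := sv_ge v; rewrite /=; lia.
have Lam0 : 0 < Lam by have /andP[h1 h2] := exit_rate_itv (svS v0); exact: lt_le_trans h2.
pose u v := beta * (sv v).2%:R.
have u0 v : 0 <= u v by case/andP: (up_rate_itv (svS v)).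
have uL v : r + u v <= Lam by case/andP: (exit_rate_itv (svS v)).
(* Uniformization at rate Lam turns the rates of the finite chain into a stochastic kernel;
   multiplying its invariance by Lam gives back the balance equations. *)
pose p v v' := (r * (sv v' == dn (sv v))%:R + u v * (sv v' == up (sv v))%:R +
  (Lam - r - u v) * (v' == v)%:R) / Lam.
have p0 v v' : 0 <= p v v'.
  apply: divr_ge0; last exact: ltW.
  apply: addr_ge0; first by apply: addr_ge0; apply: mulr_ge0 => //; exact: ltW.
  by apply: mulr_ge0 => //; have := uL v; lra.
have sum_eq s v : sv v = s -> \sum_v' (sv v' == s)%:R = 1 :> R.
  by move=> e; rewrite -[RHS](sum_at s (fun=> 1) v e); apply: eq_bigr => v' _; rewrite mulr1.
have p1 v : \sum_v' p v v' = 1.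
  rewrite /p -mulr_suml !big_split /= -!mulr_sumr.
  have [vd /sum_eq ->] := dn_ex v.
  have -> : \sum_v' (v' == v)%:R = 1 :> R.
    by rewrite (bigD1 v)//= eqxx big1 ?addr0// => v' /negbTE ->.
  have -> : u v * \sum_v' (sv v' == up (sv v))%:R = u v.
    have [v2|v2] := posnP (sv v).2; first by rewrite /u v2 mulr0 mul0r.
    by have [vu /sum_eq ->] := up_ex v v2; rewrite mulr1.
  by rewrite !mulr1 (_ : r + u v + (Lam - r - u v) = Lam) ?mulfV ?gt_eqF//; ring.
have [m [m0 m1 minv]] := finite_stationary v0 p0 p1.
have mbal v' : \sum_v m v * (r * (sv v' == dn (sv v))%:R + u v * (sv v' == up (sv v))%:R) =
    (r + u v') * m v'.
  have : Lam * m v' = \sum_v m v * (r * (sv v' == dn (sv v))%:R + u v * (sv v' == up (sv v))%:R) +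
      (Lam - r - u v') * m v'.
    have e1 := sum_at _ (fun v => (Lam - r - u v) * m v) _ (erefl (sv v')).
    rewrite -{}e1 -{1}minv mulr_sumr -big_split /=; apply: eq_bigr => v _.
    rewrite (inj_eq sv_inj) [v == v']eq_sym /p; field.
    by rewrite gt_eqF.
  lra.
pose M s := \sum_v (sv v == s)%:R * m v.
have ME v : M (sv v) = m v by exact: sum_at.
pose w (s : state) : R := if y0 <= s.1 then M s
  else (s.2 == Zm)%:R * (m v0 * rho ^+ `|y0 - s.1|%N).
have rho_gt0 : 0 < rho by case/andP: flat_ratio.
have wsv v : w (sv v) = m v by rewrite /w sv_ge ME.
have wflat y : y <= y0 -> w (y, Zm) = m v0 * rho ^+ `|y0 - y|%N.
  move=> yy0; rewrite /w /=; case: ifP => h; last by rewrite eqxx mul1r.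
  have -> : y = y0 by lia.
  by rewrite -v0E ME subrr expr0 mulr1.
have w0 s : 0 <= w s.
  rewrite /w; case: ifP => _; first by apply: sumr_ge0 => v _; rewrite mulr_ge0.
  by rewrite !mulr_ge0// exprn_ge0// ltW.
have wS s : ~ S s -> w s = 0.
  move=> nS; rewrite /w; case: ifP => h.
    rewrite /M big1// => v _; case: eqVneq => [e|]; last by rewrite mul0r.
    by case: nS; rewrite -e.
  case: s nS h => y z /= nS h; case: eqVneq => [e|]; last by rewrite mul0r.
  by case: nS; rewrite e; apply: flatS; lia.
have box_sum (F : state -> \bar R) : (forall s, S s -> 0 <= F s)%E ->
    (\esum_(s in S `&` [set s : state | (y0 <= s.1)%R]) F s = \sum_v F (sv v))%E.
  move=> F0; rewrite (@esum_seq _ _ _ _ [seq sv v | v <- enum V]).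
  - by rewrite big_map big_enum.
  - by move=> s [Ss _]; exact: F0.
  - by rewrite map_inj_uniq ?enum_uniq.
  - by move=> s /mapP[v _ ->]; split; [exact: svS|exact: sv_ge].
  - move=> s [Ss /= ys] /negP; case; have [v <-] := sv_surj s Ss ys.
    by rewrite map_f// mem_enum.
have split_sum (F : state -> \bar R) : (forall s, S s -> 0 <= F s)%E ->
    (\esum_(s in S) F s = \sum_v F (sv v) + \esum_(s in S `&` ~` [set s : state | (y0 <= s.1)%R]) F s)%E.
  by move=> F0; rewrite (esumID [set s : state | (y0 <= s.1)%R])// box_sum.
have wE0 s : (0 <= (w s)%:E)%E by rewrite lee_fin.
apply: (weight_balanced w0 wS).
- have [v mv] : exists v, 0 < m v.
    apply: contrapT => h; move: m1; rewrite big1 => [/esym/eqP|v _]; first by rewrite oner_eq0.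
    apply/eqP; rewrite eq_le m0 andbT leNgt; apply/negP => mv; apply: h; by exists v.
  by exists (sv v); rewrite ?wsv.
- rewrite split_sum//; apply: lte_add_pinfty; first by rewrite sumEFin ltry.
  rewrite (@reindex_esum _ _ _ [set: nat] _ (fun k => (y0 - k.+1%:Z, Zm))); last first.
    split.
    - move=> k _; split; first by apply: flatS; lia.
      by rewrite /=; lia.
    - by move=> k k' _ _ []; lia.
    - move=> [y z] [Ss /= /negP]; rewrite -ltNge => yy0.
      exists `|(y0 - y - 1)%R|%N => //; rewrite (flatE _ Ss (ltW yy0)) /=.
      by congr pair; lia.
  apply: (@le_lt_trans _ _ (m v0 * (1 - rho)^-1)%:E); last exact: ltry.
  rewrite -nneseries_esumT//; apply: lime_le; first exact: is_cvg_nneseries.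
  apply: nearW => N; rewrite big_mkord sumEFin lee_fin.
  apply: (@le_trans _ _ (\sum_(k < N) m v0 * rho ^+ k)); last first.
    rewrite -mulr_sumr ler_wpM2l// geometric_sum_le//.
    by case/andP: flat_ratio => /ltW -> ->.
  apply: ler_sum => k _; rewrite wflat; last by lia.
  have -> : `|(y0 - (y0 - k.+1%:Z))%R|%N = k.+1 by lia.
  rewrite ler_wpM2l// exprS ler_piMl ?exprn_ge0 ?(ltW rho_gt0)//.
  by case/andP: flat_ratio => _ /ltW.
move=> j Sj.
have rhoE : rho * (beta * Zm%:R) = r.
  by rewrite /rho mulfVK// mulf_neq0 ?gt_eqF// ltr0n max_transit_gt0.
have F0 s : S s -> (0 <= (w s * rate g s j)%:E)%E.
  by move=> _; rewrite lee_fin mulr_ge0// rate_ge0.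
(* Below y0 only the two neighbours in the flat region lead to j, and the geometric weights
   balance. *)
have [yj|jy] := leP y0 j.1; last first.
  have jE := flatE j Sj (ltW jy); set y := j.1 in jE jy.
  have dE : down (y + 1, Zm) = j by rewrite down_flat jE; congr pair; lia.
  have uE : up (y - 1, Zm) = j.
    by rewrite up_flat ?subrK -?jE//; apply: flat; exact: ltW.
  rewrite (@esum_seq _ _ _ _ [:: (y + 1, Zm); (y - 1, Zm)])//.
  - rewrite big_cons big_seq1 -{1}dE rate_down -[in X in (_ + X)%E]uE rate_up /= -EFinD.
    rewrite [in RHS]jE !wflat; try lia.
    have -> : `|(y0 - y)%R|%N = `|(y0 - (y + 1))%R|%N.+1 by lia.
    have -> : `|(y0 - (y - 1))%R|%N = `|(y0 - (y + 1))%R|%N.+2 by lia.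
    by congr EFin; rewrite !exprS -rhoE; ring.
  - by rewrite /= inE andbT; apply/eqP => -[]; lia.
  - by move=> s; rewrite !inE => /orP[] /eqP ->; apply: flatS; lia.
  - move=> s Ss; rewrite !inE negb_or => /andP[s1 s2]; rewrite rate_eq0 ?mulr0//.
      apply: contraNneq s1 => jd; have e : s.1 = y + 1 by rewrite /y jd /=; lia.
      by rewrite (flatE s Ss) e//; lia.
    apply: contraNneq s2 => ju; have e : s.1 = y - 1 by rewrite /y ju /=; lia.
    by rewrite (flatE s Ss) e//; lia.
have [v' v'E] := sv_surj j Sj yj.
have dnE v : r * (sv v' == dn (sv v))%:R = r * (sv v' == down (sv v))%:R +
    r * (j.1 == y0)%:R * (v' == v)%:R.
  rewrite /dn; case: (eqVneq (sv v).1 y0) => [e|ne].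
    have -> : (sv v' == down (sv v)) = false.
      by apply/negbTE/eqP => h; have := sv_ge v'; rewrite h /= e; lia.
    rewrite (inj_eq sv_inj) mulr0 add0r; case: (eqVneq v' v) => [vv|]; last by rewrite !mulr0.
    have -> : j.1 = y0 by rewrite -v'E vv e.
    by rewrite eqxx /= !mulr1.
  case: (eqVneq v' v) => [vv|]; last by rewrite mulr0 addr0.
  by rewrite -v'E vv (negbTE ne) mulr0 mul0r addr0.
rewrite split_sum// sumEFin.
have -> : \sum_v w (sv v) * rate g (sv v) j = q j * w j - r * (j.1 == y0)%:R * m v'.
  have := mbal v'; rewrite -v'E wsv => <-.
  have e2 := sum_at _ m _ (erefl (sv v')).
  rewrite -{}e2 mulr_sumr -sumrB.
  apply: eq_bigr => v _; rewrite wsv dnE (inj_eq sv_inj) v'E /rate [v == v']eq_sym /u /=.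
  by ring.
(* Above y0 nothing enters from below. At y0 the finite chain retains the flow r * m v0 of
   suppressed demands; in the full chain this flow leaves and an equal one enters from (y0 - 1,
   [max_transit]), as rho * beta * [max_transit] = r. *)
case: (eqVneq j.1 y0) => [jy|jy]; last first.
  rewrite mulr0 mul0r subr0 esum1 ?adde0// => s [Ss /= sy]; congr EFin.
  rewrite rate_eq0 ?mulr0//; apply/eqP => jE.
    by move: yj jy; rewrite jE /=; lia.
  by move: yj jy; rewrite jE /=; lia.
have jE := flatE j Sj _; rewrite jy lexx in jE; have {}jE := jE isT.
have v0' : v' = v0 by apply: sv_inj; rewrite v'E v0E.
rewrite (@esum_only _ _ _ _ (y0 - 1, Zm)).
- have uE : up (y0 - 1, Zm) = j.
    by rewrite up_flat ?subrK -?jE//; apply: flat.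
  have -> : rate g (y0 - 1, Zm) j = beta * Zm%:R by rewrite -uE rate_up.
  rewrite wflat; last by lia.
  have -> : `|(y0 - (y0 - 1))%R|%N = 1%N by lia.
  by rewrite -EFinD v0' /= expr1 mulr1 -mulrA rhoE [m v0 * r]mulrC subrK.
- by move=> s [Ss _]; exact: F0.
- by split; [apply: flatS; lia|rewrite /=; lia].
- move=> s [Ss /= sy] sne; rewrite rate_eq0 ?mulr0//; apply/eqP => js.
    by move: jy; rewrite js /=; lia.
  have e : s.1 = y0 - 1 by move: jy; rewrite js /=; lia.
  by move: sne; rewrite (flatE s Ss) e ?eqxx//; lia.
Qed.

(** * Moment bounds and the normal limit *)

Section moment_bounds.
Context (mu : probability state R) (bal : balanced mu).

Let mS : measurable S. Proof. by []. Qed.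
Let muS : mu S = 1%E. Proof. by case: bal. Qed.

Lemma transit_itv s : S s -> 0 <= beta * s.2%:R <= beta * Zm%:R.
Proof.
move=> /state_space_inv[_ sZ _].
by rewrite mulr_ge0 ?(ltW beta_gt0)//= ler_pM2l// ler_nat.
Qed.

(** F itself may be unbounded and not integrable. Clipping it to [-n, n] and adding n yields a
    bounded nonnegative test function; clipping is 1-Lipschitz, so the clipped increments stay
    bounded by L while n tends to infinity. *)
Lemma increments_zero (F : state -> R) (L : R) :
  (forall s, S s -> `|F (down s) - F s| <= L) ->
  (forall s, S s -> (0 < s.2)%N -> `|F (up s) - F s| <= L) ->
  \int[mu]_(s in S) (r * (F (down s) - F s) + beta * s.2%:R * (F (up s) - F s)) = 0.
Proof.
move=> Fd Fu.
pose cl (n : nat) (x : R) := if x <= - n%:R then - n%:R else if n%:R <= x then n%:R else x.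
have cl_itv n x : - n%:R <= cl n x <= n%:R.
  rewrite /cl; have n0 : 0 <= n%:R :> R by [].
  by case: (leP x); [|case: (leP _ x)] => *; apply/andP; split; lra.
have clP n x : (x <= - n%:R /\ cl n x = - n%:R) \/ (n%:R <= x /\ cl n x = n%:R) \/
    (- n%:R <= x <= n%:R /\ cl n x = x).
  rewrite /cl; case: (leP x) => xn; first by left.
  by right; case: (leP _ x) => nx; [left|right; rewrite !ltW].
have cl_lip n x y : `|cl n x - cl n y| <= `|x - y|.
  have n0 : 0 <= n%:R :> R by [].
  have h1 := ler_norm (x - y); have := ler_norm (y - x); rewrite distrC => h2.
  rewrite ler_norml; have [[? ->]|[[? ->]|[? ->]]] := clP n x;
    have [[? ->]|[[? ->]|[? ->]]] := clP n y; apply/andP; split; lra.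
have cl_eq n x : `|x| <= n%:R -> cl n x = x.
  rewrite ler_norml /cl => /andP[x1 x2].
  by case: leP => ?; [lra|case: leP => // ?; lra].
pose G n s := r * (cl n (F (down s)) - cl n (F s)) +
  beta * s.2%:R * (cl n (F (up s)) - cl n (F s)).
have L0 s : S s -> 0 <= L by move=> /Fd; apply: le_trans.
have GL n s : S s -> `|G n s| <= r * L + beta * Zm%:R * L.
  move=> Ss; rewrite (le_trans (ler_normD _ _))// lerD//.
    by rewrite normrM (gtr0_norm r_gt0) ler_pM2l// (le_trans (cl_lip _ _ _)) ?Fd.
  have /andP[z0 zZ] := transit_itv Ss.
  have [s0|s0] := posnP s.2.
    by rewrite s0 mulr0 mul0r normr0 mulr_ge0 ?(L0 s) ?(le_trans z0).
  by rewrite normrM (ger0_norm z0) ler_pM// (le_trans (cl_lip _ _ _)) ?Fu.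
have Gcvg s : S s -> G n s @[n --> \oo] -->
    r * (F (down s) - F s) + beta * s.2%:R * (F (up s) - F s).
  move=> Ss; apply: cvg_near_cst; near=> n.
  have h x : x \in [:: F s; F (down s); F (up s)] -> cl n x = x.
    move=> xs_; apply: cl_eq; rewrite (@le_trans _ _ (`|F s| + `|F (down s)| + `|F (up s)|))//.
      have := normr_ge0 (F s); have := normr_ge0 (F (down s)); have := normr_ge0 (F (up s)).
      by move: xs_; rewrite !inE => /or3P[]/eqP ->; lra.
    by near: n; exact: nbhs_infty_ger.
  by rewrite /G !h// !inE eqxx ?orbT.
have G0 n : \int[mu]_(s in S) G n s = 0.
  pose H s := cl n (F s) + n%:R.
  have Hb s : 0 <= H s <= n%:R + n%:R.
    by have /andP[h1 h2] := cl_itv n (F s); rewrite /H; apply/andP; split; lra.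
  have e : \int[mu]_(s in S) (q s * H s) =
      \int[mu]_(s in S) (r * H (down s) + beta * s.2%:R * H (up s)).
    by congr fine; apply: (balanced_test bal) => s _; case/andP: (Hb s).
  have qb s : S s -> 0 <= q s <= r + beta * Zm%:R.
    by move=> /transit_itv; have := r_gt0; lra.
  have nn0 : 0 <= n%:R + n%:R :> R by rewrite addr_ge0.
  have i1 : mu.-integrable S (EFin \o (fun s => q s * H s)).
    apply: (@bounded_integrable _ mu _ _ ((r + beta * Zm%:R) * (n%:R + n%:R))) => s Ss.
    have /andP[q0 q1] := qb s Ss; have /andP[H0 H1] := Hb s.
    by rewrite normrM !ger0_norm// ler_pM.
  have i2 : mu.-integrable S (EFin \o (fun s => r * H (down s) + beta * s.2%:R * H (up s))).
    apply: (@bounded_integrable _ mu _ _ (r * (n%:R + n%:R) + beta * Zm%:R * (n%:R + n%:R))) => s Ss.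
    have /andP[z0 zZ] := transit_itv Ss.
    have /andP[H0 H1] := Hb (down s); have /andP[K0 K1] := Hb (up s).
    have rH : 0 <= r * H (down s) by rewrite mulr_ge0// ltW.
    have uH : 0 <= beta * s.2%:R * H (up s) by rewrite mulr_ge0.
    rewrite (ger0_norm (addr_ge0 rH uH)) lerD//; first by rewrite ler_pM2l.
    by rewrite ler_pM.
  rewrite -[RHS](subrr (\int[mu]_(s in S) (q s * H s))) {1}e -RintegralB//.
  by apply: eq_Rintegral => s _; rewrite /G /H; ring.
have := Rintegral_dominated (mu := mu) GL Gcvg.
rewrite (_ : (fun n => _) = cst 0); last by apply/funext => n; exact: G0.
by move=> /cvg_lim <-//; rewrite lim_cst.
Unshelve. all: by end_near.
Qed.

Definition antidiff (f : int -> R) (y : int) : R :=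
  match y with
  | Posz n => \sum_(k < n) f k%:Z
  | Negz n => - \sum_(k < n.+1) f (- k.+1%:Z)
  end.

Lemma antidiffD1 f y : antidiff f (y + 1) = antidiff f y + f y.
Proof.
case: y => n; first by rewrite -PoszD addn1 /= big_ord_recr.
case: n => [|n].
  rewrite (_ : Negz 0 + 1 = 0)// /= big_ord0 big_ord1 NegzE addrC subrr //.
rewrite (_ : Negz n.+1 + 1 = Negz n); last by lia.
by rewrite /= [in RHS]big_ord_recr /= NegzE opprD subrK.
Qed.

(** [increments_zero] for a discrete primitive of f, whose increments are the values of f at y and,
    for a demand, at y - 1. *)
Lemma position_test (f : int -> R) (C : R) : (forall y, `|f y| <= C) ->
  \int[mu]_(s in S) (beta * s.2%:R * f s.1 - r * f (s.1 - 1)) = 0.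
Proof.
move=> fC; rewrite -[RHS](@increments_zero (fun s => antidiff f s.1) C) => [|s _|s _ _] /=.
- apply: eq_Rintegral => s _; rewrite /= antidiffD1.
  by have := antidiffD1 f (s.1 - 1); rewrite subrK => ->; ring.
- have := antidiffD1 f (s.1 - 1); rewrite subrK => ->.
  by rewrite opprD addNKr normrN.
- by rewrite antidiffD1 addrC addKr.
Qed.

Lemma transit_integrable : mu.-integrable S (EFin \o (fun s => s.2%:R : R)).
Proof.
apply: (@bounded_integrable _ mu _ _ Zm%:R) => s /state_space_inv[_ sZ _].
by rewrite ger0_norm// ler_nat.
Qed.

Lemma mean_transit : \int[mu]_(s in S) (s.2%:R : R) = r / beta.
Proof.
have := @position_test (cst 1) 1 (fun=> ltac:(by rewrite normr1)).
rewrite (@eq_Rintegral _ _ _ mu S (fun s : state => beta * s.2%:R - r)); last first.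
  by move=> s _; rewrite /= !mulr1.
rewrite RintegralB//; first last.
- by apply: (@bounded_integrable _ mu _ _ `|r|).
- by apply: integrableZ_EFin; exact: transit_integrable.
rewrite (RintegralZl _ mS transit_integrable) (Rintegral_cst1 _ muS) => /eqP.
rewrite subr_eq0 => /eqP e; apply: (mulfI (lt0r_neq0 beta_gt0)).
by rewrite e mulrCA mulfV ?mulr1// gt_eqF.
Qed.

(** Monotone convergence. The drift estimates only reach the bounded functions min (V, n), with a
    bound uniform in n. *)
Lemma truncation_bound (V : state -> R) (B : R) : (forall s, S s -> 0 <= V s) ->
  (forall n : nat, \int[mu]_(s in S) Num.min (V s) n%:R <= B) ->
  mu.-integrable S (EFin \o V) /\ \int[mu]_(s in S) V s <= B.
Proof.
move=> V0 VB.
pose W (n : nat) s := (Num.min (V s) n%:R)%:E.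
have W0 n s : S s -> (0 <= W n s)%E by move=> /V0 h; rewrite lee_fin le_min h /=.
have Wcvg s : W n s @[n --> \oo] --> (V s)%:E.
  apply: cvg_near_cst; near=> n; rewrite /W min_l//.
  by near: n; exact: nbhs_infty_ger.
have Wint n : (\int[mu]_(s in S) W n s)%E = (\int[mu]_(s in S) Num.min (V s) n%:R)%:E.
  rewrite /Rintegral fineK//; apply: integrable_fin_num => //.
  apply: (@bounded_integrable _ mu _ _ n%:R) => s /V0 h.
  by rewrite ger0_norm ?ge_min ?lexx ?orbT// le_min h /=.
have le : (\int[mu]_(s in S) (V s)%:E <= B%:E)%E.
  have -> : (\int[mu]_(s in S) (V s)%:E = \int[mu]_(s in S) limn (W^~ s))%E.
    by apply: eq_integral => s _; apply/esym/cvg_lim => //; exact: Wcvg.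
  have c := @cvg_monotone_convergence _ _ R mu S mS W ltac:(by move=> n; exact: measurable_state) W0.
  have {}c := c ltac:(move=> s _ m n mn; rewrite lee_fin le_min ge_min lexx /= ge_min ler_nat mn orbT; exact: isT).
  rewrite -(cvg_lim _ c)//; apply: lime_le; first by apply/cvg_ex; eexists; exact: c.
  by apply: nearW => n; rewrite Wint lee_fin VB.
have ge : (0 <= \int[mu]_(s in S) (V s)%:E)%E by apply: integral_ge0 => s /V0.
split; last by rewrite -lee_fin /Rintegral fineK// ge0_fin_numE// (le_lt_trans le) ?ltry.
apply/integrableP; split; first exact: measurable_state.
rewrite (eq_integral (fun s => (V s)%:E)); first by rewrite (le_lt_trans le) ?ltry.
by move=> s /set_mem /V0 h; rewrite /= ger0_norm.
Unshelve. all: by end_near.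
Qed.

(** The two ways in which z misses the untruncated target: the target exceeds the cap, so that
    orders cannot follow it, or z exceeds the target, since items in transit cannot be cancelled. *)
Let overshoot (s : state) : R := (Num.max (D s.1 - Zm%:Z) 0)%:~R.
Let excess (s : state) : int := Num.max (s.2%:Z - D s.1) 0.

Let beta_Zm : r + beta * fr <= beta * Zm%:R.
Proof.
have /andP[h _] := max_transit_itv; have := ler_wpM2l (ltW beta_gt0) h.
by rewrite mulrDr mulrCA mulfV ?gt_eqF// mulr1.
Qed.

(** Tested with f = min (overshoot, n). Where f is positive, z is at the cap and beta z >= r + beta
    [fr]; and f (y - 1) <= f y + gamma. Stationarity then gives beta [fr] E f <= r gamma. *)
Lemma overshoot_bound : mu.-integrable S (EFin \o overshoot) /\
  \int[mu]_(s in S) overshoot s <= r * gam%:R / (beta * fr).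
Proof.
apply: truncation_bound => [s _|n]; first by rewrite ler0z; lia.
pose f (y : int) : int := Num.min (Num.max (D y - Zm%:Z) 0) n%:Z.
have f0 y : (0 <= f y) && (f y <= n%:Z) by rewrite /f; lia.
have f0R y : 0 <= (f y)%:~R :> R by rewrite ler0z; case/andP: (f0 y).
have fn y : (f y)%:~R <= n%:R :> R by rewrite -[n%:R]/(n%:Z%:~R) ler_int; case/andP: (f0 y).
have fb y : `|(f y)%:~R| <= n%:R :> R by rewrite ger0_norm.
have -> : \int[mu]_(s in S) Num.min (overshoot s) n%:R = \int[mu]_(s in S) (f s.1)%:~R.
  apply: eq_Rintegral => s _; rewrite /overshoot /f.
  have nE : n%:R = (n%:Z)%:~R :> R by [].
  rewrite nE; case: (leP (Num.max (D s.1 - Zm%:Z) 0) n%:Z) => h.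
    by rewrite min_l ?ler_int.
  by rewrite min_r// ler_int ltW.
have bfr : 0 < beta * fr by rewrite mulr_gt0.
rewrite ler_pdivlMr// mulrC.
have if_ : mu.-integrable S (EFin \o (fun s => (f s.1)%:~R)).
  by apply: (@bounded_integrable _ mu _ _ n%:R) => s _.
rewrite -(RintegralZl _ mS if_) -subr_le0 -[r * gam%:R](Rintegral_cst1 _ muS).
have ic : mu.-integrable S (EFin \o (fun s => r * gam%:R)).
  by apply: (@bounded_integrable _ mu _ _ `|r * gam%:R|).
rewrite -RintegralB//; last exact: integrableZ_EFin.
rewrite -(position_test fb); apply: le_Rintegral => //.
- by apply: integrableB_EFin => //; exact: integrableZ_EFin.
- apply: (@bounded_integrable _ mu _ _ (beta * Zm%:R * n%:R + r * n%:R)) => s Ss.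
  have /andP[z0 zZ] := transit_itv Ss.
  rewrite (le_trans (ler_normB _ _))// lerD// normrM.
    by rewrite ger0_norm// ler_pM.
  by rewrite gtr0_norm// ler_pM2l.
move=> s Ss.
have fd : (f (s.1 - 1))%:~R <= (f s.1)%:~R + gam%:R :> R.
  by rewrite -[gam%:R]/(gam%:Z%:~R) -intrD ler_int /f sloped_targetB1; lia.
have fz : s.2%:R * (f s.1)%:~R = Zm%:R * (f s.1)%:~R :> R.
  have [h|h] := leP Zm%:Z (D s.1).
    by rewrite (flat_inv (y := s.1) (z := s.2) h)//; have := state_space_inv Ss; case: (s).
  have -> : f s.1 = 0 by rewrite /f; lia.
  by rewrite !mulr0.
rewrite -[beta * s.2%:R * _]mulrA fz [beta * (_ * _)]mulrA.
have h1 := ler_wpM2l (ltW r_gt0) fd.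
have h2 := ler_wpM2r (f0R s.1) beta_Zm.
lra.
Qed.

(* v^2 with linear growth beyond n: its expected drift is then bounded below by a
   multiple of min(v, n), and its increments are bounded. *)
Let huber (n v : int) : int := Num.min v n * (2 * v - Num.min v n).

Let huberP (n v : int) : (v <= n /\ Num.min v n = v) \/ (n < v /\ Num.min v n = n).
Proof. lia. Qed.

Let huber_le (n v w : int) : 0 <= n -> 0 <= v -> 0 <= w ->
  huber n w <= huber n v + 2 * Num.min v n * (w - v) + (w - v) ^+ 2.
Proof.
move=> n0 v0 w0; rewrite /huber.
by have [[? ->]|[? ->]] := huberP n v; have [[? ->]|[? ->]] := huberP n w; nia.
Qed.

Let huber_mono (n v w : int) : 0 <= n -> 0 <= v -> v <= w -> huber n v <= huber n w.
Proof.
move=> n0 v0 w0; rewrite /huber.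
by have [[? ->]|[? ->]] := huberP n v; have [[? ->]|[? ->]] := huberP n w; nia.
Qed.

Let huber_down (n v d : int) : 0 <= n -> 0 <= v -> 0 <= d ->
  huber n (Num.max (v - d) 0) <= huber n v - 2 * Num.min v n * d + d ^+ 2.
Proof.
move=> n0 v0 d0; have [dv|vd] := leP d v.
  rewrite max_l ?subr_ge0//; have := @huber_le n v (v - d) n0 v0 _.
  by rewrite subr_ge0 dv => /(_ isT); nia.
rewrite max_r; last by lia.
rewrite /huber (_ : Num.min 0 n = 0); last by lia.
by have [[? ->]|[? ->]] := huberP n v; nia.
Qed.

Let huber_up (n v w d : int) : 0 <= n -> 0 <= v -> 0 <= d -> 0 <= w -> w <= v + d ->
  huber n w <= huber n v + 2 * Num.min v n * d + d ^+ 2.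
Proof.
move=> n0 v0 d0 w0 wv; apply: (le_trans (huber_mono n0 w0 wv)).
have := @huber_le n v (v + d) n0 v0 (addr_ge0 v0 d0); rewrite (_ : v + d - v = d)//; ring.
Qed.

Let huber_lip (n v w d : int) : 0 <= n -> 0 <= v -> 0 <= w -> v - d <= w -> w <= v + d ->
  `|huber n w - huber n v| <= 2 * n * d.
Proof.
move=> n0 v0 w0 wv vw; rewrite /huber.
by have [[? ->]|[? ->]] := huberP n v; have [[? ->]|[? ->]] := huberP n w; nia.
Qed.

Lemma excess_down s : S s -> excess (down s) = Num.max (excess s - gam%:Z) 0.
Proof.
move=> /state_space_inv[cz _ _]; rewrite /excess /= sloped_targetB1.
have := target_ceilP (s.1 - 1); rewrite sloped_targetB1.
by move: (c (s.1 - 1)) (D s.1) Zm max_transit_gt0; lia.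
Qed.

(** An arrival lowers the target by gamma but also z by one, so the excess gains at most gamma - 1,
    strictly less than the gamma that a demand takes off. The lower bound only serves to bound
    increments. *)
Lemma excess_up s : S s -> (0 < s.2)%N ->
  excess s - gam%:Z <= excess (up s) <= excess s + gam%:Z - 1.
Proof.
move=> /state_space_inv[cz _ _] s0; rewrite /excess /= sloped_targetD1.
have := target_ceilP (s.1 + 1); rewrite sloped_targetD1; move: gam_ge1.
by move: (c (s.1 + 1)) (D s.1) Zm max_transit_gt0; lia.
Qed.

(** With d = gamma - 1 and eta = beta [fr] + beta, arrivals have rate at most r + eta. The drift of
    the truncated square is at most - 2 r m + 2 d eta m plus r gamma^2 + (r + eta) d^2. The first
    hypothesis leaves - r m, the second bounds the constants by three times r gamma^2. *)
Lemma excess_bound : (gam%:R - 1) * (beta * fr + beta) <= r / 2 -> beta * fr + beta <= r ->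
  mu.-integrable S (EFin \o (fun s => (excess s)%:~R : R)) /\
  \int[mu]_(s in S) ((excess s)%:~R : R) <= 3 * gam%:R ^+ 2.
Proof.
move=> small1 small2.
have x0 s : 0 <= excess s by rewrite /excess; lia.
apply: truncation_bound => [s _|n]; first by rewrite ler0z.
pose m s : R := (Num.min (excess s) n%:Z)%:~R.
have -> : \int[mu]_(s in S) Num.min (excess s)%:~R n%:R = \int[mu]_(s in S) m s.
  apply: eq_Rintegral => s _; have nE : n%:R = (n%:Z)%:~R :> R by [].
  rewrite nE /m; case: (leP (excess s) n%:Z) => h.
    by rewrite min_l ?ler_int.
  by rewrite min_r// ler_int ltW.
have m0 s : 0 <= m s by rewrite ler0z; have := x0 s; lia.
have mn s : m s <= n%:R by rewrite -[n%:R]/(n%:Z%:~R) ler_int; lia.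
have im : mu.-integrable S (EFin \o m).
  by apply: (@bounded_integrable _ mu _ _ n%:R) => s _; rewrite ger0_norm.
pose F s : R := (huber n (excess s))%:~R.
pose L : R := 2 * n%:R * gam%:R.
have LE : L = (2 * n%:Z * gam%:Z)%:~R by rewrite !intrM.
have Fd s : S s -> `|F (down s) - F s| <= L.
  move=> Ss; rewrite LE /F -intrB -intr_norm ler_int.
  by apply: huber_lip => //; rewrite excess_down//; have := x0 s; lia.
have Fu s : S s -> (0 < s.2)%N -> `|F (up s) - F s| <= L.
  move=> Ss s0; rewrite LE /F -intrB -intr_norm ler_int.
  by apply: huber_lip => //; have := excess_up Ss s0; lia.
have Fd2 s : S s -> F (down s) - F s <= - (2 * m s * gam%:R) + gam%:R ^+ 2.
  move=> Ss; rewrite lerBlDr /F /m excess_down//.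
  have := @huber_down n (excess s) gam isT (x0 s) isT.
  rewrite -(ler_int R) intrD intrB !intrM -[(gam%:Z)%:~R]/(gam%:R : R) => h.
  by apply: (le_trans h); rewrite -[(2%:~R : R)]/(2 : R) expr2; lra.
pose d : R := gam%:R - 1.
have d0 : 0 <= d by rewrite subr_ge0 ler1n.
have Fu2 s : S s -> (0 < s.2)%N -> F (up s) - F s <= 2 * m s * d + d ^+ 2.
  move=> Ss s0; rewrite lerBlDr /F /m.
  have [e [eE e0 ed]] : exists e : int, [/\ e = gam%:Z - 1, 0 <= e & e%:~R = d].
    by exists (gam%:Z - 1); split=> //; [have := gam_ge1; lia|rewrite /d intrB].
  have wv : excess (up s) <= excess s + e by have := excess_up Ss s0; lia.
  have := @huber_up n (excess s) _ _ isT (x0 s) e0 (x0 _) wv.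
  rewrite -(ler_int R) !intrD !intrM ed => h.
  by apply: (le_trans h); rewrite -[(2%:~R : R)]/(2 : R) expr2; lra.
have dG : d ^+ 2 <= gam%:R ^+ 2 by rewrite ler_sqr ?nnegrE// /d; lra.
have Zle : beta * Zm%:R <= r + (beta * fr + beta).
  have /andP[_ h] := max_transit_itv; have := ler_wpM2l (ltW beta_gt0) (ltW h).
  by rewrite !mulrDr mulrCA mulfV ?gt_eqF// !mulr1 addrA.
have Gle s : S s -> r * (F (down s) - F s) + beta * s.2%:R * (F (up s) - F s) <=
    r * (3 * gam%:R ^+ 2) - r * m s.
  move=> Ss; have /andP[z0 zZ] := transit_itv Ss.
  have h1 := ler_wpM2l (ltW r_gt0) (Fd2 s Ss).
  have h2 : beta * s.2%:R * (F (up s) - F s) <= beta * s.2%:R * (2 * m s * d + d ^+ 2).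
    have [s0|s0] := posnP s.2; first by rewrite s0 mulr0 !mul0r.
    by apply: ler_wpM2l => //; exact: Fu2.
  have h3 : beta * s.2%:R * (2 * m s * d + d ^+ 2) <=
      (r + (beta * fr + beta)) * (2 * m s * d + d ^+ 2).
    rewrite ler_wpM2r ?(le_trans zZ)// addr_ge0 ?sqr_ge0//.
    by apply: mulr_ge0 => //; exact: mulr_ge0.
  have h4 := ler_wpM2r (m0 s) small1; rewrite -/d in h4.
  have h5 := ler_wpM2r (sqr_ge0 d) small2.
  have h6 := ler_wpM2l (ltW r_gt0) dG.
  move: h1 h2; set x1 := F (down s) - F s; set x2 := F (up s) - F s; move: x1 x2 => x1 x2.
  have gE : gam%:R = d + 1 by rewrite /d subrK.
  by rewrite gE in h6 *; move: h3 h4 h5 h6; lra.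
rewrite -(ler_pM2l r_gt0) -(RintegralZl _ mS im) -subr_ge0.
rewrite -[r * (3 * _)](Rintegral_cst1 _ muS).
have ic : mu.-integrable S (EFin \o (fun s => r * (3 * gam%:R ^+ 2))).
  by apply: (@bounded_integrable _ mu _ _ `|r * (3 * gam%:R ^+ 2)|).
rewrite -RintegralB//; last exact: integrableZ_EFin.
rewrite -(increments_zero Fd Fu); apply: le_Rintegral => //.
- apply: (@bounded_integrable _ mu _ _ (r * L + beta * Zm%:R * L)) => s Ss.
  have /andP[z0 zZ] := transit_itv Ss.
  rewrite (le_trans (ler_normD _ _))// lerD//.
    by rewrite normrM (gtr0_norm r_gt0) ler_pM2l// Fd.
  have [s0|s0] := posnP s.2.
    by rewrite s0 mulr0 mul0r normr0 mulr_ge0 ?(le_trans _ (Fd s Ss))// (le_trans z0).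
  by rewrite normrM (ger0_norm z0) ler_pM// Fu.
- by apply: integrableB_EFin => //; exact: integrableZ_EFin.
Qed.

(* Vanishes when the number of in-transit items is on the untruncated target. *)
Definition deviation (s : state) : R := s.2%:R - r / beta + gam%:R * (s.1%:~R - xs).

(** The bounds on excess and overshoot, and 1 for the rounding of the target. *)
Definition deviation_bound : R := 3 * gam%:R ^+ 2 + r * gam%:R / (beta * fr) + 1.

Lemma deviation_le s : S s -> `|deviation s| <= (excess s)%:~R + overshoot s + 1.
Proof.
move=> /state_space_inv[cz zZ _]; have /andP[h1 h2] := sloped_target_itv s.1.
have e1 : s.2%:R - (D s.1)%:~R <= (excess s)%:~R :> R.
  by rewrite -[s.2%:R]/(s.2%:Z%:~R) -intrB ler_int /excess; lia.
have e2 : (D s.1)%:~R - s.2%:R <= overshoot s.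
  rewrite -[s.2%:R]/(s.2%:Z%:~R) -intrB ler_int.
  by have := target_ceilP s.1; move: cz zZ; move: (c s.1) (D s.1) Zm => x y z; lia.
have e3 : 0 <= (excess s)%:~R :> R by rewrite ler0z /excess; lia.
have e4 : 0 <= overshoot s by rewrite ler0z; lia.
by rewrite ler_norml /deviation; apply/andP; split; lra.
Qed.

(** * Comparison with the normal law *)

Section light_traffic.
Context (small1 : (gam%:R - 1) * (beta * fr + beta) <= r / 2) (small2 : beta * fr + beta <= r).

Lemma deviation_integrable : mu.-integrable S (EFin \o deviation) /\
  \int[mu]_(s in S) `|deviation s| <= deviation_bound.
Proof.
have [i1 b1] := excess_bound small1 small2; have [i2 b2] := overshoot_bound.
have i3 : mu.-integrable S (EFin \o (fun=> 1 : R)).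
  by apply: (@bounded_integrable _ mu _ _ 1) => s _; rewrite normr1.
have i12 := integrableD_EFin i1 i2; have i123 := integrableD_EFin i12 i3.
have iw : mu.-integrable S (EFin \o deviation).
  apply: le_integrable i123 => //.
  move=> s Ss; rewrite lee_fin (le_trans (deviation_le Ss))//; exact: ler_norm.
split=> //; apply: (@le_trans _ _ (\int[mu]_(s in S) ((excess s)%:~R + overshoot s + 1))).
  apply: le_Rintegral => //; last by move=> s; exact: deviation_le.
  exact: integrable_abse iw.
rewrite (RintegralD mS i12 i3) (RintegralD mS i1 i2) (Rintegral_cst1 _ muS).
by rewrite /deviation_bound !lerD.
Qed.

Local Notation X := (scaled_level g).

Let sr_gt0 : 0 < Num.sqrt r. Proof. by rewrite sqrtr_gt0. Qed.

Let X_deviation s : gam%:R * Num.sqrt r * X s = deviation s - (s.2%:R - r / beta).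
Proof.
rewrite /deviation /scaled_level /= addrAC subrr add0r -mulrA; congr (_ * _).
by rewrite mulrCA mulfV ?mulr1// gt_eqF.
Qed.

Let transit_dev_integrable : mu.-integrable S (EFin \o (fun s => s.2%:R - r / beta : R)).
Proof.
apply: integrableB_EFin transit_integrable _.
by apply: (@bounded_integrable _ mu _ _ `|r / beta|).
Qed.

Let gs_gt0 : 0 < gam%:R * Num.sqrt r. Proof. by rewrite mulr_gt0// ltr0n. Qed.

Lemma scaled_level_integrable : mu.-integrable S (EFin \o X).
Proof.
have [iw _] := deviation_integrable.
have := integrableZ_EFin (gam%:R * Num.sqrt r)^-1 (integrableB_EFin iw transit_dev_integrable).
rewrite (_ : (fun s => _) = X)//; apply/funext => s.
by rewrite -X_deviation mulKf// gt_eqF.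
Qed.

Lemma mean_scaled_level :
  `|\int[mu]_(s in S) X s| <= deviation_bound / (gam%:R * Num.sqrt r).
Proof.
have [iw bw] := deviation_integrable; have iX := scaled_level_integrable.
rewrite ler_pdivlMr// mulrC -{1}(gtr0_norm gs_gt0) -normrM -(RintegralZl _ mS iX).
have -> : \int[mu]_(s in S) (gam%:R * Num.sqrt r * X s) = \int[mu]_(s in S) deviation s.
  rewrite (@eq_Rintegral _ _ _ mu S (fun s => deviation s - (s.2%:R - r / beta))); last first.
    by move=> s _; exact: X_deviation.
  rewrite RintegralB//.
  rewrite RintegralB//; first last.
  - by apply: (@bounded_integrable _ mu _ _ `|r / beta|).
  - exact: transit_integrable.
  by rewrite mean_transit (Rintegral_cst1 _ muS) subrr subr0.
by apply: le_trans bw; exact: le_normr_Rintegral.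
Qed.

Lemma positive_part_integrable a :
  mu.-integrable S (EFin \o (fun s => Num.max (X s - a) 0)).
Proof.
have ia : mu.-integrable S (EFin \o (fun=> a)) by apply: (@bounded_integrable _ mu _ _ `|a|).
apply: le_integrable (integrableB_EFin scaled_level_integrable ia) => //.
move=> s _; rewrite lee_fin ger0_norm ?le_max ?lexx ?orbT//.
by rewrite ge_max ler_norm normr_ge0.
Qed.

(* The drift beta z - r equals beta * deviation - beta gam (y - xs), so the
   generator acts on functions of y as the Stein operator of the normal law up to
   the deviation and a second order remainder. *)
Lemma stein_estimate (phi : R -> R) (C A a : R) : 0 <= C -> (forall x, `|phi x| <= C) ->
  (forall x e, 0 <= e -> `|phi x - phi (x - e) -
     e * (Num.max (x - a) 0 - A + beta * gam%:R * x * phi x)| <= C * e ^+ 2) ->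
  `|\int[mu]_(s in S) Num.max (X s - a) 0 - A| <=
  C * (beta * deviation_bound + 1) / Num.sqrt r.
Proof.
move=> C0 phiC stein; have [iw bw] := deviation_integrable.
pose s_ := Num.sqrt r; have s_r : s_ ^+ 2 = r by rewrite sqr_sqrtr// ltW.
pose x (y : int) := (y%:~R - xs) / s_.
have xB y : x (y - 1) = x y - s_^-1 by rewrite /x intrB; ring.
pose I (s : state) := beta * s.2%:R * phi (x s.1) - r * phi (x (s.1 - 1)).
have I0 : \int[mu]_(s in S) I s = 0 
  by apply: (@position_test (fun y => phi (x y)) C) => y; exact: phiC.
have iI : mu.-integrable S (EFin \o I).
  apply: (@bounded_integrable _ mu _ _ (beta * Zm%:R * C + r * C)) => s Ss.
  have /andP[z0 zZ] := transit_itv Ss.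
  rewrite (le_trans (ler_normB _ _))// lerD// normrM.
    by rewrite ger0_norm// ler_pM.
  by rewrite gtr0_norm// ler_pM2l.
pose U s := Num.max (X s - a) 0 - A.
have iA : mu.-integrable S (EFin \o (fun=> A)) by apply: (@bounded_integrable _ mu _ _ `|A|).
have iU : mu.-integrable S (EFin \o U) by exact: integrableB_EFin (positive_part_integrable a) iA.
(* With step e = 1 / sqrt r one has r e = sqrt r and r e^2 = 1: multiplied by r, the Stein term is
   of order sqrt r and the Taylor remainder at most C. *)
have UI s : `|s_ * U s - I s| <= C * (beta * `|deviation s| + 1).
  have e0 : 0 <= s_^-1 by rewrite invr_ge0 ltW.
  have := stein (x s.1) _ e0; rewrite -xB; set err := (X in `|X|) => herr.
  have re : r * s_^-1 = s_ by rewrite -s_r expr2 mulfK ?gt_eqF.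
  have re2 : r * s_^-1 ^+ 2 = 1 by rewrite expr2 mulrA re mulfV ?gt_eqF.
  have -> : s_ * U s - I s = - (beta * deviation s * phi (x s.1) + r * err).
    rewrite /err !mulrBr mulrA re /U /I /deviation -/(x s.1) -[X s]/(x s.1).
    have -> : s.1%:~R - xs = s_ * x s.1 by rewrite /x mulrCA mulfV ?mulr1// gt_eqF.
    have -> : beta * (s.2%:R - r / beta + gam%:R * (s_ * x s.1)) * phi (x s.1) =
      (beta * s.2%:R - r + beta * (gam%:R * (s_ * x s.1))) * phi (x s.1).
      by congr (_ * _); field; rewrite gt_eqF.
    by ring.
  rewrite normrN (le_trans (ler_normD _ _))// [C * (_ + _)]mulrDr mulr1 lerD//.
    rewrite !normrM (gtr0_norm beta_gt0) mulrC ler_wpM2r//.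
    by rewrite mulr_ge0// ltW.
  rewrite normrM (gtr0_norm r_gt0) (le_trans (ler_wpM2l (ltW r_gt0) herr))//.
  by rewrite mulrCA re2 mulr1.
have -> : \int[mu]_(s in S) Num.max (X s - a) 0 - A = \int[mu]_(s in S) U s.
  by rewrite /U RintegralB// ?(Rintegral_cst1 _ muS)//; exact: positive_part_integrable.
have i1 := integrableB_EFin (integrableZ_EFin s_ iU) iI.
rewrite ler_pdivlMr// mulrC -{1}(gtr0_norm sr_gt0) -normrM -(RintegralZl _ mS iU).
rewrite -[X in `|X|]subr0 -I0 -RintegralB//; last exact: integrableZ_EFin.
apply: (le_trans (le_normr_Rintegral mS i1)).
have iw' : mu.-integrable S (EFin \o (fun s => beta * `|deviation s|)).
  by apply: integrableZ_EFin; exact: integrable_abse iw.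
have i3 : mu.-integrable S (EFin \o (fun=> 1 : R)).
  by apply: (@bounded_integrable _ mu _ _ 1) => s _; rewrite normr1.
have iB := integrableD_EFin iw' i3.
apply: (@le_trans _ _ (\int[mu]_(s in S) (C * (beta * `|deviation s| + 1)))).
  apply: le_Rintegral => //; last exact: integrableZ_EFin.
  exact: integrable_abse i1.
rewrite (RintegralZl _ mS iB) ler_wpM2l// (RintegralD mS iw' i3) (Rintegral_cst1 _ muS) lerD2r.
by rewrite (RintegralZl _ mS (integrable_abse iw)) ler_pM2l.
Qed.

(** Pointwise, (x - a)^+ - (x - b)^+ is b - a for x > b, vanishes for x <= a, and lies in between
    otherwise. *)
Lemma tail_squeeze a b : a < b ->
  (b - a) * fine (mu [set s | b < X s]) <=
  \int[mu]_(s in S) Num.max (X s - a) 0 - \int[mu]_(s in S) Num.max (X s - b) 0 <=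
  (b - a) * fine (mu [set s | a < X s]).
Proof.
move=> ab.
have tailE t : fine (mu [set s | t < X s]) = \int[mu]_(s in S) (t < X s)%R%:R.
  rewrite (prob_support _ muS) -integral_indic//; congr fine.
  by apply: eq_integral => s _; rewrite indicE mem_setE.
have it t : mu.-integrable S (EFin \o (fun s => (t < X s)%R%:R)).
  by apply: (@bounded_integrable _ mu _ _ 1) => s _; rewrite normr_nat lern1 leq_b1.
have ip := positive_part_integrable.
rewrite !tailE -!(RintegralZl _ mS (it _)) -RintegralB//.
apply/andP; split; apply: le_Rintegral => //.
- exact: integrableZ_EFin.
- exact: integrableB_EFin.
- move=> s _; case: ltP => h; rewrite ?mulr1 ?mulr0.
    by rewrite !max_l//; lra.
  by rewrite subr_ge0 ge_max !le_max lexx orbT andbT; apply/orP; left; lra.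
- exact: integrableB_EFin.
- exact: integrableZ_EFin.
- move=> s _; case: ltP => h; rewrite ?mulr1 ?mulr0.
    rewrite max_l; last by lra.
    have : X s - b <= Num.max (X s - b) 0 by rewrite le_max lexx.
    lra.
  by rewrite !max_r; lra.
Qed.

End light_traffic.

End moment_bounds.

End gbs_structure.

(** * The limit along the sequence of systems *)

Theorem theorem1 (R : realType) (gamma : nat) (beta : R)
    (r : nat -> R) (f xstar : R -> R)
    (gamma_ge1 : (1 <= gamma)%N) (beta_gt0 : 0 < beta)
    (r_gt0 : forall k, 0 < r k) (r_incr : increasing_seq r)
    (r_oo : r k @[k --> \oo] --> +oo)
    (f_gt0 : forall k, 0 < f (r k))
    (f_small : f (r k) / r k @[k --> \oo] --> (0 : R))
    (f_large : f (r k) / Num.sqrt (r k) @[k --> \oo] --> +oo) :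
  let g k := GBS (r k) beta gamma%:R (f (r k)) (xstar (r k)) in
  let S k := state_space (g k) in
  let Q k := generator (g k) in
  (forall k, exists P, is_ctmc (S k) (Q k) P) /\
  forall P : nat -> R -> state -> state -> R,
    (forall k, is_ctmc (S k) (Q k) (P k)) ->
    [/\ (forall k, irreducible (S k) (P k)),
        (\forall k \near \oo, positive_recurrent (S k) (P k)),
        (\forall k \near \oo, exists2 mu, stationary (S k) (P k) mu &
           forall mu', stationary (S k) (P k) mu' -> forall A, mu' A = mu A) &
        forall mu : nat -> probability state R,
          (\forall k \near \oo, stationary (S k) (P k) (mu k)) ->
          [/\ cvg_in_distribution mu (fun k => scaled_level (g k))
                (normal_prob 0 (Num.sqrt (beta * gamma%:R)^-1)),
              ('E_(mu k)[(scaled_level (g k))^\+])%E @[k --> \oo] -->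
                ((Num.sqrt (2 * pi))^-1 * (Num.sqrt (beta * gamma%:R))^-1)%:E &
              ('E_(mu k)[(scaled_level (g k))^\-])%E @[k --> \oo] -->
                ((Num.sqrt (2 * pi))^-1 * (Num.sqrt (beta * gamma%:R))^-1)%:E]].
Proof.
move=> g S Q; split.
  by move=> k; eexists; exact: uniform_semigroup_ctmc (r_gt0 k) (f_gt0 k).
move=> P HP.
have ex k : exists mu, stationary (S k) (P k) mu.
  have [mu bal] := balanced_exists (xstar (r k)) gamma_ge1 beta_gt0 (r_gt0 k) (f_gt0 k).
  by exists mu; exact: balanced_stationary (HP k) bal.
split.
- by move=> k; exact: ctmc_irreducible (HP k).
- by apply: nearW => k; have [mu st] := ex k; exact: ctmc_positive_recurrent (HP k) st.
- apply: nearW => k; have [mu st] := ex k; exists mu => // mu' st'.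
  exact: stationary_unique (HP k) st st'.
move=> mu st.
pose sr k := Num.sqrt (r k); have sr_gt0 k : 0 < sr k by rewrite sqrtr_gt0.
have bg : 0 < beta * gamma%:R by rewrite mulr_gt0// ltr0n.
have g1 : 1 <= gamma%:R :> R by rewrite ler1n.
pose sg := Num.sqrt (beta * gamma%:R)^-1.
have sg_gt0 : 0 < sg by rewrite sqrtr_gt0 invr_gt0.
have sg2 : sg ^- 2 = beta * gamma%:R by rewrite sqr_sqrtr ?invrK// invr_ge0 ltW.
have sr_oo : (sr k)^-1 @[k --> \oo] --> (0 : R).
  have h : (r k)^-1 @[k --> \oo] --> (0 : R) by apply/gtr0_cvgV0 => //; exact: nearW.
  have -> : (fun k => (sr k)^-1) = Num.sqrt \o (fun k => (r k)^-1).
    by apply/funext => k; rewrite /= sqrtrV// ltW.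
  by rewrite -(sqrtr0 R); apply: cvg_comp h _; exact: sqrt_continuous.
pose W k := deviation_bound gamma beta (r k) (f (r k)).
have W0 : W k / sr k @[k --> \oo] --> (0 : R).
  (* The overshoot contributes r / f to the deviation, which after division by sqrt r is sqrt r / f;
     this is where f must dominate sqrt r. *)
  have fi : sr k / f (r k) @[k --> \oo] --> (0 : R).
    have fpos : \forall k \near \oo, 0 < f (r k) / Num.sqrt (r k).
      by apply: nearW => k; apply: divr_gt0 => //; exact: sr_gt0.
    have -> : (fun k => sr k / f (r k)) = (fun k => (f (r k) / Num.sqrt (r k))^-1).
      by apply/funext => k; rewrite invf_div.
    exact: (gtr0_cvgV0 fpos).2.
  have -> : (fun k => W k / sr k) = (fun k => (3 * gamma%:R ^+ 2 + 1) * (sr k)^-1 +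
      gamma%:R / beta * (sr k / f (r k))).
    apply/funext => k; rewrite /W /deviation_bound -{1}[r k]sqr_sqrtr ?ltW// -/(sr k).
    by field; rewrite !gt_eqF.
  rewrite -[X in _ --> X]addr0; apply: cvgD.
    by rewrite -[X in _ --> X](mulr0 (3 * gamma%:R ^+ 2 + 1)); apply: cvgM => //; exact: cvg_cst.
  by rewrite -[X in _ --> X](mulr0 (gamma%:R / beta)); apply: cvgM => //; exact: cvg_cst.
have light : \forall k \near \oo,
    (gamma%:R - 1) * (beta * f (r k) + beta) <= r k / 2 /\ beta * f (r k) + beta <= r k.
  (* For large k both f and 1 are at most dl * r, so that beta * gamma * (f + 1) <= r / 2; as gamma
     >= 1 this implies both inequalities. *)
  pose dl := (4 * (beta * gamma%:R))^-1; have dl0 : 0 < dl by rewrite invr_gt0 mulr_gt0.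
  have dlE : (beta * gamma%:R) * dl = 4^-1 by rewrite /dl; field; rewrite !gt_eqF// ltr0n.
  have fs : \forall k \near \oo, `|f (r k) / r k| <= dl.
    by move: f_small => /cvgr0Pnorm_le; apply.
  have rs : \forall k \near \oo, dl^-1 <= r k by move: r_oo => /cvgryPge; apply.
  near=> k.
  have h1 : f (r k) <= dl * r k.
    rewrite -ler_pdivrMr//; apply: le_trans (ler_norm _) _.
    by near: k; exact: fs.
  have h2 : 1 <= dl * r k.
    by rewrite -ler_pdivrMl// mulr1; near: k; exact: rs.
  have h3 : beta * gamma%:R * (f (r k) + 1) <= r k / 2.
    have := ler_wpM2l (ltW bg) (lerD h1 h2).
    by rewrite -mulrDl mulrA mulrDr dlE; lra.
  have f0 := f_gt0 k; have b1 : 0 <= beta * (f (r k) + 1) by rewrite mulr_ge0 ?ltW ?addr_gt0.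
  have b2 : beta * (f (r k) + 1) <= beta * gamma%:R * (f (r k) + 1).
    by rewrite mulrAC ler_peMr.
  split; last by have := r_gt0 k; lra.
  by apply: le_trans h3; lra.
pose X k := scaled_level (g k).
pose e k a := \int[mu k]_(s in S k) Num.max (X k s - a) 0.
have bal : \forall k \near \oo, balanced gamma beta (r k) (f (r k)) (xstar (r k)) (mu k).
  by near=> k; apply: (stationary_balanced gamma_ge1 beta_gt0 (r_gt0 k) (f_gt0 k) (HP k)); near: k.
have eA a : e k a @[k --> \oo] --> normal_excess sg a.
  have [phi [C [C0 phiC stein]]] := stein_solution sg_gt0 a; rewrite sg2 in stein.
  apply: (@cvgr_dist_squeeze _ _ (fun k => C * (beta * W k + 1) / sr k)).
    near=> k; have [s1 s2] : (gamma%:R - 1) * (beta * f (r k) + beta) <= r k / 2 /\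
      beta * f (r k) + beta <= r k by near: k.
    have bk : balanced gamma beta (r k) (f (r k)) (xstar (r k)) (mu k) by near: k.
    exact: (stein_estimate gamma_ge1 beta_gt0 (r_gt0 k) (f_gt0 k) bk s1 s2 C0 phiC stein).
  have -> : (fun k => C * (beta * W k + 1) / sr k) =
      (fun k => C * (beta * (W k / sr k) + (sr k)^-1)).
    by apply/funext => k; ring.
  rewrite -[X in _ --> X](mulr0 C) -[X in C * X]addr0; apply: cvgM; first exact: cvg_cst.
  apply: cvgD => //; rewrite -[X in _ --> X](mulr0 beta); apply: cvgM => //; exact: cvg_cst.
pose pr k a := fine (mu k [set s | a < X k s]).
have prT x : pr k x @[k --> \oo] --> normal_tail sg x.
  apply: (tail_from_excess (e := e) _ eA (is_derive_normal_excess sg_gt0 x)).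
  near=> k => a b ab.
  have [s1 s2] : (gamma%:R - 1) * (beta * f (r k) + beta) <= r k / 2 /\
    beta * f (r k) + beta <= r k by near: k.
  have bk : balanced gamma beta (r k) (f (r k)) (xstar (r k)) (mu k) by near: k.
  exact: (tail_squeeze gamma_ge1 beta_gt0 (r_gt0 k) (f_gt0 k) bk s1 s2 ab).
have mean0 : \int[mu k]_(s in S k) X k s @[k --> \oo] --> (0 : R).
  apply: (@cvgr_dist_squeeze _ _ (fun k => gamma%:R^-1 * (W k / sr k))).
    near=> k; have [s1 s2] : (gamma%:R - 1) * (beta * f (r k) + beta) <= r k / 2 /\
      beta * f (r k) + beta <= r k by near: k.
    have bk : balanced gamma beta (r k) (f (r k)) (xstar (r k)) (mu k) by near: k.
    rewrite subr0 mulrCA -invfM.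
    exact: (mean_scaled_level gamma_ge1 beta_gt0 (r_gt0 k) (f_gt0 k) bk s1 s2).
  by rewrite -[X in _ --> X](mulr0 gamma%:R^-1); apply: cvgM => //; exact: cvg_cst.
have Xint : \forall k \near \oo, [/\ mu k (S k) = 1%E,
    (mu k).-integrable (S k) (EFin \o X k) &
    (mu k).-integrable (S k) (EFin \o (fun s => Num.max (X k s - 0) 0))].
  near=> k; have [s1 s2] : (gamma%:R - 1) * (beta * f (r k) + beta) <= r k / 2 /\
    beta * f (r k) + beta <= r k by near: k.
  have bk : balanced gamma beta (r k) (f (r k)) (xstar (r k)) (mu k) by near: k.
  split; first by case: bk.
    exact: (scaled_level_integrable gamma_ge1 beta_gt0 (r_gt0 k) (f_gt0 k) bk s1 s2).
  exact: (positive_part_integrable gamma_ge1 beta_gt0 (r_gt0 k) (f_gt0 k) bk s1 s2).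
rewrite -(normal_excess0 bg) -/sg; split.
- move=> x _; have : (1 - pr k x)%:E @[k --> \oo] --> (1 - normal_tail sg x)%:E.
    by apply: cvg_EFin; [exact: nearW|apply: cvgB => //; exact: cvg_cst].
  have -> : (fun k => (1 - pr k x)%:E) = (fun k => mu k [set w | X k w <= x]).
    apply/funext => k; have -> : [set w | X k w <= x] = ~` [set s | x < X k s].
      by apply/seteqP; split=> s /=; rewrite leNgt => /negP.
    by rewrite probability_setC// EFinB /pr fineK// fin_num_measure.
  by rewrite -normal_probE.
- have : (e k 0)%:E @[k --> \oo] --> (normal_excess sg 0)%:E.
    by apply: cvg_EFin; [exact: nearW|exact: eA].
  apply: cvg_trans; apply: near_eq_cvg; near=> k.
  have [S1 iX ip] : [/\ mu k (S k) = 1%E,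
    (mu k).-integrable (S k) (EFin \o X k) &
    (mu k).-integrable (S k) (EFin \o (fun s => Num.max (X k s - 0) 0))] by near: k.
  rewrite (expectation_support (A := S k)) => [||s|] //.
  + by congr EFin; apply: eq_Rintegral => s _; rewrite /funrpos subr0.
  + have -> : (scaled_level (g k))^\+ = (fun s => Num.max (X k s - 0) 0) => //.
    by apply/funext => s; rewrite /funrpos subr0.
have : (e k 0 - \int[mu k]_(s in S k) X k s)%:E @[k --> \oo] --> (normal_excess sg 0)%:E.
  apply: cvg_EFin; first exact: nearW.
  by rewrite -[normal_excess _ _]subr0; apply: cvgB => //; exact: eA.
apply: cvg_trans; apply: near_eq_cvg; near=> k.
have [S1 iX ip] : [/\ mu k (S k) = 1%E,
  (mu k).-integrable (S k) (EFin \o X k) &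
  (mu k).-integrable (S k) (EFin \o (fun s => Num.max (X k s - 0) 0))] by near: k.
have negE : (scaled_level (g k))^\- = (fun s => Num.max (X k s - 0) 0 - X k s).
  by apply/funext => s; rewrite /funrneg subr0 -/(X k s) addr_maxl subrr sub0r maxC.
rewrite (expectation_support (A := S k)) => [||s|] //.
- by congr EFin; rewrite negE RintegralB.
- by rewrite negE; exact: integrableB_EFin.
Unshelve. all: by end_near.
Qed.
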